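(* Let $G$ be a simple graph on $n$ nodes with degeneracy $d$, and let $H$ be a pattern graph on $k$ nodes. If $H$ is a complete multipartite graph, then one can compute $\hom(H,G)$ and $\mathrm{sub}(H,G)$ in time $f(d,k)\cdot\tilde{O}(n)$. If $H$ is obtained from a complete multipartite graph by adding $\epsilon$ edges, then one can compute $\mathrm{sub}(H,G)$ in time $f(d,k)\cdot\tilde{O}(n^{\lfloor \epsilon/4\rfloor+2})$. Here $f$ is some computable function.
   Context: The degeneracy of $G$ is the smallest $d$ such that $G$ admits an acyclic orientation in which every node has out-degree at most $d$. $\hom(H,G)$ is the number of homomorphisms from $H$ to $G$; $\mathrm{sub}(H,G)$ is the number of subgraphs of $G$ isomorphic to $H$. Conventions: $k=O(1)$, asymptotic notation hides $\mathrm{poly}(k)$ factors, and $\tilde O(\cdot)$ additionally hides $\mathrm{polylog}(ndk)$ factors. *)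

(* Defs.v *)
From mathcomp Require Import all_boot.

Set Implicit Arguments.
Unset Strict Implicit.
Unset Printing Implicit Defensive.

(** * Simple graphs *)

Record sgraph (n : nat) := SGraph {
  adj :> 'I_n -> 'I_n -> bool;
  adj_sym : forall u v, adj u v = adj v u;
  adj_irr : forall u, adj u u = false
}.

Definition edges n (G : sgraph n) : {set {set 'I_n}} :=
  [set [set u; v] | u in 'I_n, v in [pred w | G u w]].

Definition orientation n (G : sgraph n) (o : rel 'I_n) : Prop :=
  forall u v, G u v = (o u v || o v u) /\ ~~ (o u v && o v u).

Definition acyclic n (o : rel 'I_n) : Prop :=
  forall p : seq 'I_n, p != [::] -> ~~ cycle o p.

Definition orientable_within n (G : sgraph n) (d : nat) : Prop :=
  exists o : rel 'I_n,
    [/\ orientation G o, acyclic o & forall u, #|[set v | o u v]| <= d].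

Definition degeneracy n (G : sgraph n) (d : nat) : Prop :=
  orientable_within G d /\ forall d', orientable_within G d' -> d <= d'.

(** The edgeless graph (one part) and the cliques (singleton parts) are
    complete multipartite. *)
Definition complete_multipartite k (H : sgraph k) : Prop :=
  exists2 P : {set {set 'I_k}}, partition P [set: 'I_k] &
    forall u v, H u v = (pblock P u != pblock P v).

Definition multipartite_plus k (eps : nat) (H : sgraph k) : Prop :=
  exists M : sgraph k,
    [/\ complete_multipartite M, edges M \subset edges H &
        #|edges H :\: edges M| = eps].

Definition hom k n (H : sgraph k) (G : sgraph n) : nat :=
  #|[set phi : {ffun 'I_k -> 'I_n} |
      [forall u, forall v, H u v ==> G (phi u) (phi v)]]|.

(** A subgraph, not necessarily induced, is a pair (vertex set, edge set). *)
Definition is_subgraph n (G : sgraph n)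
    (S : {set 'I_n} * {set {set 'I_n}}) : bool :=
  (S.2 \subset edges G) && [forall e in S.2, e \subset S.1].

Definition isomorphic_to k n (H : sgraph k)
    (S : {set 'I_n} * {set {set 'I_n}}) : bool :=
  [exists phi : {ffun 'I_k -> 'I_n},
    [&& injectiveb phi, [set phi u | u : 'I_k] == S.1 &
        [forall u, forall v, H u v == ([set phi u; phi v] \in S.2)]]].

Definition sub k n (H : sgraph k) (G : sgraph n) : nat :=
  #|[set S : {set 'I_n} * {set {set 'I_n}} |
      is_subgraph G S && isomorphic_to H S]|.

(** * Random access machines with logarithmic cost

    A program uses finitely many arrays, named by numerals; every array has a
    cell for each natural number, and a cell holds a natural number.  Array
    indices are computed at run time, array names are not.  Evaluating an
    expression costs the total bit length of all the values computed on the
    way, array indices included. *)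

Inductive expr : Type :=
  | Const of nat
  | Get of nat & expr
  | Add of expr & expr
  | Sub of expr & expr
  | Mul of expr & expr
  | Div of expr & expr
  | Leq of expr & expr.

Inductive cmd :=
  | Skip
  | Assign of nat & expr & expr
  | Seq of cmd & cmd
  | If of expr & cmd & cmd
  | While of expr & cmd.

Definition store := nat -> nat -> nat.

Definition update (s : store) (a i x : nat) : store :=
  fun b j => if (b == a) && (j == i) then x else s b j.

Fixpoint eval (s : store) (e : expr) : nat :=
  match e with
  | Const x => x
  | Get a e1 => s a (eval s e1)
  | Add e1 e2 => eval s e1 + eval s e2
  | Sub e1 e2 => eval s e1 - eval s e2
  | Mul e1 e2 => eval s e1 * eval s e2
  | Div e1 e2 => eval s e1 %/ eval s e2
  | Leq e1 e2 => eval s e1 <= eval s e2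
  end.

Definition bitlen (x : nat) : nat := (trunc_log 2 x).+1.

Fixpoint ecost (s : store) (e : expr) : nat :=
  bitlen (eval s e) +
  match e with
  | Const _ => 0
  | Get _ e1 => ecost s e1
  | Add e1 e2 | Sub e1 e2 | Mul e1 e2 | Div e1 e2 | Leq e1 e2 =>
      ecost s e1 + ecost s e2
  end.

(** [exec c s t s']: started in [s], the command [c] halts in [s'] after
    time [t]. *)
Inductive exec : cmd -> store -> nat -> store -> Prop :=
  | exec_skip s : exec Skip s 1 s
  | exec_assign s a i e :
      exec (Assign a i e) s (1 + ecost s i + ecost s e)
        (update s a (eval s i) (eval s e))
  | exec_seq c1 c2 s t1 s1 t2 s2 :
      exec c1 s t1 s1 -> exec c2 s1 t2 s2 ->
      exec (Seq c1 c2) s (t1 + t2) s2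
  | exec_if_true e c1 c2 s t s1 :
      eval s e != 0 -> exec c1 s t s1 ->
      exec (If e c1 c2) s (1 + ecost s e + t) s1
  | exec_if_false e c1 c2 s t s1 :
      eval s e = 0 -> exec c2 s t s1 ->
      exec (If e c1 c2) s (1 + ecost s e + t) s1
  | exec_while_true e c s t1 s1 t2 s2 :
      eval s e != 0 -> exec c s t1 s1 -> exec (While e c) s1 t2 s2 ->
      exec (While e c) s (1 + ecost s e + t1 + t2) s2
  | exec_while_false e c s :
      eval s e = 0 -> exec (While e c) s (1 + ecost s e) s.

Lemma exec_det c s t1 s1 t2 s2 :
  exec c s t1 s1 -> exec c s t2 s2 -> t1 = t2 /\ s1 = s2.
Proof.
move=> E; move: E t2 s2; elim=> {c s t1 s1}; intros;
  match goal with h : exec _ _ ?t ?s |- _ /\ _ = ?s => inversion h; subst end;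
  try match goal with
    | a : is_true (eval ?s ?e != 0), b : eval ?s ?e = 0 |- _ =>
        by rewrite b in a
    end;
  repeat match goal with
    | IH : forall t s, exec ?c ?s0 t s -> _, h : exec ?c ?s0 _ _ |- _ =>
        case: (IH _ _ h) => ? ?; subst; clear h IH
    end; by [].
Qed.

(** The i-th sequence of the input is loaded in array i, all other cells are
    0; the output is read in cell 0 of array 0. *)
Definition load (input : seq (seq nat)) : store :=
  fun a i => nth 0 (nth [::] input a) i.

Definition outputs_within (p : cmd) (input : seq (seq nat)) (x T : nat) : Prop :=
  exists t s, [/\ exec p (load input) t s, s 0 0 = x & t <= T].

Definition computable2 (f : nat -> nat -> nat) : Prop :=
  exists p : cmd, forall x y, exists t,
    outputs_within p [:: [:: x; y]] (f x y) t.

(** * Input format and time bounds *)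

(** The lists may be in any order. *)
Definition adjacency_lists n (G : sgraph n) (L : 'I_n -> seq 'I_n) : Prop :=
  forall v, perm_eq (L v) (enum [pred w | G v w]).

(** The pattern is given by its adjacency matrix, row by row; the host graph by
    its adjacency lists, concatenated: the list of node v occupies the cells
    from offset v (included) to offset v+1 (excluded). *)
Definition encode k n (H : sgraph k) (L : 'I_n -> seq 'I_n) : seq (seq nat) :=
  [:: [:: k; n];
      [seq nat_of_bool (H u v) | u <- enum 'I_k, v <- enum 'I_k];
      0 :: scanl addn 0 [seq size (L v) | v <- enum 'I_n];
      flatten [seq [seq val w | w <- L v] | v <- enum 'I_n]].

(** [soft_bound c n d k e] is n^e up to poly(k) and polylog(ndk) factors, all
    governed by the constant [c].  The shifts only matter when one of [n], [d],
    [k] is 0, where n^e or log(ndk) would vanish or be undefined. *)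
Definition soft_bound (c n d k e : nat) : nat :=
  c * k.+1 ^ c * maxn 1 n ^ e * bitlen (n.+1 * d.+1 * k.+1) ^ c.

(* Main.v *)
Require Import Defs.
From mathcomp Require Import all_boot zify.

(** Removing in rounds the vertices of at most twice the average degree orients
    [G] with out-degrees at most [4 * d].  A homomorphism then orients every
    edge of [H], and inclusion-exclusion over identifications of non-adjacent
    vertices enforces injectivity.  So [hom H G], and [sub H G] times the number
    of automorphisms of [H], are signed sums, over digraphs [q] on the vertices
    of [H], of the number of maps that satisfy a constraint on each arc of [q]:
    an edge of [H] is one arc of [q], whose ends must be mapped to an arc of
    [G], and an identified pair is two opposite arcs.

    Such a map is determined by the images of one root in each source component
    of [q], and by the indices of the out-neighbours used to follow the arcs.
    Counting becomes cheaper when [q] is cut along a centre [W] that no arc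
    leaves: the components outside [W] interact only through [W], so their
    counts can be tabulated by their boundary values and multiplied, and the
    exponent of [n] is the largest number of roots in a single piece.

    For a complete multipartite graph plus [eps] edges, let [s] reach as many
    vertices as possible.  The vertices that [s] does not reach lie in one part,
    so that one-way arcs between them are added edges.  Let [W] be the set
    reached from [s] and from further vertices, chosen one by one as long as one
    of them reaches four new added edges: there are at most [eps %/ 4] of them.
    In the end no vertex outside [W] reaches four added edges, and then a
    component has at most three source components; for [eps < 4] one further
    vertex is enough to leave a single source in each component.  The program
    finds the best centre by exhaustive search, hence it needs no knowledge of
    the parts. *)

Set Implicit Arguments.
Unset Strict Implicit.
Unset Printing Implicit Defensive.

(** The machine charges bit lengths, so every number that occurs has to be bounded, not only the
    number of operations. The algorithm is therefore written in a language with bounded loops and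
    compiled; a syntactic typing bounds all values by [Z ^ (K ^ L)], where [Z = n.+1 * K], [K]
    depends on [d] and [k] only, and [L] is a numeral. Bit lengths are then logarithmic in [n] up to
    a factor in [d] and [k]. Outside the preparation, the loop over candidate maps is the only one
    whose length grows with [n], and this length is what the search for a certificate minimises.

    Injectivity is enforced by sets of identified pairs, not by set partitions: the sign is a
    parity, and for a map that is not injective toggling one pair cancels the terms.

    The number four: a place where several sources first meet is entered by at least two one-way
    arcs. With at most three such arcs below any vertex, no source sees two such places, so the
    sources of a component all meet in one place, and each enters it by an arc of its own. *)

(** * A language with bounded loops and its compilation *)

Inductive bop := OAdd | OSub | OMul | ODiv | OMod | OMin | OLeq | OLt | OEq.

Definition opd (o : bop) (x y : nat) : nat :=
  match o with
  | OAdd => x + y | OSub => x - y | OMul => x * y | ODiv => x %/ y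
  | OMod => x %% y | OMin => minn x y
  | OLeq => x <= y | OLt => x < y | OEq => x == y
  end.

(** Variables are levels counted from the outermost binder. The number of rounds of a loop is fixed
    on entry, so programs denote total functions and need no termination argument. *)
Inductive xe :=
  | Cst of nat | Var of nat | Arr of nat & xe | Bin of bop & xe & xe
  | Sum of xe & xe | Prd of xe & xe.

Inductive il :=
  | Nop | Put of nat & xe & xe | Sq of il & il | Ite of xe & il & il
  | For of xe & il.

Fixpoint ev (s : store) (e : xe) (env : seq nat) : nat :=
  match e with
  | Cst c => c
  | Var l => nth 0 env l
  | Arr a i => s a (ev s i env)
  | Bin o e1 e2 => opd o (ev s e1 env) (ev s e2 env)
  | Sum l b => \sum_(i < ev s l env) ev s b (rcons env i)
  | Prd l b => \prod_(i < ev s l env) ev s b (rcons env i)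
  end.

Fixpoint run (p : il) (env : seq nat) (s : store) : store :=
  match p with
  | Nop => s
  | Put a i e => update s a (ev s i env) (ev s e env)
  | Sq p q => run q env (run p env s)
  | Ite e p q => if ev s e env != 0 then run p env s else run q env s
  | For l p => iteri (ev s l env) (fun i s' => run p (rcons env i) s') s
  end.

(** Number of machine commands executed, up to a constant factor. *)
Fixpoint wke (s : store) (e : xe) (env : seq nat) : nat :=
  match e with
  | Cst _ | Var _ => 1
  | Arr _ i => 1 + wke s i env
  | Bin _ e1 e2 => 1 + wke s e1 env + wke s e2 env
  | Sum l b | Prd l b =>
      4 + wke s l env + \sum_(i < ev s l env) (3 + wke s b (rcons env i))
  end.

Fixpoint wk (p : il) (env : seq nat) (s : store) : nat :=
  match p with
  | Nop => 1
  | Put _ i e => 1 + wke s i env + wke s e env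
  | Sq p q => wk p env s + wk q env (run p env s)
  | Ite e p q => 1 + wke s e env +
                 if ev s e env != 0 then wk p env s else wk q env s
  | For l p => 2 + wke s l env + \sum_(i < ev s l env)
      (2 + wk p (rcons env i) (iteri i (fun j s' => run p (rcons env j) s') s))
  end.

(** A sum bounds its own partial sums, but a partial product exceeds the final one when a later
    factor is 0; hence the different clauses for [Sum] and [Prd]. *)
Fixpoint okv (V : nat) (s : store) (e : xe) (env : seq nat) : Prop :=
  match e with
  | Cst c => c <= V
  | Var l => nth 0 env l <= V
  | Arr a i => okv V s i env /\ s a (ev s i env) <= V
  | Bin o e1 e2 => [/\ okv V s e1 env, okv V s e2 env &
                      opd o (ev s e1 env) (ev s e2 env) <= V]
  | Sum l b => [/\ okv V s l env,
      forall i, i < ev s l env -> okv V s b (rcons env i) &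
      ev s (Sum l b) env <= V]
  | Prd l b => [/\ okv V s l env,
      forall i, i < ev s l env -> okv V s b (rcons env i) &
      forall j, j <= ev s l env -> \prod_(i < j) ev s b (rcons env i) <= V]
  end.

Fixpoint okp (V : nat) (p : il) (env : seq nat) (s : store) : Prop :=
  match p with
  | Nop => True
  | Put _ i e => okv V s i env /\ okv V s e env
  | Sq p q => okp V p env s /\ okp V q env (run p env s)
  | Ite e p q => okv V s e env /\
                 if ev s e env != 0 then okp V p env s else okp V q env s
  | For l p => okv V s l env /\ forall i, i < ev s l env ->
      okp V p (rcons env i) (iteri i (fun j s' => run p (rcons env j) s') s)
  end.

(** Array 4 of the machine is used as an evaluation stack; the array [a] of
    the source program is the array [bump 4 a] of the machine, so that the
    four input arrays keep their names. *)
Notation stk j := (Get 4 (Const j)).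

Definition opx (o : bop) (x y : expr) : expr :=
  match o with
  | OAdd => Add x y | OSub => Defs.Sub x y | OMul => Mul x y | ODiv => Div x y
  | OMod => Defs.Sub x (Mul (Div x y) y)
  | OMin => Defs.Sub x (Defs.Sub x y)
  | OLeq => Leq x y | OLt => Leq (Add x (Const 1)) y
  | OEq => Mul (Leq x y) (Leq y x)
  end.

Definition setk j e := Assign 4 (Const j) e.

(** Cell [t] holds the number of rounds, cell [t.+1] the index of the current one. *)
Definition loop t c :=
  While (Leq (Add (stk t.+1) (Const 1)) (stk t))
    (Seq c (setk t.+1 (Add (stk t.+1) (Const 1)))).

(** The value of [e] is left in cell [t], and the cells below [t] are not touched; [cv] lists the
    cells that hold the indices of the enclosing loops. A level outside [cv] reads as 0, like the
    default of [nth] in [ev]. *)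
Fixpoint cmpe (cv : seq nat) (t : nat) (e : xe) : cmd :=
  match e with
  | Cst c => setk t (Const c)
  | Var l => setk t (if l < size cv then stk (nth 0 cv l) else Const 0)
  | Arr a i => Seq (cmpe cv t i) (setk t (Get (bump 4 a) (stk t)))
  | Bin o e1 e2 => Seq (Seq (cmpe cv t e1) (cmpe cv t.+1 e2))
                     (setk t (opx o (stk t) (stk t.+1)))
  | Sum l b => Seq (Seq (Seq (Seq (cmpe cv t l) (setk t.+1 (Const 0)))
        (setk t.+2 (Const 0)))
      (loop t (Seq (cmpe (rcons cv t.+1) t.+3 b)
                 (setk t.+2 (Add (stk t.+2) (stk t.+3))))))
      (setk t (stk t.+2))
  | Prd l b => Seq (Seq (Seq (Seq (cmpe cv t l) (setk t.+1 (Const 0)))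
        (setk t.+2 (Const 1)))
      (loop t (Seq (cmpe (rcons cv t.+1) t.+3 b)
                 (setk t.+2 (Mul (stk t.+2) (stk t.+3))))))
      (setk t (stk t.+2))
  end.

Fixpoint cmpi (cv : seq nat) (t : nat) (p : il) : cmd :=
  match p with
  | Nop => Skip
  | Put a i e => Seq (Seq (cmpe cv t i) (cmpe cv t.+1 e))
                   (Assign (bump 4 a) (stk t) (stk t.+1))
  | Sq p q => Seq (cmpi cv t p) (cmpi cv t q)
  | Ite e p q => Seq (cmpe cv t e) (If (stk t) (cmpi cv t p) (cmpi cv t q))
  | For l p => Seq (Seq (cmpe cv t l) (setk t.+1 (Const 0)))
                 (loop t (cmpi (rcons cv t.+1) t.+2 p))
  end.

(** Stack cells in use above the base. *)
Fixpoint dpe (e : xe) : nat :=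
  match e with
  | Cst _ | Var _ => 0
  | Arr _ i => dpe i
  | Bin _ e1 e2 => maxn (dpe e1) (dpe e2).+1
  | Sum l b | Prd l b => maxn (dpe l) (dpe b).+3
  end.

Fixpoint dpi (p : il) : nat :=
  match p with
  | Nop => 0
  | Put _ i e => maxn (dpe i) (dpe e).+1
  | Sq p q => maxn (dpi p) (dpi q)
  | Ite e p q => maxn (dpe e) (maxn (dpi p) (dpi q))
  | For l p => maxn (dpe l) (dpi p).+2
  end.

(** * Bit lengths and correctness of the compiled code *)

Lemma bitlen_gt0 x : 0 < bitlen x. Proof. by []. Qed.

Lemma leq_bitlen x y : x <= y -> bitlen x <= bitlen y.
Proof. by move=> h; rewrite /bitlen ltnS leq_trunc_log. Qed.

Lemma ltn_bitlen x : x < 2 ^ bitlen x.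
Proof. exact: trunc_log_ltn. Qed.

Lemma bitlen_min x b : 0 < b -> x < 2 ^ b -> bitlen x <= b.
Proof.
case: x => [|x] // b0 h; rewrite /bitlen -(@ltn_exp2l 2) //.
exact: leq_ltn_trans (trunc_logP _ _) h.
Qed.

Lemma bitlenS x : bitlen x.+1 <= 2 * bitlen x.
Proof.
have b0 := bitlen_gt0 x; apply: leq_trans (_ : _ <= (bitlen x).+1) _; last lia.
by apply: bitlen_min => //; rewrite expnS; have := ltn_bitlen x; lia.
Qed.

(** Nothing is said about the stack from [t] on: it is scratch space. The cells of [cv] lie below
    [t], so that evaluation above [t] preserves the environment. *)
Record sim (cv : seq nat) (t : nat) (m : store) (env : seq nat) (s : store) :
    Prop := Sim {
  sim_arr : forall a i, m (bump 4 a) i = s a i;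
  sim_size : size cv = size env;
  sim_lt : all (fun j => j < t) cv;
  sim_env : forall l, l < size cv -> m 4 (nth 0 cv l) = nth 0 env l
}.

Lemma sim_eq cv t m m' env s :
  sim cv t m env s -> (forall a i, m' (bump 4 a) i = m (bump 4 a) i) ->
  (forall j, j < t -> m' 4 j = m 4 j) -> sim cv t m' env s.
Proof.
case=> h1 h2 h3 h4 ha hj; split => // [a i|l hl]; first by rewrite ha h1.
by rewrite hj ?h4 //; apply: (allP h3); apply: mem_nth.
Qed.

Lemma sim_weak cv t t' m env s : t <= t' -> sim cv t m env s -> sim cv t' m env s.
Proof.
move=> h [h1 h2 h3 h4]; split => //.
by apply/allP => j /(allP h3) /leq_trans; apply.
Qed.

Lemma sim_push cv t m env s i : sim cv t m env s -> m 4 t.+1 = i ->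
  sim (rcons cv t.+1) t.+2 m (rcons env i) s.
Proof.
case=> h1 h2 h3 h4 e; split => //; first by rewrite !size_rcons h2.
  rewrite all_rcons ltnSn /=; apply/allP => j /(allP h3); lia.
move=> l; rewrite size_rcons !nth_rcons h2 ltnS leq_eqVlt.
by case: ltngtP => // hl _; rewrite h4 // h2.
Qed.

Lemma upd_same s a i x : update s a i x a i = x.
Proof. by rewrite /update !eqxx. Qed.

Lemma upd_arr s a i x b j : b != a -> update s a i x b j = s b j.
Proof. by rewrite /update => /negPf ->. Qed.

Lemma upd_idx s a i x b j : j != i -> update s a i x b j = s b j.
Proof. by rewrite /update => /negPf ->; rewrite andbF. Qed.

Lemma upd_bump s i x a j : update s 4 i x (bump 4 a) j = s (bump 4 a) j.
Proof. by rewrite upd_arr // eq_sym neq_bump. Qed.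

(** Machine time per unit of source work, as a multiple of the largest bit length. *)
Definition cst := 60.

(** One lemma for the accumulating loops of expressions, where [st] is constant and [Q] records the
    accumulator, and for [For], where [Q] is trivial. Execution is unconditional and only its cost
    depends on a bound [V] on the values; [B] stands for whatever the cost of the body requires of
    [V]. *)
Lemma loop_exec cv t m env s c (L : nat) (st : nat -> store)
    (Q : nat -> store -> Prop) (W : nat -> nat) (B : nat -> Prop) :
  sim cv t m env s -> m 4 t = L -> m 4 t.+1 = 0 -> Q 0 m ->
  st 0 = s ->
  (forall i m1, i < L -> Q i m1 -> sim (rcons cv t.+1) t.+2 m1 (rcons env i) (st i) ->
    exists t1 m2, [/\ exec c m1 t1 m2, sim (rcons cv t.+1) t.+2 m2 (rcons env i) (st i.+1),
      forall j, j < t.+2 -> m2 4 j = m1 4 j,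
      Q i.+1 (update m2 4 t.+1 i.+1) &
      forall V, t.+3 <= V -> L <= V -> B V -> t1 <= cst * W i * bitlen V]) ->
  exists t1 m2, [/\ exec (loop t c) m t1 m2, sim cv t m2 env (st L),
     forall j, j < t.+1 -> m2 4 j = m 4 j, Q L m2 &
     forall V, t.+3 <= V -> L <= V -> B V ->
       t1 <= cst * (1 + \sum_(i < L) (1 + W i)) * bitlen V].
Proof.
move=> hs hL h0 hQ hst step.
(* Induction on the number [r] of remaining rounds. *)
have gen r : forall i m1, i + r = L -> sim cv t m1 env (st i) -> m1 4 t = L ->
    m1 4 t.+1 = i -> Q i m1 -> 
  exists t1 m2, [/\ exec (loop t c) m1 t1 m2, sim cv t m2 env (st L),
     forall j, j < t.+1 -> m2 4 j = m1 4 j, Q L m2 &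
     forall V, t.+3 <= V -> L <= V -> B V ->
       t1 <= cst * (1 + \sum_(i <= j < L) (1 + W j)) * bitlen V].
  elim: r => [|r IH] i m1 e hs1 hL1 hi1 hQ1.
    exists (1 + ecost m1 (Leq (Add (stk t.+1) (Const 1)) (stk t))), m1.
    have ei : i = L by lia.
    split=> //.
    - by apply: exec_while_false => /=; rewrite hi1 hL1; case: leqP => //; lia.
    - by rewrite -ei.
    - by rewrite -ei.
    move=> V hV hLV _; rewrite big_geq; last lia.
    have b1 := bitlen_gt0 V; have b2 := bitlenS V.
    rewrite /= hi1 hL1 /cst.
    have := leq_bitlen hLV.
    have : bitlen (i + 1) <= 2 * bitlen V by rewrite (leq_trans _ b2) // leq_bitlen; lia.
    have : bitlen i <= bitlen V by rewrite leq_bitlen; lia.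
    have : bitlen t.+1 <= bitlen V by rewrite leq_bitlen; lia.
    have : bitlen t <= bitlen V by rewrite leq_bitlen; lia.
    have : bitlen 1 <= bitlen V by rewrite leq_bitlen; lia.
    have : bitlen (i + 1 <= L) <= bitlen V by rewrite leq_bitlen //; case: (i + 1 <= L); lia.
    lia.
  have hi : i < L by lia.
  have := step i m1 hi hQ1 (sim_push hs1 hi1).
  case=> t1 [m2 [e1 s2 f2 q2 c2]].
  set m3 := update m2 4 t.+1 i.+1 in q2.
  have fm3 j : j < t.+1 -> m3 4 j = m1 4 j.
    by move=> hj; rewrite /m3 upd_idx ?f2 //; lia.
  have s3 : sim cv t m3 env (st i.+1).
    case: s2 => a1 a2 a3 a4; case: hs1 => b1 b2 b3 b4.
    split=> // [a j|l hl]; first by rewrite /m3 upd_bump.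
    rewrite fm3; first by rewrite b4.
    by apply: leq_trans (allP b3 _ _) _; rewrite ?mem_nth.
  have e3 : m3 4 t = L by rewrite fm3.
  have [] := IH i.+1 m3 _ s3 e3 _ q2; [lia | exact: upd_same |].
  move=> t4 [m4 [e4 s4 f4 q4 c4]].
  exists (1 + ecost m1 (Leq (Add (stk t.+1) (Const 1)) (stk t)) +
     (t1 + (1 + ecost m2 (Const t.+1) + ecost m2 (Add (stk t.+1) (Const 1)))) + t4), m4.
  have e5 : eval m2 (Add (stk t.+1) (Const 1)) = i.+1.
    by rewrite /= f2 // hi1 addn1.
  split=> //.
  - apply: exec_while_true.
    + by rewrite /= hi1 hL1 addn1 hi.
    + by apply: exec_seq e1 _; apply: exec_assign.
    + by rewrite e5.
  - by move=> j hj; rewrite f4 // fm3.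
  move=> V hV hLV hB; rewrite big_ltn //.
  have := c2 V hV hLV hB; have := c4 V hV hLV hB.
  rewrite -[ecost m2 (Add _ _)]/(bitlen (eval m2 (Add (stk t.+1) (Const 1))) +
     ((bitlen (m2 4 t.+1) + (bitlen t.+1 + 0)) + (bitlen 1 + 0))) e5.
  rewrite /= f2 // hi1 hL1.
  have b1 := bitlen_gt0 V; have b2 := bitlenS V.
  have := leq_bitlen hLV.
  have : bitlen (i + 1) <= 2 * bitlen V by rewrite (leq_trans _ b2) // leq_bitlen; lia.
  have : bitlen i.+1 <= 2 * bitlen V by rewrite (leq_trans _ b2) // leq_bitlen; lia.
  have : bitlen i <= bitlen V by rewrite leq_bitlen; lia.
  have : bitlen t.+1 <= bitlen V by rewrite leq_bitlen; lia.
  have : bitlen t <= bitlen V by rewrite leq_bitlen; lia.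
  have : bitlen 1 <= bitlen V by rewrite leq_bitlen; lia.
  have : bitlen (i + 1 <= L) <= bitlen V by rewrite leq_bitlen //; case: (i + 1 <= L); lia.
  rewrite /cst; set S := \sum_(_ <= _ < _) _; nia.
have := gen L 0 m erefl; rewrite hst => /(_ hs hL h0 hQ).
case=> t1 [m2 [a1 a2 a3 a4 a5]]; exists t1, m2; split=> // V h1 h2 h3.
by have := a5 V h1 h2 h3; rewrite big_mkord.
Qed.

Lemma exec_setk m j e : exec (setk j e) m
  (1 + bitlen j + ecost m e) (update m 4 j (eval m e)).
Proof. by have := exec_assign m 4 (Const j) e; rewrite /= !addn0. Qed.

Lemma leq_opxcost m o t V : t < V -> m 4 t <= V -> m 4 t.+1 <= V ->
  opd o (m 4 t) (m 4 t.+1) <= V ->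
  ecost m (opx o (stk t) (stk t.+1)) <= 30 * bitlen V.
Proof.
move=> hV h1 h2.
have B x : x <= V -> bitlen x <= bitlen V by apply: leq_bitlen.
have B2 x : x <= V.+1 -> bitlen x <= 2 * bitlen V.
  by move=> hx; apply: leq_trans (leq_bitlen hx) (bitlenS V).
have b1 := B _ h1; have b2 := B _ h2; have b0 := bitlen_gt0 V.
have bt : bitlen t <= bitlen V by apply: B; lia.
have bt1 : bitlen t.+1 <= bitlen V by apply: B; lia.
have bb (b : bool) : bitlen b <= bitlen V by apply: B; case: b; lia.
have bm : bitlen (m 4 t - m 4 t.+1) <= bitlen V by apply: B; lia.
have bd : bitlen (m 4 t %/ m 4 t.+1) <= bitlen V.
  by apply: B; apply: leq_trans (leq_div _ _) h1.
have be : bitlen (m 4 t %/ m 4 t.+1 * m 4 t.+1) <= bitlen V.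
  by apply: B; apply: leq_trans (leq_divM _ _) h1.
have bs : bitlen (m 4 t + 1) <= 2 * bitlen V by apply: B2; lia.
have b11 : bitlen 1 <= bitlen V by apply: B; lia.
have bq (b c : bool) : bitlen (b * c) <= bitlen V by case: b; rewrite ?mul1n ?mul0n // (bb false).
case: o => /= /B ho; try lia.
- have : bitlen (m 4 t - m 4 t %/ m 4 t.+1 * m 4 t.+1) <= bitlen V.
    by apply: B; apply: leq_trans (leq_subr _ _) h1.
  lia.
- have : bitlen (m 4 t - (m 4 t - m 4 t.+1)) <= bitlen V.
    by apply: B; apply: leq_trans (leq_subr _ _) h1.
  lia.
- by move: (bitlen (nat_of_bool _)) (bb (m 4 t + 1 <= m 4 t.+1)) => z hz; lia.
- move: (bitlen (nat_of_bool _ * _)) (bq (m 4 t <= m 4 t.+1) (m 4 t.+1 <= m 4 t)).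
  move: (bitlen (nat_of_bool _)) (bb (m 4 t <= m 4 t.+1)).
  move: (bitlen (nat_of_bool _)) (bb (m 4 t.+1 <= m 4 t)).
  by clear -b1 b2 b0 bt bt1; move=> *; lia.
Qed.

Lemma eval_opx m o t :
  eval m (opx o (stk t) (stk t.+1)) = opd o (m 4 t) (m 4 t.+1).
Proof.
case: o => //=.
- by rewrite {1}(divn_eq (m 4 t) (m 4 t.+1)) addKn.
- by rewrite minnE.
- by rewrite addn1.
- by rewrite eqn_leq; do 2 case: leq.
Qed.

Lemma okv_val V s e env : okv V s e env -> ev s e env <= V.
Proof.
case: e => [c|l|a i|o e1 e2|l b|l b] //=; try by case.
by case=> _ _; apply.
Qed.

(** The addresses of stack cells are charged as well, hence [V] must dominate the highest cell in
    use and not only the values. *)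
Lemma cmpe_exec e : forall cv t m env s, sim cv t m env s ->
  exists T m', [/\ exec (cmpe cv t e) m T m', sim cv t m' env s,
    forall j, j < t -> m' 4 j = m 4 j, m' 4 t = ev s e env &
    forall V, t + dpe e + 3 <= V -> okv V s e env ->
      T <= cst * wke s e env * bitlen V].
Proof.
have bit V x : x <= V -> bitlen x <= bitlen V by apply: leq_bitlen.
have agree cv t m env s j e1 : sim cv t m env s -> t <= j ->
    sim cv t (update m 4 j e1) env s.
  move=> hs hj; apply: sim_eq hs _ _ => [a i|i hi]; first by rewrite upd_bump.
  by rewrite upd_idx //; lia.
(* Both kinds of loop at once: [isum] selects the operation, its neutral element and the
   accumulator. *)
have bigcase (isum : bool) l b cv t m env s :
  (forall cv t m env s, sim cv t m env s ->
  exists T m', [/\ exec (cmpe cv t l) m T m', sim cv t m' env s,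
    forall j, j < t -> m' 4 j = m 4 j, m' 4 t = ev s l env &
    forall V, t + dpe l + 3 <= V -> okv V s l env ->
      T <= cst * wke s l env * bitlen V]) ->
  (forall cv t m env s, sim cv t m env s ->
  exists T m', [/\ exec (cmpe cv t b) m T m', sim cv t m' env s,
    forall j, j < t -> m' 4 j = m 4 j, m' 4 t = ev s b env &
    forall V, t + dpe b + 3 <= V -> okv V s b env ->
      T <= cst * wke s b env * bitlen V]) ->
  sim cv t m env s ->
  exists T m', [/\ exec (cmpe cv t ((if isum then Sum else Prd) l b)) m T m',
     sim cv t m' env s,
    forall j, j < t -> m' 4 j = m 4 j,
    m' 4 t = ev s ((if isum then Sum else Prd) l b) env &
    forall V, t + dpe (Sum l b) + 3 <= V ->
      okv V s ((if isum then Sum else Prd) l b) env ->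
      T <= cst * wke s (Sum l b) env * bitlen V].
  move=> IHl IHb hs.
  have [t1 [m1 [e1 s1 f1 v1 c1]]] := IHl _ _ _ _ _ hs.
  set L := ev s l env in v1.
  pose op x y := if isum then x + y else x * y.
  pose ini := if isum then 0 else 1 : nat.
  pose acc i := if isum then \sum_(j < i) ev s b (rcons env j)
                else \prod_(j < i) ev s b (rcons env j).
  pose opxx := if isum then Add else Mul.
  have accS i : acc i.+1 = op (acc i) (ev s b (rcons env i)).
    by rewrite /acc /op; case: (isum); rewrite big_ord_recr.
  have acc0 : acc 0 = ini by rewrite /acc /ini; case: (isum); rewrite big_ord0.
  set m2 := update m1 4 t.+1 0; set m3 := update m2 4 t.+2 ini.
  have s3 : sim cv t m3 env s by do 2 (apply: (agree); last lia).
  have m3t : m3 4 t = L by rewrite /m3 /m2 !upd_idx //; lia.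
  have m3t1 : m3 4 t.+1 = 0 by rewrite /m3 /m2 upd_idx ?upd_same //; lia.
  have := @loop_exec cv t m3 env s
    (Seq (cmpe (rcons cv t.+1) t.+3 b) (setk t.+2 (opxx (stk t.+2) (stk t.+3))))
    L (fun=> s) (fun i m => m 4 t.+2 = acc i)
    (fun i => 1 + wke s b (rcons env i))
    (fun V => t + dpe (Sum l b) + 3 <= V /\ okv V s ((if isum then Sum else Prd) l b) env).
  case=> //; first by rewrite /= /m3 upd_same acc0.
    move=> i m4 hi q4 s4.
    have [t5 [m5 [e5 s5 f5 v5 c5]]] := IHb _ t.+3 m4 _ _ (sim_weak (leqnSn _) s4).
    have evop : eval m5 (opxx (stk t.+2) (stk t.+3)) = acc i.+1.
      by rewrite accS /opxx /op; case: (isum); rewrite /= f5 // q4 v5.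
    exists (t5 + (1 + bitlen t.+2 + ecost m5 (opxx (stk t.+2) (stk t.+3)))).
    exists (update m5 4 t.+2 (acc i.+1)); split.
    - by rewrite -evop; apply: exec_seq e5 (exec_setk _ _ _).
    - case: s5 => a1 a2 a3 a4; case: s4 => b1 b2 b3 b4; split => //.
        by move=> a j; rewrite upd_bump.
      move=> j hj; rewrite upd_idx ?a4 //.
      by have /= := allP b3 _ (mem_nth 0 hj); lia.
    - by move=> j hj; rewrite upd_idx ?f5 //; lia.
    - by rewrite upd_idx ?upd_same //; lia.
    move=> V h1 h2 [h3 h4].
    have accV j : j <= L -> acc j <= V.
      move: h4; rewrite /acc; case: (isum) => /= -[_ _ h5] hj; last exact: h5.
      apply: leq_trans h5; rewrite -/L -(subnKC hj).
      by rewrite big_split_ord /= leq_addr.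
    have okb j : j < L -> okv V s b (rcons env j).
      by move: h4; case: (isum) => /= -[_ h5 _]; apply: h5.
    have := c5 V _ (okb i hi); have ob := okv_val (okb i hi).
    have hd : t.+3 + dpe b + 3 <= V by move: h3 => /=; lia.
    move=> /(_ hd).
    have -> : ecost m5 (opxx (stk t.+2) (stk t.+3)) =
       bitlen (acc i.+1) + ((bitlen (acc i) + (bitlen t.+2 + 0)) + (bitlen (ev s b (rcons env
         i)) + (bitlen t.+3 + 0))).
      rewrite -evop -v5 -q4 -(f5 t.+2) //.
      by rewrite /opxx; case: (isum).
    have : bitlen (acc i.+1) <= bitlen V by apply: bit; apply: accV.
    have : bitlen (acc i) <= bitlen V by apply: bit; apply: accV; lia.
    have : bitlen (ev s b (rcons env i)) <= bitlen V by apply: bit.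
    have : bitlen t.+2 <= bitlen V by apply: bit; lia.
    have : bitlen t.+3 <= bitlen V by apply: bit; lia.
    have := bitlen_gt0 V.
    rewrite /cst; nia.
  move=> t4 [m4 [e4 s4 f4 q4 c4]].
  exists (t1 + (1 + bitlen t.+1 + bitlen 0) + (1 + bitlen t.+2 + bitlen ini) + t4 +
     (1 + bitlen t + (bitlen (m4 4 t.+2) + (bitlen t.+2 + 0)))).
  exists (update m4 4 t (m4 4 t.+2)); split.
  - have E1 : exec (Seq (cmpe cv t l) (setk t.+1 (Const 0))) m (t1 + (1 + bitlen t.+1 +
    bitlen 0)) m2.
      by apply: exec_seq e1 _; have := exec_setk m1 t.+1 (Const 0); rewrite /= !addn0.
    have E2 : exec (setk t.+2 (Const ini)) m2 (1 + bitlen t.+2 + bitlen ini) m3.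
      by have := exec_setk m2 t.+2 (Const ini); rewrite /= !addn0.
    have E3 := exec_seq (exec_seq (exec_seq E1 E2) e4) (exec_setk m4 t (stk t.+2)).
    by move: E3; rewrite /ini /opxx; case: (isum).
  - exact: agree.
  - move=> j hj; rewrite upd_idx; last lia.
    by rewrite f4 /m3 /m2 ?upd_idx ?f1 //; lia.
  - by rewrite upd_same q4 /acc; case: (isum).
  move=> V h1 h2.
  have okl : okv V s l env by move: h2; case: (isum) => -[].
  have hL := okv_val okl.
  have := c4 V _ hL (conj h1 h2); have := c1 V _ okl.
  have d1 : t + dpe l + 3 <= V by move: h1 => /=; lia.
  have d2 : t.+3 <= V by lia.
  move=> /(_ d1) ; move=> C1 /(_ d2) C4.
  have : bitlen (m4 4 t.+2) <= bitlen V.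
    by rewrite q4; apply: bit; move: (okv_val h2); rewrite /acc; case: (isum).
  have : bitlen t <= bitlen V by apply: bit; lia.
  have : bitlen t.+1 <= bitlen V by apply: bit; lia.
  have : bitlen t.+2 <= bitlen V by apply: bit; lia.
  have : bitlen 0 <= bitlen V by apply: bit; lia.
  have : bitlen ini <= bitlen V by apply: bit; rewrite /ini; case: (isum); lia.
  have := bitlen_gt0 V.
  have -> : wke s (Sum l b) env = 4 + wke s l env +
     (\sum_(i < L) 1 + \sum_(i < L) (1 + (1 + wke s b (rcons env i)))).
    by rewrite /= -big_split /=; congr (_ + _); apply: eq_bigr => i _; lia.
  move: C1 C4; rewrite /cst; set S1 := \sum_(_ < _) _; set S2 := \sum_(_ < _) _; nia.
elim: e => [c|l|a i IH|o e1 IH1 e2 IH2|l IHl b IHb|l IHl b IHb] cv t m env s hs.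
- exists (1 + bitlen t + (bitlen c + 0)), (update m 4 t c); split.
  + exact: exec_setk.
  + exact: agree.
  + by move=> j hj; rewrite upd_idx //; lia.
  + by rewrite upd_same.
  move=> V h1 /= /bit; have : bitlen t <= bitlen V by apply: bit; lia.
  by have := bitlen_gt0 V; rewrite /cst; lia.
- set x := if l < size cv then stk (nth 0 cv l) else Const 0.
  have ex : eval m x = nth 0 env l.
    rewrite /x; case: ltnP => h /=; first by rewrite (sim_env hs).
    by rewrite nth_default // -(sim_size hs).
  exists (1 + bitlen t + ecost m x), (update m 4 t (nth 0 env l)); split.
  + by rewrite -ex; apply: exec_setk.
  + exact: agree.
  + by move=> j hj; rewrite upd_idx //; lia.
  + by rewrite upd_same.
  move=> V h1 /= /bit h2.
  have c1 : bitlen t <= bitlen V by apply: bit; lia.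
  have : ecost m x <= bitlen (nth 0 env l) + bitlen V.
    rewrite -ex /x; case: ltnP => h /=; last lia.
    have : nth 0 cv l < t by apply: (allP (sim_lt hs)); apply: mem_nth.
    move=> hl; have : bitlen (nth 0 cv l) <= bitlen V by apply: bit; lia.
    lia.
  by have := bitlen_gt0 V; rewrite /cst; lia.
- have [t1 [m1 [e1 s1 f1 v1 c1]]] := IH _ _ _ _ _ hs.
  have ex : eval m1 (Get (bump 4 a) (stk t)) = s a (ev s i env).
    by rewrite /= v1 (sim_arr s1).
  exists (t1 + (1 + bitlen t + ecost m1 (Get (bump 4 a) (stk t)))).
  exists (update m1 4 t (s a (ev s i env))); split.
  + by rewrite -ex; apply: exec_seq e1 (exec_setk _ _ _).
  + exact: agree.
  + by move=> j hj; rewrite upd_idx ?f1 //; lia.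
  + by rewrite upd_same.
  move=> V h1 /= [h2 h3]; have := c1 V h1 h2; rewrite v1 (sim_arr s1).
  have := bit _ _ h3; have := bit _ _ (okv_val h2).
  have : bitlen t <= bitlen V by apply: bit; lia.
  by have := bitlen_gt0 V; rewrite /cst; nia.
- have [t1 [m1 [E1 s1 f1 v1 c1]]] := IH1 _ _ _ _ _ hs.
  have [t2 [m2 [E2 s2 f2 v2 c2]]] := IH2 _ _ _ _ _ (sim_weak (leqnSn t) s1).
  have m2t : m2 4 t = ev s e1 env by rewrite f2.
  have ex : eval m2 (opx o (stk t) (stk t.+1)) = ev s (Bin o e1 e2) env.
    by rewrite eval_opx m2t v2.
  exists (t1 + t2 + (1 + bitlen t + ecost m2 (opx o (stk t) (stk t.+1)))).
  exists (update m2 4 t (ev s (Bin o e1 e2) env)); split.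
  + by rewrite -ex; apply: exec_seq (exec_seq E1 E2) (exec_setk _ _ _).
  + apply: agree => //; case: s2 => a1 a2 a3 a4; case: s1 => b1 b2 b3 b4.
    by split.
  + by move=> j hj; rewrite upd_idx ?f2 ?f1 //; lia.
  + by rewrite upd_same.
  move=> V; rewrite [dpe _]/= => h1 [h2 h3 h4].
  have d1 : t + dpe e1 + 3 <= V by lia.
  have d2 : t.+1 + dpe e2 + 3 <= V by lia.
  have := c1 V d1 h2; have := c2 V d2 h3.
  have := @leq_opxcost m2 o t V; rewrite m2t v2.
  have d3 : t < V by lia.
  move=> /(_ d3 (okv_val h2) (okv_val h3) h4).
  have : bitlen t <= bitlen V by apply: bit; lia.
  by have := bitlen_gt0 V; rewrite /= /cst; nia.
- exact: (bigcase true).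
- exact: (bigcase false).
Qed.

Lemma cmpi_exec p : forall cv t m env s, sim cv t m env s ->
  exists T m', [/\ exec (cmpi cv t p) m T m', sim cv t m' env (run p env s),
    forall j, j < t -> m' 4 j = m 4 j &
    forall V, t + dpi p + 4 <= V -> okp V p env s ->
      T <= cst * wk p env s * bitlen V].
Proof.
have bit V x : x <= V -> bitlen x <= bitlen V by apply: leq_bitlen.
elim: p => [|a i e|p IHp q IHq|e p IHp q IHq|l p IHp] cv t m env s hs.
- by exists 1, m; split=> //; apply: exec_skip.
- have [t1 [m1 [E1 s1 f1 v1 c1]]] := cmpe_exec i hs.
  have [t2 [m2 [E2 s2 f2 v2 c2]]] := cmpe_exec e (sim_weak (leqnSn t) s1).
  have m2t : m2 4 t = ev s i env by rewrite f2.
  exists (t1 + t2 + (1 + ecost m2 (stk t) + ecost m2 (stk t.+1))).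
  exists (update m2 (bump 4 a) (ev s i env) (ev s e env)); split.
  + apply: exec_seq (exec_seq E1 E2) _.
    have := exec_assign m2 (bump 4 a) (stk t) (stk t.+1).
    by rewrite /= m2t v2.
  + case: s2 => a1 a2 a3 a4; case: s1 => b1 b2 b3 b4; split=> //.
      move=> c j; rewrite /update a1 /=.
      by rewrite /update (can_eq (bumpK 4)).
    by move=> j hj; rewrite upd_arr ?a4 // neq_bump.
  + by move=> j hj; rewrite upd_arr ?neq_bump // f2 ?f1 //; lia.
  move=> V; rewrite [dpi _]/= => h1 [h2 h3].
  have d1 : t + dpe i + 3 <= V by lia.
  have d2 : t.+1 + dpe e + 3 <= V by lia.
  have := c1 V d1 h2; have := c2 V d2 h3; rewrite /= m2t v2.
  have := bit _ _ (okv_val h2); have := bit _ _ (okv_val h3).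
  have : bitlen t <= bitlen V by apply: bit; lia.
  have : bitlen t.+1 <= bitlen V by apply: bit; lia.
  by have := bitlen_gt0 V; rewrite /cst; nia.
- have [t1 [m1 [E1 s1 f1 c1]]] := IHp _ _ _ _ _ hs.
  have [t2 [m2 [E2 s2 f2 c2]]] := IHq _ _ _ _ _ s1.
  exists (t1 + t2), m2; split=> //; first exact: exec_seq E1 E2.
    by move=> j hj; rewrite f2 ?f1.
  move=> V; rewrite [dpi _]/= => h1 [h2 h3].
  have d1 : t + dpi p + 4 <= V by lia.
  have d2 : t + dpi q + 4 <= V by lia.
  by have := c1 V d1 h2; have := c2 V d2 h3; rewrite /=; nia.
- have [t1 [m1 [E1 s1 f1 v1 c1]]] := cmpe_exec e hs.
  have hb V : t + dpi (Ite e p q) + 4 <= V -> [/\ t + dpe e + 3 <= V,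
     t + dpi p + 4 <= V & t + dpi q + 4 <= V].
    by rewrite [dpi _]/= => h; split; lia.
  have hc V : t + dpe e + 3 <= V -> okv V s e env ->
     1 + ecost m1 (stk t) <= cst * bitlen V.
    move=> h1 h2; rewrite /= v1; have := bit _ _ (okv_val h2).
    have : bitlen t <= bitlen V by apply: bit; lia.
    have := bitlen_gt0 V; rewrite /cst; lia.
  case: (boolP (ev s e env != 0)) => h.
    have [t2 [m2 [E2 s2 f2 c2]]] := IHp _ _ _ _ _ s1.
    exists (t1 + (1 + ecost m1 (stk t) + t2)), m2; split=> //.
    + by apply: exec_seq E1 _; apply: exec_if_true; rewrite /= ?v1.
    + by rewrite /= h.
    + by move=> j hj; rewrite f2 ?f1.
    move=> V /hb[d1 d2 d3]; rewrite [okp _ _ _ _]/= h => -[h2 h3].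
    have := c1 V d1 h2; have := c2 V d2 h3; have := hc V d1 h2.
    by rewrite [wk (Ite e p q) env s]/= h; nia.
  have [t2 [m2 [E2 s2 f2 c2]]] := IHq _ _ _ _ _ s1.
  exists (t1 + (1 + ecost m1 (stk t) + t2)), m2; split=> //.
  + by apply: exec_seq E1 _; apply: exec_if_false; rewrite //= v1; move/negPn/eqP: h.
  + by rewrite /= (negPf h).
  + by move=> j hj; rewrite f2 ?f1.
  move=> V /hb[d1 d2 d3]; rewrite [okp _ _ _ _]/= (negPf h) => -[h2 h3].
  have := c1 V d1 h2; have := c2 V d3 h3; have := hc V d1 h2.
  by rewrite [wk (Ite e p q) env s]/= (negPf h); nia.
have [t1 [m1 [E1 s1 f1 v1 c1]]] := cmpe_exec l hs.
set L := ev s l env in v1.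
set m2 := update m1 4 t.+1 0.
pose st i := iteri i (fun j s' => run p (rcons env j) s') s.
have := @loop_exec cv t m2 env s (cmpi (rcons cv t.+1) t.+2 p) L st
  (fun _ _ => True) (fun i => wk p (rcons env i) (st i))
  (fun V => t + dpi (For l p) + 4 <= V /\ okp V (For l p) env s).
case=> //.
- apply: sim_eq s1 _ _ => [a i|i hi]; first by rewrite /m2 upd_bump.
  by rewrite /m2 upd_idx //; lia.
- by rewrite /m2 upd_idx //; lia.
- by rewrite /m2 upd_same.
- move=> i m3 hi _ s3; have [t4 [m4 [E4 s4 f4 c4]]] := IHp _ _ _ _ _ s3.
  exists t4, m4; split=> // V h1 h2 [h3 h4]; apply: c4.
    by move: h3; rewrite [dpi _]/=; lia.
  by case: h4 => _; apply.
move=> t3 [m3 [E3 s3 f3 _ c3]].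
exists (t1 + (1 + bitlen t.+1 + bitlen 0) + t3), m3; split=> //.
- apply: exec_seq E3; apply: exec_seq E1 _.
  by have := exec_setk m1 t.+1 (Const 0); rewrite /= !addn0.
- by move=> j hj; rewrite f3 /m2 ?upd_idx ?f1 //; lia.
move=> V h1 h2.
have d1 : t + dpe l + 3 <= V by move: h1; rewrite [dpi _]/=; lia.
have d2 : t.+3 <= V by move: h1; rewrite [dpi _]/=; lia.
have okl : okv V s l env by case: h2.
have := c1 V d1 okl; have := c3 V d2 (okv_val okl) (conj h1 h2).
have : bitlen t.+1 <= bitlen V by apply: bit; lia.
have : bitlen 0 <= bitlen V by apply: bit.
have := bitlen_gt0 V.
have -> : wk (For l p) env s = 2 + wke s l env + (\sum_(i < L) 1 +
   \sum_(i < L) (1 + wk p (rcons env i) (st i))).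
  by rewrite /= -big_split /=; congr (_ + _); apply: eq_bigr => i _; lia.
rewrite /cst; set S1 := \sum_(_ < _) _; set S2 := \sum_(_ < _) _; nia.
Qed.

(** * Static bounds on values and on work *)

(** [Sm j] is the type of the numbers up to [K ^ j], and [Bg m] of those up to
    [Z ^ (K ^ m)]; [K] will depend on the parameters [d] and [k] only. *)
Inductive ty := Sm of nat | Bg of nat.

Definition lvl t := match t with Sm j => j | Bg m => m end.

Definition subty t1 t2 :=
  match t1, t2 with
  | Sm i, Sm j => i <= j
  | Sm i, Bg j | Bg i, Bg j => i <= j
  | Bg _, Sm _ => false
  end.

Definition multy t1 t2 :=
  match t1, t2 with
  | Sm i, Sm j => Sm (i + j)
  | _, _ => Bg (maxn (lvl t1) (lvl t2)).+1
  end.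

Definition opty o t1 t2 :=
  match o with
  | OAdd => match t1, t2 with
            | Sm i, Sm j => Sm (maxn i j).+1
            | _, _ => Bg (maxn (lvl t1) (lvl t2)).+1
            end
  | OSub | ODiv | OMod => t1
  | OMul => multy t1 t2
  | OMin => if subty t1 t2 then t1 else if subty t2 t1 then t2 else t1
  | OLeq | OLt | OEq => Sm 0
  end.

(** Besides the type of the value, a level [L] is returned such that all intermediate values are at
    most [Z ^ (K ^ L)]. A product must have a small number of factors: [K ^ j] factors multiply the
    exponent of [Z] by [K ^ j]. *)
Fixpoint tye (sty : nat -> ty) (te : seq ty) (e : xe) : option (ty * nat) :=
  match e with
  | Cst c => Some (Sm c, c)
  | Var l => Some (nth (Sm 0) te l, lvl (nth (Sm 0) te l))
  | Arr a i => if tye sty te i is Some (_, L)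
               then Some (sty a, maxn L (lvl (sty a))) else None
  | Bin o e1 e2 =>
      match tye sty te e1, tye sty te e2 with
      | Some (t1, l1), Some (t2, l2) =>
          let t := opty o t1 t2 in Some (t, maxn (maxn l1 l2) (lvl t))
      | _, _ => None
      end
  | Sum l b =>
      if tye sty te l is Some (t1, l1) then
        if tye sty (rcons te t1) b is Some (t2, l2) then
          let t := multy t1 t2 in Some (t, maxn (maxn l1 l2) (lvl t))
        else None
      else None
  | Prd l b =>
      if tye sty te l is Some (Sm j, l1) then
        if tye sty (rcons te (Sm j)) b is Some (t2, l2) then
          Some (Bg (lvl t2 + j), maxn (maxn l1 l2) (lvl t2 + j))
        else None
      else None
  end.

Fixpoint typ (sty : nat -> ty) (te : seq ty) (p : il) : option nat :=
  match p with
  | Nop => Some 0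
  | Put a i e =>
      match tye sty te i, tye sty te e with
      | Some (_, l1), Some (t, l2) =>
          if subty t (sty a) then Some (maxn l1 l2) else None
      | _, _ => None
      end
  | Sq p q =>
      match typ sty te p, typ sty te q with
      | Some l1, Some l2 => Some (maxn l1 l2)
      | _, _ => None
      end
  | Ite e p q =>
      match tye sty te e, typ sty te p, typ sty te q with
      | Some (_, l0), Some l1, Some l2 => Some (maxn l0 (maxn l1 l2))
      | _, _, _ => None
      end
  | For l p =>
      if tye sty te l is Some (t, l1) then
        if typ sty (rcons te t) p is Some l2 then Some (maxn l1 l2) else None
      else None
  end.

(** For at most [K ^ j] rounds: the 2 stands for the constant overheads, which are at most [K ^ 2],
    and each addition of two terms raises the exponent by 1. *)
Definition wloop j l b := (maxn (maxn l 2).+1 (j + (maxn 2 b).+1)).+1.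

(** Exponent of [K] in a bound on the work, when all loops are small. *)
Fixpoint woe (sty : nat -> ty) (te : seq ty) (e : xe) : option nat :=
  match e with
  | Cst _ | Var _ => Some 0
  | Arr _ i => omap succn (woe sty te i)
  | Bin _ e1 e2 =>
      match woe sty te e1, woe sty te e2 with
      | Some w1, Some w2 => Some (maxn w1 w2).+2
      | _, _ => None
      end
  | Sum l b | Prd l b =>
      match tye sty te l, woe sty te l with
      | Some (Sm j, _), Some w1 =>
          if woe sty (rcons te (Sm j)) b is Some w2 then Some (wloop j w1 w2)
          else None
      | _, _ => None
      end
  end.

Fixpoint wop (sty : nat -> ty) (te : seq ty) (p : il) : option nat :=
  match p with
  | Nop => Some 0
  | Put _ e1 e2 =>
      match woe sty te e1, woe sty te e2 with
      | Some w1, Some w2 => Some (maxn w1 w2).+2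
      | _, _ => None
      end
  | Sq p q =>
      match wop sty te p, wop sty te q with
      | Some w1, Some w2 => Some (maxn w1 w2).+1
      | _, _ => None
      end
  | Ite e p q =>
      match woe sty te e, wop sty te p, wop sty te q with
      | Some w0, Some w1, Some w2 => Some (maxn w0 (maxn w1 w2)).+2
      | _, _, _ => None
      end
  | For l p =>
      match tye sty te l, woe sty te l with
      | Some (Sm j, _), Some w1 =>
          if wop sty (rcons te (Sm j)) p is Some w2 then Some (wloop j w1 w2)
          else None
      | _, _ => None
      end
  end.

Lemma sum_le_const n (F : nat -> nat) c :
  (forall i, i < n -> F i <= c) -> \sum_(i < n) F i <= n * c.
Proof.
move=> h; rewrite -[n in n * c]card_ord -sum_nat_const.
by apply: leq_sum => i _; apply: h.
Qed.

Lemma iteri_inv T (P : nat -> T -> Prop) n f x :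
  P 0 x -> (forall i y, i < n -> P i y -> P i.+1 (f i y)) -> P n (iteri n f x).
Proof.
move=> h0 hS; suff h m : m <= n -> P m (iteri m f x) by apply: h.
by elim: m => [|m IH] hm //=; apply: hS => //; apply: IH; lia.
Qed.

Section StaticBounds.
Variables (K Z : nat).
Hypotheses (K2 : 2 <= K) (KZ : K <= Z).

Definition bd t := match t with Sm j => K ^ j | Bg m => Z ^ (K ^ m) end.

Definition typed (sty : nat -> ty) (s : store) := forall a i, s a i <= bd (sty a).

Definition tenv (te : seq ty) (env : seq nat) :=
  size te = size env /\ forall l, nth 0 env l <= bd (nth (Sm 0) te l).

Lemma Kgt0 : 0 < K. Proof. lia. Qed.

Lemma bd_gt0 t : 0 < bd t.
Proof. by case: t => m; rewrite expn_gt0; have := K2; have := KZ; lia. Qed.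

Lemma leK i j : i <= j -> K ^ i <= K ^ j.
Proof. by move=> h; apply: leq_pexp2l => //; have := K2; lia. Qed.

Lemma leZ i j : i <= j -> Z ^ i <= Z ^ j.
Proof. by move=> h; apply: leq_pexp2l => //; have := K2; have := KZ; lia. Qed.

Lemma leKid i : i <= K ^ i.
Proof. exact: ltnW (ltn_expl _ K2). Qed.

Lemma Sm_Bg j : K ^ j <= Z ^ (K ^ j).
Proof.
apply: leq_trans (leZ (leKid j)).
by case: j => [|j] //; rewrite leq_exp2r.
Qed.

Lemma bd_lvl t L : lvl t <= L -> bd t <= Z ^ (K ^ L).
Proof.
case: t => m /= h; last by apply: leZ; apply: leK.
by apply: leq_trans (leK h) (Sm_Bg _).
Qed.

Lemma bd_sub t1 t2 : subty t1 t2 -> bd t1 <= bd t2.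
Proof.
case: t1 t2 => [i|i] [j|j] //= h; first exact: leK.
  by apply: leq_trans (leK h) (Sm_Bg _).
by apply: leZ; apply: leK.
Qed.

Lemma addK a b c : a <= K ^ c -> b <= K ^ c -> a + b <= K ^ c.+1.
Proof. by rewrite expnS => h1 h2; have := K2; nia. Qed.

Lemma addKm a b i j : a <= K ^ i -> b <= K ^ j -> a + b <= K ^ (maxn i j).+1.
Proof.
move=> h1 h2; apply: addK.
  by apply: leq_trans h1 (leK _); rewrite leq_maxl.
by apply: leq_trans h2 (leK _); rewrite leq_maxr.
Qed.

Lemma mulZ a b c : a <= Z ^ (K ^ c) -> b <= Z ^ (K ^ c) -> a * b <= Z ^ (K ^ c.+1).
Proof.
move=> h1 h2; apply: leq_trans (leq_mul h1 h2) _.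
by rewrite -expnD; apply: leZ; rewrite expnS; have := K2; nia.
Qed.

Lemma addZ a b c : a <= Z ^ (K ^ c) -> b <= Z ^ (K ^ c) -> a + b <= Z ^ (K ^ c.+1).
Proof.
move=> h1 h2; have h0 : 2 <= Z ^ (K ^ c).
  apply: leq_trans (_ : Z ^ 1 <= _); first by rewrite expn1; have := K2; have := KZ; lia.
  by apply: leZ; rewrite expn_gt0; have := K2; lia.
by apply: leq_trans (mulZ h0 (leqnn _)); lia.
Qed.

Lemma mulbd x y t1 t2 : x <= bd t1 -> y <= bd t2 -> x * y <= bd (multy t1 t2).
Proof.
have gen : x <= bd t1 -> y <= bd t2 ->
    x * y <= bd (Bg (maxn (lvl t1) (lvl t2)).+1).
  move=> h1 h2; apply: mulZ.
    by apply: leq_trans h1 (bd_lvl _); rewrite leq_maxl.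
  by apply: leq_trans h2 (bd_lvl _); rewrite leq_maxr.
case: t1 t2 gen => [i|i] [j|j] //= _ h1 h2.
by rewrite expnD; apply: leq_mul.
Qed.

Lemma opbd o x y t1 t2 :
  x <= bd t1 -> y <= bd t2 -> opd o x y <= bd (opty o t1 t2).
Proof.
move=> h1 h2; case: o => /=; try by rewrite leq_b1.
- have gen : x + y <= bd (Bg (maxn (lvl t1) (lvl t2)).+1).
    apply: addZ.
      by apply: leq_trans h1 (bd_lvl _); rewrite leq_maxl.
    by apply: leq_trans h2 (bd_lvl _); rewrite leq_maxr.
  by case: t1 t2 h1 h2 gen => [i|i] [j|j] //= h1 h2 _; apply: addKm.
- exact: leq_trans (leq_subr _ _) h1.
- exact: mulbd.
- exact: leq_trans (leq_div _ _) h1.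
- exact: leq_trans (leq_mod _ _) h1.
- case: ifP => _; first exact: leq_trans (geq_minl _ _) h1.
  by case: ifP => _; [exact: leq_trans (geq_minr _ _) h2
                     |exact: leq_trans (geq_minl _ _) h1].
Qed.

Lemma tenv_rcons te env t i : tenv te env -> i <= bd t ->
  tenv (rcons te t) (rcons env i).
Proof.
case=> h1 h2 hi; split=> [|l]; first by rewrite !size_rcons h1.
by rewrite !nth_rcons h1; case: ltngtP.
Qed.

Lemma tye_sound sty s : typed sty s -> forall e te env t L, tenv te env ->
  tye sty te e = Some (t, L) ->
  ev s e env <= bd t /\ forall L', L <= L' -> okv (Z ^ (K ^ L')) s e env.
Proof.
move=> hs; elim=> [c|l|a i IH|o e1 IH1 e2 IH2|l IHl b IHb|l IHl b IHb] te env t L hE /=.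
- case=> <- <-; split=> [|L' h]; first exact: leKid.
  by apply: leq_trans (bd_lvl (t := Sm c) h); apply: leKid.
- case=> <- <-; split=> [|L' h]; first by case: hE.
  by apply: leq_trans (bd_lvl h); case: hE.
- case E: (tye sty te i) => [[t1 l1]|] // [<- <-].
  have [h1 h2] := IH _ _ _ _ hE E; split=> // L'; rewrite geq_max => /andP[a1 a2].
  by split; [apply: h2 | apply: leq_trans (hs _ _) (bd_lvl a2)].
- case E1: (tye sty te e1) => [[t1 l1]|] //.
  case E2: (tye sty te e2) => [[t2 l2]|] // [<- <-].
  have [h1 h2] := IH1 _ _ _ _ hE E1; have [h3 h4] := IH2 _ _ _ _ hE E2.
  have h5 := opbd o h1 h3; split=> // L'; rewrite !geq_max => /andP[/andP[a1 a2] a3].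
  by split; [apply: h2 | apply: h4 | apply: leq_trans h5 (bd_lvl a3)].
- case E1: (tye sty te l) => [[t1 l1]|] //.
  case E2: (tye sty (rcons te t1) b) => [[t2 l2]|] // [<- <-].
  have [h1 h2] := IHl _ _ _ _ hE E1.
  have hb i : i < ev s l env -> ev s b (rcons env i) <= bd t2 /\
      forall L', l2 <= L' -> okv (Z ^ (K ^ L')) s b (rcons env i).
    move=> hi; apply: IHb E2; apply: tenv_rcons => //.
    by apply: leq_trans h1; apply: ltnW.
  have h5 : \sum_(i < ev s l env) ev s b (rcons env i) <= bd (multy t1 t2).
    apply: leq_trans (mulbd h1 (leqnn (bd t2))).
    apply: (@sum_le_const _ (fun i => ev s b (rcons env i))) => i hi.
    by case: (hb i hi).
  split=> // L'; rewrite !geq_max => /andP[/andP[a1 a2] a3]; split.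
  + exact: h2.
  + by move=> i /hb[_]; apply.
  + exact: leq_trans h5 (bd_lvl a3).
case E1: (tye sty te l) => [[[j|//] l1]|] //.
case E2: (tye sty (rcons te (Sm j)) b) => [[t2 l2]|] // [<- <-].
have [h1 h2] := IHl _ _ _ _ hE E1.
have hb i : i < ev s l env -> ev s b (rcons env i) <= bd t2 /\
    forall L', l2 <= L' -> okv (Z ^ (K ^ L')) s b (rcons env i).
  move=> hi; apply: IHb E2; apply: tenv_rcons => //.
  by apply: leq_trans h1; apply: ltnW.
have h5 r : r <= ev s l env ->
    \prod_(i < r) ev s b (rcons env i) <= bd (Bg (lvl t2 + j)).
  move=> hr; apply: (@leq_trans (bd t2 ^ r)).
    rewrite -[X in _ ^ X](card_ord r) -prod_nat_const; apply: leq_prod => i _.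
    by case: (hb i) => //; apply: leq_trans hr; apply: ltn_ord.
  have hr' : r <= K ^ j by apply: leq_trans hr h1.
  apply: (@leq_trans (bd t2 ^ (K ^ j))).
    by apply: leq_pexp2l => //; apply: bd_gt0.
  rewrite /= expnD expnM leq_exp2r ?expn_gt0 ?Kgt0 //.
  exact: bd_lvl.
split=> [|L']; first exact: h5.
rewrite !geq_max => /andP[/andP[a1 a2] a3]; split.
- exact: h2.
- by move=> i /hb[_]; apply.
- by move=> r /h5 h6; apply: leq_trans h6 (bd_lvl (t := Bg _) a3).
Qed.

Lemma typed_upd sty s a i x : typed sty s -> x <= bd (sty a) ->
  typed sty (update s a i x).
Proof. by move=> h hx b j; rewrite /update; case: andP => [[/eqP -> _]|_]. Qed.

Lemma typ_sound sty p : forall te env s L, typed sty s -> tenv te env ->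
  typ sty te p = Some L ->
  typed sty (run p env s) /\ forall L', L <= L' -> okp (Z ^ (K ^ L')) p env s.
Proof.
elim: p => [|a i e|p IHp q IHq|e p IHp q IHq|l p IHp] te env s L hs hE /=.
- by [].
- case E1: (tye sty te i) => [[t1 l1]|] //.
  case E2: (tye sty te e) => [[t2 l2]|] //; case: ifP => // hsub [<-].
  have [h1 h2] := tye_sound hs hE E1; have [h3 h4] := tye_sound hs hE E2.
  split=> [|L']; first by apply: typed_upd => //; apply: leq_trans h3 (bd_sub hsub).
  by rewrite geq_max => /andP[a1 a2]; split; [apply: h2 | apply: h4].
- case E1: (typ sty te p) => [l1|] //; case E2: (typ sty te q) => [l2|] // [<-].
  have [h1 h2] := IHp _ _ _ _ hs hE E1; have [h3 h4] := IHq _ _ _ _ h1 hE E2.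
  split=> // L'; rewrite geq_max => /andP[a1 a2].
  by split; [apply: h2 | apply: h4].
- case E0: (tye sty te e) => [[t0 l0]|] //.
  case E1: (typ sty te p) => [l1|] //; case E2: (typ sty te q) => [l2|] // [<-].
  have [h1 h2] := IHp _ _ _ _ hs hE E1; have [h3 h4] := IHq _ _ _ _ hs hE E2.
  have [h5 h6] := tye_sound hs hE E0.
  split=> [|L']; first by case: ifP.
  rewrite !geq_max => /andP[a0 /andP[a1 a2]]; split; first exact: h6.
  by case: ifP => _; [apply: h2 | apply: h4].
case E1: (tye sty te l) => [[t1 l1]|] //.
case E2: (typ sty (rcons te t1) p) => [l2|] // [<-].
have [h1 h2] := tye_sound hs hE E1.
have hst i : i <= ev s l env ->
    typed sty (iteri i (fun j s' => run p (rcons env j) s') s).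
  move=> hi; apply: (@iteri_inv _ (fun _ => typed sty)) => // j y hj hy.
  have [] // := IHp _ (rcons env j) _ _ hy _ E2.
  apply: tenv_rcons => //; lia.
split=> [|L']; first exact: hst.
rewrite geq_max => /andP[a1 a2]; split; first exact: h2.
move=> i hi; have [|_] // := IHp _ (rcons env i) _ _ (hst i (ltnW hi)) _ E2; last by apply.
apply: tenv_rcons => //; lia.
Qed.

Lemma wloopP L S W j w1 w2 a b : L <= K ^ j -> a <= 4 -> b <= 3 -> W <= K ^ w1 ->
  S <= L * (b + K ^ w2) -> a + W + S <= K ^ wloop j w1 w2.
Proof.
move=> hL ha hb hW hS; rewrite /wloop; have hK := K2.
apply: addKm; first by rewrite addnC; apply: addKm => //; nia.
apply: leq_trans hS _; rewrite expnD; apply: leq_mul => //.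
by apply: addKm => //; nia.
Qed.

Lemma woe_sound sty s : typed sty s -> forall e te env w, tenv te env ->
  woe sty te e = Some w -> wke s e env <= K ^ w.
Proof.
move=> hs; have hK := K2.
have loopcase l b te env w :
  (forall te env w, tenv te env -> woe sty te l = Some w -> wke s l env <= K ^ w) ->
  (forall te env w, tenv te env -> woe sty te b = Some w -> wke s b env <= K ^ w) ->
  tenv te env -> woe sty te (Sum l b) = Some w -> wke s (Sum l b) env <= K ^ w.
  move=> IHl IHb hE /=.
  case E1: (tye sty te l) => [[[j|//] l1]|] //.
  case E2: (woe sty te l) => [w1|] //.
  case E3: (woe sty _ b) => [w2|] // [<-].
  have [h1 _] := tye_sound hs hE E1.
  apply: (wloopP h1 (leqnn 4) (leqnn 3)); first exact: IHl E2.
  apply: (@sum_le_const _ (fun i => 3 + wke s b (rcons env i))) => i hi.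
  rewrite leq_add2l; apply: IHb E3.
  by apply: tenv_rcons => //; apply: leq_trans h1; apply: ltnW.
elim=> [c|l|a i IH|o e1 IH1 e2 IH2|l IHl b IHb|l IHl b IHb] te env w hE; last 2 first.
- exact: loopcase.
- exact: loopcase.
- by case=> <-; rewrite /= expn0.
- by case=> <-; rewrite /= expn0.
- rewrite /=; case E: (woe sty te i) => [w1|] //= [<-].
  by apply: addK; [rewrite expn_gt0; lia | apply: IH E].
rewrite /=; case E1: (woe sty te e1) => [w1|] //.
case E2: (woe sty te e2) => [w2|] // [<-]; rewrite -addnA.
by apply: addK; [rewrite expn_gt0; lia | apply: addKm; [apply: IH1 E1 | apply: IH2 E2]].
Qed.

(** [typ] is required along with [wop] because the length of a loop is read in a store that
    preceding commands have changed, and which must still be well typed. *)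
Lemma wop_sound sty p : forall te env s w L, typed sty s -> tenv te env ->
  typ sty te p = Some L -> wop sty te p = Some w -> wk p env s <= K ^ w.
Proof.
have hK := K2.
elim: p => [|a i e|p IHp q IHq|e p IHp q IHq|l p IHp] te env s w L hs hE.
- by move=> _ [<-].
- move=> _ /=; case E1: (woe sty te i) => [w1|] //.
  case E2: (woe sty te e) => [w2|] // [<-]; rewrite -addnA.
  apply: addK; first by rewrite expn_gt0; lia.
  by apply: addKm; [apply: woe_sound E1 | apply: woe_sound E2].
- rewrite /=; case T1: (typ sty te p) => [l1|] //.
  case T2: (typ sty te q) => [l2|] // _.
  case E1: (wop sty te p) => [w1|] //; case E2: (wop sty te q) => [w2|] // [<-].
  have [h1 _] := typ_sound hs hE T1.
  by apply: addKm; [apply: IHp T1 E1 | apply: IHq T2 E2].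
- rewrite /=; case T0: (tye sty te e) => [[t0 l0]|] //.
  case T1: (typ sty te p) => [l1|] //; case T2: (typ sty te q) => [l2|] // _.
  case E0: (woe sty te e) => [w0|] //.
  case E1: (wop sty te p) => [w1|] //; case E2: (wop sty te q) => [w2|] // [<-].
  rewrite -addnA; apply: addK; first by rewrite expn_gt0; lia.
  apply: addKm; first exact: woe_sound E0.
  case: ifP => _.
    by apply: leq_trans (leK (leq_maxl _ _)); apply: IHp T1 E1.
  by apply: leq_trans (leK (leq_maxr _ _)); apply: IHq T2 E2.
rewrite /=; case T1: (tye sty te l) => [[t1 l1]|] //.
case T2: (typ sty (rcons te t1) p) => [l2|] // _.
case: t1 T1 T2 => [j|//] T1 T2.
case E1: (woe sty te l) => [w1|] //; case E2: (wop sty _ p) => [w2|] // [<-].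
have [h1 _] := tye_sound hs hE T1.
apply: (wloopP h1 (_ : 2 <= 4) (_ : 2 <= 3)) => //; first exact: woe_sound E1.
apply: (@sum_le_const _ (fun i => 2 + wk p (rcons env i)
    (iteri i (fun j s' => run p (rcons env j) s') s))) => i hi.
have ht r : r <= ev s l env -> tenv (rcons te (Sm j)) (rcons env r).
  by move=> hr; apply: tenv_rcons => //; apply: leq_trans h1.
rewrite leq_add2l; apply: (IHp _ _ _ _ _ _ _ T2 E2); last by apply: ht; apply: ltnW.
apply: (@iteri_inv _ (fun _ => typed sty)) => // r y hr hy.
by have [] // := typ_sound hy (ht r _) T2; lia.
Qed.

End StaticBounds.

(** * The counting programs *)

Declare Scope xe_scope.
Delimit Scope xe_scope with xe.
Bind Scope xe_scope with xe.
Notation "# c" := (Cst c) (at level 1, format "# c") : xe_scope.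
Notation "$ l" := (Var l) (at level 1, format "$ l") : xe_scope.
Notation "a @[ i ]" := (Arr a i) (at level 2, left associativity,
  format "a @[ i ]") : xe_scope.
Notation "x + y" := (Bin OAdd x y) : xe_scope.
Notation "x - y" := (Bin OSub x y) : xe_scope.
Notation "x * y" := (Bin OMul x y) : xe_scope.
Notation "x %/ y" := (Bin ODiv x y) : xe_scope.
Notation "x %% y" := (Bin OMod x y) : xe_scope.
Notation "x <= y" := (Bin OLeq x y) : xe_scope.
Notation "x < y" := (Bin OLt x y) : xe_scope.
Notation "x == y" := (Bin OEq x y) : xe_scope.
Notation "p ;; q" := (Sq p q) (at level 60, right associativity).

Local Open Scope xe_scope.

(** Arrays of the programs: 0-3 the input; 4 the number of pattern vertices;
    5 the round in which a host vertex is removed; 6, 7 numbers of vertices and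
    of arcs left; 9 the j-th out-neighbour of v, at j(n+1)+v; 10 the arcs;
    11 the maximal out-degree; 12, 13, 14 the numbers of patterns, certificates
    and self-maps; 15 the pattern; 17 the certificate; 19 the code of the best
    one; 20, 21 boundary and domain of each label; 22 the number of candidate
    maps for each label; 23 the current partial map; 24 its code; 25 the codes
    already met; 26 the counts, indexed by label and boundary values; 28, 29 the
    positive and the negative part of the sum; 30, 31 bounds on the counts and
    on the codes. *)
Definition n_ : xe := 0@[#1].
Definition k_ : xe := 4@[#0].
Definition not_ (e : xe) : xe := e == #0.

Definition deg_ (v : xe) : xe := 2@[v + #1] - 2@[v].
Definition nbr_ (v j : xe) : xe := 3@[2@[v] + j].
Definition alive_ (v : xe) : xe := 5@[v] == #0.

Definition p_setup : il :=
  Put 12 (#0) (Prd (k_ * k_) (#2)) ;;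
  Put 13 (#0) (Prd k_ ((k_ + #1) * (k_ + #1) * #2)) ;;
  Put 14 (#0) (Prd k_ k_) ;;
  Put 31 (#0) (Prd k_ (n_ + #1)) ;;
  Put 30 (#0) (12@[#0] * 31@[#0]).

Definition p_degsum : il :=
  Put 7 (#0) (Sum n_ (alive_ $1 * Sum (deg_ $1) (alive_ (nbr_ $1 $2)))).

(** Vertices that are removed in the current round still count as alive. *)
Definition low_ : xe := alive_ $1 *
  (6@[#0] * Sum (deg_ $1) (alive_ (nbr_ $1 $2) + (5@[nbr_ $1 $2] == $0 + #1))
    <= #2 * 7@[#0]).

Definition p_remove : il := Ite low_ (Put 5 $1 ($0 + #1)) Nop.

Definition p_count : il := Put 6 (#0) (Sum n_ (alive_ $1)).

Definition p_round : il := p_degsum ;; For n_ p_remove ;; p_count.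

(** A round keeps at most half of the vertices, those of more than twice the
    average degree; so only logarithmically many of the [n] rounds do work. *)
Definition p_peel : il :=
  Put 6 (#0) n_ ;; For n_ (Ite 6@[#0] p_round Nop).

Definition before_ (v w : xe) : xe :=
  (5@[v] < 5@[w]) + (5@[v] == 5@[w]) * (v < w).

Definition p_arc : il :=
  Ite (before_ $0 (nbr_ $0 $1))
    (Put 8 (#0) (Bin OMin (8@[#0] + #1) n_) ;;
     Put 9 (8@[#0] * (n_ + #1) + ($0 + #1)) (nbr_ $0 $1 + #1) ;;
     Put 10 (($0 + #1) * (n_ + #1) + (nbr_ $0 $1 + #1)) (#1) ;;
     Ite (11@[#0] < 8@[#0]) (Put 11 (#0) 8@[#0]) Nop)
    Nop.

(** The out-neighbour of index 0 is the vertex itself, so that an identification is followed like an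
    arc. *)
Definition p_orient : il :=
  For n_ (Put 8 (#0) (#0) ;; Put 9 ($0 + #1) ($0 + #1) ;; For (deg_ $0) p_arc).

Definition H_ (u v : xe) : xe := 1@[u * k_ + v].
Definition Q_ (u v : xe) : xe := 15@[u * k_ + v].

Definition p_bits : il :=
  For (k_ * k_) (Put 15 $1 (($0 %/ Prd $1 (#2)) %% #2)).

(** Counts the violations of [qvalid]. Here and below, a sum that is 0 plays the part of a universal
    statement. *)
Definition badq_ (inj : bool) : xe :=
  Sum k_ (Sum k_ (H_ $1 $2 * (Q_ $1 $2 == Q_ $2 $1) +
    not_ (H_ $1 $2) * (not_ (Q_ $1 $2 == Q_ $2 $1) +
       Q_ $1 $2 * not_ (#inj * not_ ($1 == $2))))).

Definition sgn_ : xe :=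
  Sum k_ (Sum k_ (($1 < $2) * not_ (H_ $1 $2) * Q_ $1 $2)).

(** A certificate is a numeral with one digit per pattern vertex, which packs its root flag, its
    label and its depth; this is the base. *)
Definition cb_ : xe := (k_ + #1) * (k_ + #1) * #2.
Definition rt_ (v : xe) : xe := 17@[v] %% #2.
Definition lab_ (v : xe) : xe := (17@[v] %/ #2) %% (k_ + #1).
Definition dep_ (v : xe) : xe := (17@[v] %/ #2) %/ (k_ + #1).

(** Levels of bound variables are absolute, hence the parameter [l]. *)
Definition p_decode (l : nat) (x : xe) : il :=
  For k_ (Put 17 $l ((x %/ Prd $l cb_) %% cb_)).

Definition inv_ : xe :=
  Sum k_ (Sum k_ (Q_ $2 $3 * not_ (lab_ $3 == lab_ $2) * not_ (lab_ $3 == #0))) +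
  Sum k_ (not_ (rt_ $2) *
    not_ (Sum k_ (Q_ $3 $2 * (lab_ $3 == lab_ $2) * (dep_ $3 < dep_ $2)))).

Definition isrt_ (g v : xe) : xe := rt_ v * (lab_ v == g).
(** The number of choices at a vertex: any image for a root, otherwise a predecessor and the index
    of an out-neighbour of the image of that predecessor. Vertices outside the piece [g] get the
    second base too, which only costs a factor in [d] and [k]. *)
Definition base_ (g v : xe) : xe :=
  isrt_ g v * n_ + not_ (isrt_ g v) * (k_ * (11@[#0] + #1)).
Definition lim_ (l : nat) (g : xe) : xe := Prd k_ (base_ g $l).

(** Exhaustive search for the certificate with the fewest candidate maps; the
    best value so far is kept, increased by 1, in array 18. *)
Definition p_search : il :=
  Put 18 (#0) (#0) ;;
  For 13@[#0] (p_decode 2 $1 ;;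
    Ite (not_ inv_ * (not_ 18@[#0] + (Sum (k_ + #1) (lim_ 3 $2) + #1 < 18@[#0])))
      (Put 18 (#0) (Sum (k_ + #1) (lim_ 3 $2) + #1) ;; Put 19 (#0) $1) Nop) ;;
  p_decode 1 19@[#0].

Definition p_tables : il :=
  For (k_ + #1) (Put 22 $1 (lim_ 2 $1) ;;
    For k_ (Put 20 ($1 * k_ + $2)
        ((lab_ $2 == #0) * not_ ($1 == #0) *
         (#0 < Sum k_ (Q_ $3 $2 * (lab_ $3 == $1)))) ;;
      Put 21 ($1 * k_ + $2) ((lab_ $2 == $1) + 20@[$1 * k_ + $2]))).

(** Labels are treated from [k] down to 0, so that all branches are tabulated when the centre needs
    them. *)
Definition g_ : xe := k_ - $1.
Definition IX_ (g v : xe) : xe := 21@[g * k_ + v].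
Definition BD_ (g v : xe) : xe := 20@[g * k_ + v].
Definition dig_ : xe := ($2 %/ Prd $4 (base_ g_ $5)) %% base_ g_ $4.

(** Each pass settles the vertices whose chosen predecessor is settled. Depths are at most [k] and
    boundary vertices come after their branch, hence [k + 2] passes. *)
Definition p_phi : il :=
  For k_ (Put 23 $3 (#0)) ;;
  For (k_ + #2) (For k_ (Put 23 $4 (IX_ g_ $4 *
    (isrt_ g_ $4 * (dig_ + #1) + not_ (isrt_ g_ $4) *
      9@[(dig_ %% (11@[#0] + #1)) * (n_ + #1) + 23@[dig_ %/ (11@[#0] + #1)]])))).

Definition badl_ : xe :=
  Sum k_ (IX_ g_ $3 * not_ 23@[$3]) +
  Sum k_ (Sum k_ (IX_ g_ $3 * IX_ g_ $4 * Q_ $3 $4 *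
    (H_ $3 $4 * not_ 10@[23@[$3] * (n_ + #1) + 23@[$4]] +
     not_ (H_ $3 $4) * not_ (23@[$3] == 23@[$4])))).

(** The number [$0] of the pattern is part of the key, so that the tables never have to be
    cleared. *)
Definition key_ (g x : xe) : xe := ($0 * (k_ + #1) + g) * 31@[#0] + x.
Definition bidx_ (l : nat) (g : xe) : xe :=
  Sum k_ (BD_ g $l * 23@[$l] * Prd $l (n_ + #1)).

(** Here, in [p_arc] and in [p_sign], the minima never change a value: they
    only make its size visible to the static bounds [typ]. *)
Definition p_task : il :=
  p_phi ;;
  Ite (not_ badl_)
    (Put 24 (#0) (key_ g_ (Sum k_ (23@[$3] * Prd $3 (n_ + #1)))) ;;
     Ite (not_ 25@[24@[#0]])
       (Put 25 24@[#0] (#1) ;;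
        Put 27 (#0) (not_ (not_ g_) + not_ g_ *
          Prd k_ (26@[key_ ($3 + #1) (bidx_ 4 ($3 + #1))])) ;;
        Put 26 (key_ g_ (bidx_ 3 g_))
          (Bin OMin (26@[key_ g_ (bidx_ 3 g_)] + 27@[#0]) 30@[#0]))
       Nop)
    Nop.

Definition p_sign : il :=
  Ite (sgn_ %% #2)
    (Put 29 (#0) (Bin OMin (29@[#0] + 26@[key_ (#0) (#0)]) 30@[#0]))
    (Put 28 (#0) (Bin OMin (28@[#0] + 26@[key_ (#0) (#0)]) 30@[#0])).

Definition p_eval : il := For (k_ + #1) (For 22@[g_] p_task).

Definition p_pattern (inj : bool) : il :=
  p_bits ;;
  Ite (not_ (badq_ inj)) (p_search ;; p_tables ;; p_eval ;; p_sign) Nop.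

Definition p_main inj : il := For 12@[#0] (p_pattern inj).

Definition aut_ : xe :=
  Sum 14@[#0] (not_ (Sum k_ (Sum k_ (
    not_ ($1 == $2) * ((($0 %/ Prd $1 k_) %% k_) == (($0 %/ Prd $2 k_) %% k_)) +
    not_ (H_ $1 $2 == H_ (($0 %/ Prd $1 k_) %% k_) (($0 %/ Prd $2 k_) %% k_)))))).

Definition p_out (inj : bool) : il :=
  if inj then Put 0 (#0) ((28@[#0] - 29@[#0]) %/ aut_) else Put 0 (#0) (28@[#0] - 29@[#0]).

Definition p_all inj : il :=
  Put 4 (#0) 0@[#0] ;; p_setup ;; p_peel ;; p_orient ;; p_main inj ;; p_out inj.

Local Close Scope xe_scope.

(** Three typings for three phases. While arrays 11 to 14 are filled, nothing better than [Bg 10] is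
    known about them; afterwards their contents are at most [K], and [sty1] makes the loops they
    control small. At the end [sty2] lets the result overwrite the input cell of array 0. *)
Definition sty0 (a : nat) : ty :=
  if a <= 3 then Bg 1
  else if a \in [:: 4; 15; 17; 19; 21; 25] then Sm 1
  else if a == 20 then Sm 0
  else if a == 23 then Bg 30
  else if a \in [:: 26; 28; 29; 30] then Bg 26
  else if a \in [:: 24; 27] then Bg 60
  else if a \in [:: 18; 22] then Bg 25 else Bg 10.
Definition sty1 (a : nat) : ty :=
  if a \in [:: 11; 12; 13; 14] then Sm 1 else sty0 a.
Definition sty2 (a : nat) : ty := if a == 0 then Bg 60 else sty1 a.

(** * Frame properties of programs *)

Fixpoint wr (p : il) : seq nat :=
  match p with
  | Nop => [::]
  | Put a _ _ => [:: a]
  | Sq p q | Ite _ p q => wr p ++ wr q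
  | For _ p => wr p
  end.

Fixpoint rd (e : xe) : seq nat :=
  match e with
  | Cst _ | Var _ => [::]
  | Arr a i => a :: rd i
  | Bin _ e1 e2 | Sum e1 e2 | Prd e1 e2 => rd e1 ++ rd e2
  end.

Definition agree (P : pred nat) (s s' : store) := forall a i, P a -> s a i = s' a i.

Lemma run_frame p : forall env s a i, a \notin wr p -> run p env s a i = s a i.
Proof.
elim: p => [|b e1 e2|p IHp q IHq|e p IHp q IHq|e p IHp] env s a i //=.
- by rewrite inE => h; rewrite upd_arr.
- by rewrite mem_cat negb_or => /andP[h1 h2]; rewrite IHq ?IHp.
- by rewrite mem_cat negb_or => /andP[h1 h2]; case: ifP; rewrite ?IHq ?IHp.
move=> h; apply: (@iteri_inv _ (fun _ (t : store) => t a i = s a i)) => // j t _ <-.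
exact: IHp.
Qed.

Lemma ev_frame e : forall env s s', agree (fun a => a \in rd e) s s' ->
  ev s e env = ev s' e env.
Proof.
elim: e => [c|l|a i IH|o e1 IH1 e2 IH2|l IHl b IHb|l IHl b IHb] env s s' h //=.
- rewrite (IH env s s'); last by move=> b j hb; apply: h; rewrite inE hb orbT.
  by apply: h; rewrite inE eqxx.
- by rewrite (IH1 env s s') ?(IH2 env s s') // => a i ha; apply: h; rewrite mem_cat ha ?orbT.
- have -> : ev s l env = ev s' l env.
    by apply: IHl => a i ha; apply: h; rewrite mem_cat ha.
  apply: eq_bigr => i _; apply: IHb => a j ha; apply: h.
  by rewrite mem_cat ha orbT.
- have -> : ev s l env = ev s' l env.
    by apply: IHl => a i ha; apply: h; rewrite mem_cat ha.
  apply: eq_bigr => i _; apply: IHb => a j ha; apply: h.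
  by rewrite mem_cat ha orbT.
Qed.

Definition forst (p : il) env s i : store :=
  iteri i (fun j s' => run p (rcons env j) s') s.

Lemma forstS p env s i : forst p env s i.+1 = run p (rcons env i) (forst p env s i).
Proof. by []. Qed.

Lemma run_For l p env s : run (For l p) env s = forst p env s (ev s l env).
Proof. by []. Qed.

Lemma wk_For l p env s : wk (For l p) env s = 2 + wke s l env +
  \sum_(i < ev s l env) (2 + wk p (rcons env i) (forst p env s i)).
Proof. by []. Qed.

Lemma forst_frame p env s i a j : a \notin wr p -> forst p env s i a j = s a j.
Proof.
move=> h; apply: (@iteri_inv _ (fun _ (t : store) => t a j = s a j)) => // r t _ <-.
exact: run_frame.
Qed.

Lemma sum_lin n (F D : 'I_n -> nat) a b :
  (forall v, F v <= a + b * D v) ->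
  \sum_(v < n) F v <= a * n + b * \sum_(v < n) D v.
Proof.
move=> h; rewrite big_distrr /= -[X in a * X]card_ord mulnC -sum_nat_const.
by rewrite -big_split /=; apply: leq_sum => v _; apply: h.
Qed.

(** * Peeling and orienting the host graph *)

Section Host.
Variables (k n d : nat) (H : sgraph k) (G : sgraph n) (L : 'I_n -> seq 'I_n).
Hypotheses (hG : orientable_within G d) (hL : adjacency_lists G L).

Definition off (v : nat) : nat := \sum_(i < n | i < v) size (L i).

Record input (s : store) : Prop := {
  in_k : s 4 0 = k;
  in_n : s 0 1 = n;
  in_H : forall u v : 'I_k, s 1 (u * k + v) = H u v;
  in_off : forall v, v <= n -> s 2 v = off v;
  in_nbr : forall (v : 'I_n) j, j < size (L v) ->
    s 3 (off v + j) = nth 0 [seq val w | w <- L v] j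
}.

Lemma input_agree s s' : agree (fun a => a < 5) s s' -> input s -> input s'.
Proof.
move=> h [h1 h2 h3 h4 h5]; split; try by rewrite -h.
- by move=> u v; rewrite -h.
- by move=> v hv; rewrite -h ?h4.
- by move=> v j hj; rewrite -h ?h5.
Qed.

Lemma offS (v : 'I_n) : off v.+1 = off v + size (L v).
Proof.
rewrite /off (bigID (fun i : 'I_n => i < v)) /=; congr (_ + _).
  by apply: eq_bigl => i; rewrite ltnS; case: ltngtP.
rewrite (big_pred1 v) // => i /=; rewrite ltnS -leqNgt -eqn_leq.
by apply/eqP/eqP => [/val_inj|->].
Qed.

Lemma degE s (v : 'I_n) : input s -> s 2 (v + 1) - s 2 v = size (L v).
Proof.
move=> hs; by rewrite addn1 !(in_off hs) ?offS ?addKn //; apply: ltnW.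
Qed.

Lemma nbr_sum s (v : 'I_n) (F : nat -> nat) : input s ->
  \sum_(j < size (L v)) F (s 3 (s 2 v + j)) = \sum_(w | G v w) F w.
Proof.
move=> hs; transitivity (\sum_(w <- L v) F w); last first.
  rewrite (perm_big _ (hL v)) /= big_enum /=.
  by apply: eq_bigl => w; rewrite inE.
have -> : \sum_(w <- L v) F w = \sum_(x <- [seq val w | w <- L v]) F x.
  by rewrite big_map.
rewrite (big_nth 0) size_map big_mkord; apply: eq_bigr => j _.
by rewrite (in_off hs) ?(in_nbr hs) //; apply: ltnW.
Qed.

Definition degin (R : {set 'I_n}) v := #|[set w in R | G v w]|.

(** Every edge inside [R] is an out-arc of exactly one of its ends, so the degree sum is twice the
    number of out-arcs, of which each vertex has at most [d]. *)
Lemma deg_sum (R : {set 'I_n}) : \sum_(v in R) degin R v <= 2 * d * #|R|.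
Proof.
have [o [ho _ hd]] := hG.
have -> : \sum_(v in R) degin R v =
   \sum_(v in R) #|[set w in R | o v w]| + \sum_(v in R) #|[set w in R | o w v]|.
  rewrite -big_split /=; apply: eq_bigr => v _.
  rewrite -cardsUI (_ : _ :&: _ = set0) ?cards0 ?addn0; last first.
    apply/setP => w; rewrite !inE; have [_ h2] := ho v w.
    by case: (w \in R) => //=; apply/negbTE.
  apply: eq_card => w; rewrite !inE; have [-> _] := ho v w.
  by case: (w \in R).
have -> : \sum_(v in R) #|[set w in R | o w v]| = \sum_(v in R) #|[set w in R | o v w]|.
  under eq_bigr => v _ do rewrite -sum1dep_card.
  under [RHS]eq_bigr => v _ do rewrite -sum1dep_card.
  rewrite [LHS](exchange_big_dep (mem R)) /=; last by move=> i j _ /andP[].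
  apply: eq_bigr => i hi; apply: eq_bigl => j /=.
  by rewrite hi.
rewrite addnn -mul2n -mulnA leq_mul2l /= mulnC -sum_nat_const; apply: leq_sum => v _.
apply: leq_trans (hd v); apply: subset_leq_card; apply/subsetP => w.
by rewrite !inE => /andP[].
Qed.

Lemma size_L (v : 'I_n) : size (L v) = degin setT v.
Proof.
rewrite (perm_size (hL v)) -cardE; apply: eq_card => w; by rewrite !inE.
Qed.

Lemma total_deg : \sum_(v < n) size (L v) <= 2 * d * n.
Proof.
have := deg_sum setT; rewrite cardsT card_ord; apply: leq_trans.
rewrite [X in _ <= X](eq_bigl xpredT) => [|v]; last by rewrite inE.
by apply: leq_sum => v _; rewrite size_L.
Qed.

Definition alive (s : store) : {set 'I_n} := [set v : 'I_n | s 5 v == 0].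

Definition peeled (R : {set 'I_n}) v :=
  (v \in R) && (#|R| * degin R v <= 2 * \sum_(u in R) degin R u).

Lemma alive_deg s (v : 'I_n) : input s ->
  \sum_(j < size (L v)) (s 5 (s 3 (s 2 v + j)) == 0) = degin (alive s) v.
Proof.
move=> hs; rewrite (nbr_sum v (fun x => s 5 x == 0)) // /degin -sum1dep_card.
rewrite [RHS]big_mkcond [LHS]big_mkcond; apply: eq_bigr => w _; rewrite inE.
by case: eqP; case: (G v w).
Qed.

Definition rank_step r (s : store) (v : 'I_n) :=
  if peeled (alive s) v then r.+1 else s 5 v.

Lemma run_round r s : input s -> s 6 0 = #|alive s| ->
  (forall v : 'I_n, s 5 v <= r) ->
  let s' := run p_round [:: r] s in
  [/\ forall v : 'I_n, s' 5 v = rank_step r s v, s' 6 0 = #|alive s'|,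
      agree (fun a => a \notin [:: 5; 6; 7]) s' s &
      wk p_round [:: r] s <= 300 * (n + \sum_(v < n) size (L v) + 1)].
Proof.
move=> hs h6 hr; set S := \sum_(u in alive s) degin (alive s) u.
pose s1 := run p_degsum [:: r] s.
have s1E a i : a != 7 -> s1 a i = s a i by move=> h; rewrite /s1 /= upd_arr.
have hs1 : input s1.
  by apply: input_agree hs => a i ha; rewrite s1E //; apply: contraTneq ha => ->.
have s17 : s1 7 0 = S.
  rewrite /s1 /= upd_same (in_n hs) /S [RHS]big_mkcond; apply: eq_bigr => v _.
  by rewrite inE degE // alive_deg //; case: eqP; rewrite ?mul1n.
pose st i := forst p_remove [:: r] s1 i.
have stE i a j : a != 5 -> st i a j = s1 a j.
  by move=> ha; apply: forst_frame; rewrite inE.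
have hst i : input (st i).
  by apply: input_agree hs1 => a j ha; rewrite stE //; apply: contraTneq ha => ->.
have step i : i <= n -> forall v : 'I_n, st i 5 v = if v < i then rank_step r s v else s 5 v.
  elim: i => [|i IH] hi v; first by rewrite /st /= s1E.
  have hi' := IH (ltnW hi); pose vi := Ordinal hi.
  have vk : st i 5 vi = s 5 vi by rewrite hi' /= ltnn.
  (* Vertices already removed in this round carry the rank [r + 1], which nobody had before; so the
     degree that is counted is the one at the start of the round. *)
  have dg : \sum_(j < size (L vi)) ((st i 5 (st i 3 (st i 2 i + j)) == 0) +
       (st i 5 (st i 3 (st i 2 i + j)) == r + 1)) = degin (alive s) vi.
    rewrite (nbr_sum vi (fun x => (st i 5 x == 0) + (st i 5 x == r + 1))) //.
    rewrite /degin -sum1dep_card [RHS]big_mkcond [LHS]big_mkcond.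
    apply: eq_bigr => w _; rewrite hi' inE /rank_step /peeled inE.
    have := hr w; case: (G vi w); rewrite ?andbF ?andbT //=.
    move=> h; have e : (s 5 w == r + 1) = false by apply/eqP; lia.
    case: ltnP => _; last by rewrite e; case: eqP.
    case: ifP => [/andP[-> _]|_]; first by rewrite addn1 eqxx.
    by rewrite e; case: eqP.
  have cond : ev (st i) low_ [:: r; i] = peeled (alive s) vi.
    rewrite /= (degE vi (hst i)) dg -[i in st i 5 i]/(nat_of_ord vi) vk.
    rewrite !stE // s17 s1E // h6 /peeled inE -/S.
    by case: eqP => _; rewrite ?mul1n ?mul0n.
  have -> : st i.+1 = if peeled (alive s) vi then update (st i) 5 i (r + 1) else st i.
    have -> : st i.+1 = if ev (st i) low_ [:: r; i] != 0
       then update (st i) 5 i (r + 1) else st i by [].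
    by rewrite cond; case: peeled.
  rewrite ltnS leq_eqVlt.
  case: (boolP (peeled (alive s) vi)) => hp /=.
    rewrite addn1 /update /=.
    case: (eqVneq (v : nat) i) => [e|ne] /=.
      have -> : v = vi by apply: val_inj.
      by rewrite /rank_step hp.
    exact: hi'.
  rewrite hi'.
  case: (eqVneq (v : nat) i) => [e|ne] //=.
  have -> : v = vi by apply: val_inj.
  by rewrite ltnn /rank_step (negbTE hp).
set s2 := st n.
have s2E (v : 'I_n) : s2 5 v = rank_step r s v by rewrite /s2 step // ltn_ord.
have n1 : ev s1 n_ [:: r] = n by rewrite /= (in_n hs1).
have runE : run p_round [:: r] s = run p_count [:: r] s2.
  by rewrite /s2 /st -{1}n1.
have wkE : wk p_round [:: r] s = wk p_degsum [:: r] s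
   + (wk (For n_ p_remove) [:: r] s1 + wk p_count [:: r] s2).
  by rewrite /s2 /st -{1}n1.
move=> s'.
have s'E a i : a != 6 -> s' a i = s2 a i by move=> h; rewrite /s' runE /= upd_arr.
split.
- by move=> v; rewrite s'E.
- have n2 : s2 0 1 = n by rewrite /s2 stE // s1E // (in_n hs).
  rewrite /s' runE /= upd_same n2 -sum1_card [RHS]big_mkcond.
  by apply: eq_bigr => v _; rewrite inE upd_arr //; case: eqP.
- move=> a i; rewrite !inE !negb_or => /and3P[h1 h2 h3].
  by rewrite s'E // /s2 stE // s1E.
rewrite wkE.
set E := \sum_(v < n) size (L v).
have w1 : wk p_degsum [:: r] s <= 20 + (80 * n + 80 * E).
  rewrite /= (in_n hs); set X := \sum_(_ < n) _.
  have : X <= 80 * n + 80 * E.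
    by apply: sum_lin => v; rewrite degE // sum_nat_const card_ord; lia.
  lia.
have w2 : wk (For n_ p_remove) [:: r] s1 <= 20 + (80 * n + 80 * E).
  rewrite [wk _ _ _]/= (in_n hs1); set X := \sum_(_ < n) _.
  have : X <= 80 * n + 80 * E.
    apply: sum_lin => v.
    rewrite -/(st v) (degE _ (hst v)) sum_nat_const card_ord.
    by case: ifP => _; lia.
  lia.
have w3 : wk p_count [:: r] s2 <= 20 + 40 * n.
  rewrite /= /s2 stE // s1E // (in_n hs) sum_nat_const card_ord; lia.
lia.
Qed.

(** Markov's inequality: a survivor has more than twice the average degree. Writing this as
    [2 * S + 1] also covers a degree sum of 0, where nobody survives. *)
Lemma peel_half (R : {set 'I_n}) : 2 * #|[set v in R | ~~ peeled R v]| <= #|R|.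
Proof.
set R' := [set v in R | _]; set S := \sum_(u in R) degin R u.
have sub : R' \subset R by apply/subsetP => v; rewrite inE => /andP[].
have h1 : #|R'| * (2 * S + 1) <= S * #|R|.
  have -> : S * #|R| = \sum_(u in R) degin R u * #|R| by rewrite /S big_distrl.
  rewrite (big_setID R') /= (setIidPr sub).
  apply: leq_trans (leq_addr _ _); rewrite -sum_nat_const; apply: leq_sum => v.
  by rewrite inE /peeled => /andP[-> /=]; rewrite -ltnNge addn1 (mulnC (degin R v)).
case: (posnP S) => S0; first by move: h1; rewrite S0; nia.
nia.
Qed.

(** These neighbours were still present in the round that removed [v]. The average degree of an
    induced subgraph is at most [2 * d], and twice that is [4 * d]. *)
Definition low_rank (s : store) (v : 'I_n) :=
  #|[set w | G v w & (s 5 w == 0) || (s 5 v <= s 5 w)]| <= 4 * d.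

Record peel_inv r (s : store) : Prop := {
  peel_input : input s;
  peel_count : s 6 0 = #|alive s|;
  peel_rank : forall v : 'I_n, s 5 v <= r;
  peel_low : forall v : 'I_n, 0 < s 5 v -> low_rank s v;
  peel_exp : #|alive s| * 2 ^ r <= n
}.

Lemma peel_round r s : peel_inv r s -> peel_inv r.+1 (run p_round [:: r] s).
Proof.
case=> h1 h2 h3 h4 h5; have [e1 e2 e3 _] := run_round h1 h2 h3.
set s' := run _ _ _ in e1 e2 e3 *.
have al : alive s' = [set v in alive s | ~~ peeled (alive s) v].
  apply/setP => v; rewrite !inE e1 /rank_step.
  by case: (boolP (peeled _ _)) => h; rewrite ?andbF ?andbT.
have rle (v : 'I_n) : s' 5 v <= r.+1.
  by rewrite e1 /rank_step; case: ifP => // _; apply: leqW.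
split=> //.
- by apply: input_agree h1 => a i ha; rewrite e3 // !inE; lia.
- move=> v; rewrite e1 {1}/rank_step; case: ifP => [hp _|np s0].
    have /andP[vR hv] := hp.
    have sb : [set w | G v w & (s' 5 w == 0) || (s' 5 v <= s' 5 w)] \subset
       [set w in alive s | G v w].
      apply/subsetP => w; rewrite !inE => /andP[-> ]; rewrite andbT.
      rewrite (e1 v) /rank_step hp e1 /rank_step.
      case: ifP => [/andP[]|_]; first by rewrite inE.
      by case/orP => // hh; have := h3 w; lia.
    apply: leq_trans (subset_leq_card sb) _.
    have R0 : 0 < #|alive s| by apply/card_gt0P; exists v.
    rewrite -(leq_pmul2l R0); apply: leq_trans hv _.
    by have := deg_sum (alive s); nia.
  apply: leq_trans (h4 v s0); apply: subset_leq_card; apply/subsetP => w.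
  rewrite !inE => /andP[->]; rewrite (e1 v) /rank_step np e1 /rank_step.
  by case: ifP => // /andP[]; rewrite inE => ->.
- rewrite al expnSr; have := peel_half (alive s); nia.
Qed.

Lemma peel_skip r s : s 6 0 = 0 -> peel_inv r s -> peel_inv r.+1 s.
Proof.
move=> h0 [h1 h2 h3 h4 h5]; split=> // [v|]; first exact: leqW.
by rewrite -h2 h0.
Qed.

Lemma sum_lt_const m b C : \sum_(r < m) (if r < b then C else 0) <= b * C.
Proof.
suff : \sum_(r < m) (if r < b then C else 0) <= minn m b * C.
  by move=> h; apply: leq_trans h _; rewrite leq_mul2r geq_minr orbT.
elim: m => [|m IH]; first by rewrite big_ord0.
rewrite big_ord_recr /=; case: ltnP => h; apply: leq_trans (leq_add IH (leqnn _)) _.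
  by rewrite (minn_idPl (ltnW h)) (minn_idPl h) mulSn addnC.
by rewrite addn0 (minn_idPr h) (minn_idPr (leqW h)).
Qed.

Lemma run_peel s : input s -> (forall v : 'I_n, s 5 v = 0) ->
  let s' := run p_peel [::] s in
  [/\ agree (fun a => a \notin [:: 5; 6; 7]) s' s,
      forall v : 'I_n, 0 < s' 5 v, forall v : 'I_n, low_rank s' v &
      wk p_peel [::] s <= 20 + 10 * n + bitlen n * (300 * (n + 2 * d * n + 1))].
Proof.
move=> hs h0; pose s1 := run (Put 6 (Cst 0) n_) [::] s.
have s1E a i : a != 6 -> s1 a i = s a i by move=> h; rewrite /s1 /= upd_arr.
have al1 : alive s1 = setT by apply/setP => v; rewrite !inE s1E // h0.
have inv0 : peel_inv 0 s1.
  split.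
  - by apply: input_agree hs => a i ha; rewrite s1E //; lia.
  - by rewrite al1 cardsT card_ord /s1 /= upd_same (in_n hs).
  - by move=> v; rewrite s1E // h0.
  - by move=> v; rewrite s1E // h0.
  - by rewrite al1 cardsT card_ord expn0 muln1.
pose body := Ite (Arr 6 (Cst 0)) p_round Nop.
pose st r := forst body [::] s1 r.
have stS r : st r.+1 = if st r 6 0 != 0 then run p_round [:: r] (st r) else st r by [].
have inv r : peel_inv r (st r).
  elim: r => [|r IH] //; rewrite stS; case: eqP => /= h; first exact: peel_skip.
  exact: peel_round.
have n1 : ev s1 n_ [::] = n by rewrite /= (in_n (peel_input inv0)).
have runE : run p_peel [::] s = st n by rewrite /st -{1}n1.
move=> s'; have s'E : s' = st n := runE.
have [i1 i2 i3 i4 i5] := inv n.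
(* Nobody survives [n] rounds of halving, as [n < 2 ^ n]. *)
have al0 : #|alive (st n)| = 0.
  have := ltn_expl n (isT : 1 < 2); move: i5; case: #|_| => // m; nia.
have pos (v : 'I_n) : 0 < s' 5 v.
  rewrite s'E lt0n; apply/negP => hv; move/eqP: al0; rewrite cards_eq0 => /eqP/setP/(_ v).
  by rewrite !inE hv.
split=> //.
- move=> a i; rewrite !inE !negb_or => /and3P[a5 a6 a7].
  by rewrite s'E /st forst_frame ?s1E //= !inE !negb_or a5 a6 a7.
- by move=> v; move: (pos v); rewrite s'E; apply: i4.
have wE m : m = ev s1 n_ [::] -> wk p_peel [::] s = 4 + (4 + \sum_(r < m) (2 + (3 +
     if st r 6 0 != 0 then wk p_round [:: nat_of_ord r] (st r) else 1))).
  by move=> ->.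
rewrite (wE n (esym n1)).
set C := 300 * _; set X := \sum_(_ < n) _.
suff : X <= 6 * n + bitlen n * C by lia.
have : X <= \sum_(r < n) (6 + (if r < bitlen n then C else 0)).
  apply: leq_sum => r _; case: ifP => hr; last by lia.
  have [j1 j2 j3 j4 j5] := inv r.
  (* A round that does work has a live vertex, so [2 ^ r <= n]. *)
  have -> : r < bitlen n.
    rewrite /bitlen ltnS; apply: trunc_log_max => //; apply: leq_trans j5.
    by rewrite leq_pmull // -j2 lt0n.
  have [_ _ _] := run_round j1 j2 j3; rewrite /C; have := total_deg.
  by clear; lia.
move=> h; apply: leq_trans h _; rewrite big_split /= sum_nat_const card_ord mulnC.
by rewrite leq_add2l sum_lt_const.
Qed.

Definition arc (s : store) (v w : 'I_n) :=
  G v w && ((s 5 v < s 5 w) || (s 5 v == s 5 w) && (v < w)).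

Lemma arc_orientation s : orientation G (arc s).
Proof.
move=> u v; rewrite /arc (adj_sym G v u); case: (boolP (G u v)) => //= huv.
have : u != v by apply: contraTneq huv => ->; rewrite adj_irr.
by case: (ltngtP (s 5 u) (s 5 v)) => //= _; rewrite -val_eqE; case: ltngtP.
Qed.

Lemma arc_deg (s : store) (v : 'I_n) : 0 < s 5 v -> low_rank s v -> #|[set w | arc s v w]| <=
  4 * d.
Proof.
move=> h0; apply: leq_trans; apply: subset_leq_card; apply/subsetP => w.
rewrite !inE /arc => /andP[-> /= h]; apply/orP; right.
by case/orP: h => [/ltnW //|/andP[/eqP -> _]].
Qed.

(** Vertices are numbered from 1 in the tables 9 (out-neighbours) and 10
    (arcs); 0 stands for an undefined vertex. *)
Record oriented (A : rel 'I_n) (s : store) : Prop := {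
  or_orient : orientation G A;
  or_arc : forall v w : 'I_n, s 10 (v.+1 * n.+1 + w.+1) = A v w;
  or_arc0 : forall x, x <= n -> s 10 x = 0;
  or_le : forall i, s 9 i <= n;
  or_self : forall v : 'I_n, s 9 v.+1 = v.+1;
  or_out : forall v w, A v w ->
    exists2 j, j <= s 11 0 & s 9 (j * n.+1 + v.+1) = w.+1;
  or_deg : s 11 0 <= 4 * d
}.

Lemma idx_eq j j' x x' m : x <= m -> x' <= m ->
  (j * m.+1 + x == j' * m.+1 + x') = (j == j') && (x == x').
Proof.
move=> hx hx'; apply/eqP/andP => [e|[/eqP -> /eqP ->] //].
have ex y i : y <= m -> (i * m.+1 + y) %/ m.+1 = i.
  by move=> hy; rewrite divnMDl // divn_small ?addn0.
have ej : j = j' by rewrite -(ex x j hx) e ex.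
by move: e; rewrite ej => /addnI ->.
Qed.

(** [v] is the vertex whose list is being read, with [v = n] between two vertices; self entries are
    written below [m], and [P] marks the pairs already treated. *)
Record or_inv (A : rel 'I_n) (v m : nat) (P : rel 'I_n) (s t : store) : Prop := {
  oi_frame : agree (fun a => a \notin [:: 8; 9; 10; 11]) t s;
  oi_cnt : forall u : 'I_n, v = u -> t 8 0 = #|[set w | A u w & P u w]|;
  oi_arc : forall u w : 'I_n, t 10 (u.+1 * n.+1 + w.+1) = A u w && P u w;
  oi_arc0 : forall x, x <= n -> t 10 x = 0;
  oi_le : forall i, t 9 i <= n;
  oi_self : forall u : 'I_n, u < m -> t 9 u.+1 = u.+1;
  oi_out : forall u w : 'I_n, A u w -> P u w ->
    exists j, [/\ j <= t 11 0, v = u -> j <= t 8 0 &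
                 t 9 (j * n.+1 + u.+1) = w.+1];
  oi_deg : t 11 0 <= 4 * d;
  oi_max : forall u : 'I_n, v = u -> t 8 0 <= t 11 0
}.

Lemma or_step s (v : 'I_n) m (P : rel 'I_n) t j : input s ->
  let A := arc s in let w := nth v (L v) j in
  #|[set w | A v w]| <= 4 * d -> j < size (L v) -> ~~ P v w ->
  or_inv A v m P s t ->
  or_inv A v m (fun u x => P u x || (u == v) && (x == w)) s (run p_arc [:: nat_of_ord v; j] t).
Proof.
move=> hs A w hd hj nP [i1 i2 i3 i4 i5 i6 i7 i8 i9].
have ht : input t.
  by apply: input_agree hs => a i ha; rewrite i1 // !inE; lia.
have hv := ltn_ord v; have hw := ltn_ord w.
have Gw : G v w.
  have : w \in L v by rewrite /w mem_nth.
  by rewrite (perm_mem (hL v)) mem_enum inE.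
have nbr : t 3 (t 2 v + j) = w.
  by rewrite (in_off ht (ltnW hv)) (in_nbr ht hj) (nth_map v).
have tn : t 0 1 = n by apply: in_n.
have bef : ev t (before_ (Var 0) (nbr_ (Var 0) (Var 1))) [:: nat_of_ord v; j] = A v w.
  rewrite /= nbr !i1 // /A /arc Gw /=.
  by case: (ltngtP (s 5 v) (s 5 w)) => //= _; case: (_ < _).
have run1 : run p_arc [:: nat_of_ord v; j] t =
   if A v w then let t1 := update t 8 0 (minn (t 8 0 + 1) (t 0 1)) in
     let t2 := update t1 9 (t1 8 0 * (t1 0 1 + 1) + (v + 1)) (t1 3 (t1 2 v + j) + 1) in
     let t3 := update t2 10 ((v + 1) * (t2 0 1 + 1) + (t2 3 (t2 2 v + j) + 1)) 1 in
     if t3 11 0 < t3 8 0 then update t3 11 0 (t3 8 0) else t3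
   else t.
  have -> : run p_arc [:: nat_of_ord v; j] t = if ev t (before_ (Var 0) (nbr_ (Var 0) (Var
    1))) [:: nat_of_ord v; j] != 0
      then run p_arc [:: nat_of_ord v; j] t else t.
    by rewrite /=; case: ifP.
  rewrite bef; case hA: (A v w) => //=; move: bef; rewrite hA => /= ->.
  by rewrite /=; case: ifP => h; case: ifP => h' //; move: h h'; case: (_ < _).
rewrite run1; case: (boolP (A v w)) => hA; last first.
  have AP u x : A u x && (P u x || (u == v) && (x == w)) = A u x && P u x.
    case: (boolP (A u x)) => //= hux; case: (boolP (P u x)) => //= _.
    by apply/negbTE; apply: contraNN hA => /andP[/eqP <- /eqP <-].
  split=> // [u e|u x|u x hux hP].
  - by rewrite (i2 u e); apply: eq_card => x; rewrite !inE AP.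
  - by rewrite i3 AP.
  - by apply: i7 => //; move: (AP u x); rewrite hux /= => <-.
set c := t 8 0.
have cE : c = #|[set w | A v w & P v w]| by apply: i2.
have cS : #|[set x | A v x & (P v x || (v == v) && (x == w))]| = c.+1.
  have -> : [set x | A v x & (P v x || (v == v) && (x == w))] = w |: [set x | A v x & P v x].
    apply/setP => x; rewrite !inE eqxx /=; case: (eqVneq x w) => [->|];
      rewrite ?hA ?orbT ?orbF //.
  by rewrite cardsU1 inE (negbTE nP) andbF cE.
have cd : c.+1 <= 4 * d.
  rewrite -cS; apply: leq_trans hd; apply: subset_leq_card; apply/subsetP => x.
  by rewrite !inE => /andP[].
have cn : c.+1 <= n by rewrite -cS; apply: leq_trans (max_card _) _; rewrite card_ord.
set t1 := update t 8 0 _.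
have t1c : t1 = update t 8 0 c.+1 by rewrite /t1 tn -/c addn1 (minn_idPl cn).
rewrite t1c {t1 t1c}; cbv zeta; rewrite !(upd_same, upd_arr) // !addn1 tn nbr.
set t3 := update (update _ 9 _ _) 10 _ _.
set t4 := (if _ then _ else _).
have t4E a i : a != 11 -> t4 a i = t3 a i by rewrite /t4; case: ifP => // _ h; rewrite upd_arr.
have t411 : t4 11 0 = maxn (t 11 0) c.+1.
  by rewrite /t4; case: ltnP => h; rewrite ?upd_same.
have t48 : t4 8 0 = c.+1 by rewrite t4E.
have t49 i : t4 9 i = if i == c.+1 * n.+1 + v.+1 then w.+1 else t 9 i.
  by rewrite t4E.
have t410 i : t4 10 i = if i == v.+1 * n.+1 + w.+1 then 1 else t 10 i.
  by rewrite t4E.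
split.
- move=> a i ha; have := ha; rewrite !inE !negb_or => /and4P[a8 a9 a10 a11].
  by rewrite t4E // /t3 !upd_arr // i1.
- move=> u e; have -> : u = v by apply: val_inj.
  by rewrite t48 cS.
- move=> u x; rewrite t410 idx_eq // eqSS i3 eqSS !val_eqE.
  case: (eqVneq u v) => [->|_] /=; last by rewrite orbF.
  by case: (eqVneq x w) => [->|_] /=; rewrite ?hA ?orbT ?orbF.
- move=> x hx; rewrite t410; case: eqP => [e|_]; last exact: i4.
  by move: hx; rewrite e mulSn; lia.
- by move=> i; rewrite t49; case: ifP.
- move=> u hu; rewrite t49; case: eqP => [e|_]; last exact: i6.
  by have := ltn_ord u; move: e; rewrite mulSn; lia.
- move=> u x hux; rewrite t411 t48 => /orP[hP|/andP[/eqP -> /eqP ->]].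
    have [j' [h1 h2 h3]] := i7 u x hux hP.
    exists j'; rewrite t49 idx_eq // eqSS val_eqE; split.
    + by rewrite leq_max h1.
    + by move=> /h2; apply: leqW.
    + case: andP => // -[/eqP ej /eqP eu].
      by have := h2 (congr1 val (esym eu)); rewrite ej -/c ltnn.
  exists c.+1; rewrite t49 eqxx leq_max leqnn orbT; split=> //.
- by rewrite t411 geq_max i8.
- by move=> u e; rewrite t48 t411 leq_max leqnn orbT.
Qed.

Lemma wk_arc env t : wk p_arc env t <= 108.
Proof.
by rewrite /=; case: ifP => _ //; case: ifP.
Qed.

Lemma run_orient s : input s -> (forall v : 'I_n, #|[set w | arc s v w]| <= 4 * d) ->
  (forall a i, a \in [:: 8; 9; 10; 11] -> s a i = 0) ->
  let s' := run p_orient [::] s in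
  [/\ agree (fun a => a \notin [:: 8; 9; 10; 11]) s' s, oriented (arc s) s' &
      wk p_orient [::] s <= 200 * (n + 2 * d * n + 1)].
Proof.
move=> hs hd h0; set A := arc s.
pose body := Sq (Put 8 (Cst 0) (Cst 0)) (Sq (Put 9 (Bin OAdd (Var 0) (Cst 1)) (Bin OAdd (Var
  0) (Cst 1)))
   (For (deg_ (Var 0)) p_arc)).
pose st i := forst body [::] s i.
pose P0 i : rel 'I_n := fun u _ => u < i.
have inp t m v P : or_inv A v m P s t -> input t.
  case=> h _ _ _ _ _ _ _ _; apply: input_agree hs => a i ha; rewrite h // !inE; lia.
have vertex (v : 'I_n) t : or_inv A n v (P0 v) s t ->
    or_inv A n v.+1 (P0 v.+1) s (run body [:: nat_of_ord v] t) /\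
    wk body [:: nat_of_ord v] t <= 60 + 110 * size (L v).
  move=> inv; have it := inp _ _ _ _ inv; case: inv => [i1 i2 i3 i4 i5 i6 i7 i8 i9].
  pose t1 := update (update t 8 0 0) 9 v.+1 v.+1.
  have run1 : run (Sq (Put 8 (Cst 0) (Cst 0)) (Put 9 (Bin OAdd (Var 0) (Cst 1)) (Bin OAdd
    (Var 0) (Cst 1)))) [:: nat_of_ord v] t = t1.
    by rewrite /= !addn1.
  have inv1 : or_inv A v v.+1 (P0 v) s t1.
    split=> //.
    - move=> a i ha; have := ha; rewrite !inE !negb_or => /and4P[a8 a9 a10 a11].
      by rewrite /t1 !upd_arr // i1.
    - move=> u e; rewrite /t1 upd_arr // upd_same; apply/esym/eqP; rewrite cards_eq0.
      by apply/eqP/setP => w; rewrite !inE /P0 e ltnn andbF.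
    - move=> i; rewrite /t1 /update /=; case: ifP => // _; exact: ltn_ord.
    - move=> u hu; rewrite /t1 /update /= eqSS.
      case: (eqVneq (u : nat) v) => [->|ne] //; rewrite i6 //.
      by move: hu; rewrite ltnS leq_eqVlt (negbTE ne).
    - move=> u w hA hP; have [j [h1 _ h3]] := i7 u w hA hP.
      exists j; rewrite /t1; split=> //; first by move=> e; move: hP; rewrite /P0 e ltnn.
      rewrite /update /= -[v.+1]add0n -{1}(mul0n n.+1) idx_eq //.
      case: andP => // -[/eqP ej /eqP [eu]].
      by move: hP; rewrite /P0 eu ltnn.
  pose Pj j : rel 'I_n := fun u w => (u < v) || (u == v) && (w \in take j (L v)).
  pose sj j := forst p_arc [:: nat_of_ord v] t1 j.
  have uL : uniq (L v) by rewrite (perm_uniq (hL v)) enum_uniq.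
  have orext (P P' : rel 'I_n) m x t0 : P =2 P' -> or_inv A x m P s t0 -> or_inv A x m P' s t0.
    move=> e [k1 k2 k3 k4 k5 k6 k7 k8 k9]; split=> //.
    - by move=> u hu; rewrite (k2 u hu); apply: eq_card => w; rewrite !inE e.
    - by move=> u w; rewrite k3 e.
    - by move=> u w hA; rewrite -e; apply: k7.
  have stepj j : j <= size (L v) -> or_inv A v v.+1 (Pj j) s (sj j).
    elim: j => [|j IH] hj.
      by apply: orext inv1 => u w; rewrite /P0 /Pj take0 in_nil andbF orbF.
    have := or_step hs (hd v) hj _ (IH (ltnW hj)).
    rewrite {1}/Pj ltnn eqxx /=.
    have nin : nth v (L v) j \notin take j (L v).
      have := uL; rewrite -{1}(cat_take_drop j (L v)) (drop_nth v hj) cat_uniq.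
      by case/and3P => _ /= /norP[].
    move=> /(_ nin); apply: orext => u w.
    by rewrite /Pj (take_nth v hj) mem_rcons inE; case: (u < v); case: (u == v) => //=;
      rewrite ?andbF orbC.
  have dE : ev t1 (deg_ (Var 0)) [:: nat_of_ord v] = size (L v).
    exact: (degE _ (inp _ _ _ _ inv1)).
  have runE : run body [:: nat_of_ord v] t = sj (size (L v)).
    rewrite -dE -[LHS]/(run (For (deg_ (Var 0)) p_arc) [:: nat_of_ord v]
      (run (Sq (Put 8 (Cst 0) (Cst 0)) (Put 9 (Bin OAdd (Var 0) (Cst 1)) (Bin OAdd (Var 0)
        (Cst 1)))) [:: nat_of_ord v] t)).
    by rewrite run1.
  split.
    rewrite runE; have [k1 k2 k3 k4 k5 k6 k7 k8 k9] := stepj _ (leqnn _).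
    have PjE u w : A u w -> Pj (size (L v)) u w = P0 v.+1 u w.
      rewrite /Pj /P0 take_size ltnS [u <= v]leq_eqVlt => hA.
      case: (ltngtP u v) => //= e; first by rewrite -val_eqE /= gtn_eqF.
      have eu : u = v by apply: val_inj.
      rewrite eu eqxx /= (perm_mem (hL v)) mem_enum inE.
      by move: hA; rewrite eu /A /arc => /andP[].
    split=> //.
    - by move=> u e; have := ltn_ord u; rewrite -e ltnn.
    - by move=> u w; rewrite k3; case: (boolP (A u w)) => //= /PjE ->.
    - move=> u w hA hP; have [|j [h1 h2 h3]] := k7 u w hA; first by rewrite PjE.
      by exists j; split=> // e; have := ltn_ord u; rewrite -e ltnn.
    - by move=> u e; have := ltn_ord u; rewrite -e ltnn.
  have wE : wk body [:: nat_of_ord v] t = 3 + (7 + wk (For (deg_ (Var 0)) p_arc) [:: nat_of_ord v]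
      (run (Sq (Put 8 (Cst 0) (Cst 0)) (Put 9 (Bin OAdd (Var 0) (Cst 1)) (Bin OAdd (Var 0)
        (Cst 1)))) [:: nat_of_ord v] t)) by [].
  rewrite wE run1 wk_For dE.
  have -> : wke t1 (deg_ (Var 0)) [:: nat_of_ord v] = 7 by [].
  set X := \sum_(_ < _) _; suff : X <= size (L v) * 110 by lia.
  rewrite -[size _ in X in _ <= X]card_ord -sum_nat_const; apply: leq_sum => i _.
  by have := wk_arc (rcons [:: nat_of_ord v] i) (sj i); rewrite /sj; lia.
have step i : i <= n -> or_inv A n i (P0 i) s (st i).
  elim: i => [|i IH] hi.
    have no (u : 'I_n) : n = u -> False by move=> e; have := ltn_ord u; rewrite -e ltnn.
    rewrite -[st 0]/s; split=> //; try by move=> u /no.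
    - by move=> u w; rewrite h0 // /P0 ltn0 andbF.
    - by move=> x _; rewrite h0.
    - by move=> x; rewrite h0.
    - by rewrite h0.
  by have [h _] := vertex (Ordinal hi) _ (IH (ltnW hi)).
have n1 : ev s n_ [::] = n by rewrite /= (in_n hs).
have runE : run p_orient [::] s = st n by rewrite -n1.
move=> s'; have s'E : s' = st n := runE.
have [i1 i2 i3 i4 i5 i6 i7 i8 i9] := step n (leqnn n).
split.
- by rewrite s'E.
- rewrite s'E; split=> //.
  + exact: arc_orientation.
  + by move=> v w; rewrite i3 /P0 ltn_ord andbT.
  + by move=> v; rewrite i6.
  + move=> v w hA; have [|j [h1 h2 h3]] := i7 v w hA; first by rewrite /P0.
    by exists j.
have wE m : m = ev s n_ [::] -> wk p_orient [::] s = 4 + \sum_(r < m) (2 + wk body [::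
  nat_of_ord r] (st r)).
  by move=> ->.
rewrite (wE n (esym n1)); set X := \sum_(_ < _) _.
have : X <= 62 * n + 110 * \sum_(v < n) size (L v).
  apply: sum_lin => v; have [_ h] := vertex v _ (step v (ltnW (ltn_ord v))); lia.
have := total_deg; lia.
Qed.

End Host.

(** * Inclusion-exclusion *)

Section InclusionExclusion.
Variables (k n : nat) (H : sgraph k) (G : sgraph n) (A : rel 'I_n).
Hypothesis oA : orientation G A.
Variable inj : bool.

Definition qvalid (q : {ffun 'I_k * 'I_k -> bool}) : bool :=
  [forall u, forall v, if H u v then q (u, v) != q (v, u)
    else (q (u, v) == q (v, u)) && (q (u, v) ==> inj && (u != v))].

Definition qrel (x : 'I_k * 'I_k) (a b : 'I_n) : bool :=
  if H x.1 x.2 then A a b else a == b.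

Definition qsat (q : {ffun 'I_k * 'I_k -> bool}) (phi : {ffun 'I_k -> 'I_n}) : bool :=
  [forall u, forall v, q (u, v) ==> qrel (u, v) (phi u) (phi v)].

(** Each identified pair is counted once; the parity of this set is the sign of the pattern. *)
Definition qeq (q : {ffun 'I_k * 'I_k -> bool}) :=
  [set p : 'I_k * 'I_k | [&& p.1 < p.2, ~~ H p.1 p.2 & q p]].

Definition qodd q := odd #|qeq q|.

Definition qgood (phi : {ffun 'I_k -> 'I_n}) : bool :=
  [forall u, forall v, H u v ==> G (phi u) (phi v)] && (inj ==> injectiveb phi).

Lemma qvalidP (q : {ffun 'I_k * 'I_k -> bool}) : qvalid q -> forall u v, if H u v then q (u,
  v) != q (v, u)
    else (q (u, v) == q (v, u)) && (q (u, v) ==> inj && (u != v)).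
Proof. by move=> /forallP h u v; move/forallP: (h u). Qed.

Lemma qsatP (q : {ffun 'I_k * 'I_k -> bool}) (phi : {ffun 'I_k -> 'I_n}) : reflect
  (forall u v, q (u, v) -> qrel (u, v) (phi u) (phi v)) (qsat q phi).
Proof.
apply: (iffP forallP) => h u; first by move=> v; move/forallP: (h u) => /(_ v)/implyP.
by apply/forallP => v; apply/implyP; apply: h.
Qed.

(* Given a homomorphism, the constraints on the edges of [H] are forced. *)
Definition qcan (phi : {ffun 'I_k -> 'I_n}) :=
  [ffun p : 'I_k * 'I_k => H p.1 p.2 && A (phi p.1) (phi p.2)].

Lemma qedge (phi : {ffun 'I_k -> 'I_n}) (q : {ffun 'I_k * 'I_k -> bool}) u v :
  qvalid q -> qsat q phi -> H u v ->
  q (u, v) = A (phi u) (phi v).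
Proof.
move=> hq /qsatP hs huv; have [a1 a2] := oA (phi u) (phi v).
have := qvalidP hq u v; rewrite huv => h.
have := hs u v; have := hs v u; rewrite /qrel /= (adj_sym H v u) huv.
move: h a2; case: (q (u, v)); case: (q (v, u)) => //= _.
  by move=> _ _ /(_ isT) ->.
by move=> a2 /(_ isT) h _; move: a2; rewrite h andbT => /negbTE ->.
Qed.

(** For a fixed map. If it is not a homomorphism, it satisfies no valid pattern. If injectivity is
    required and fails, two non-adjacent vertices have the same image, and toggling this pair is a
    sign-reversing involution. Otherwise [qcan phi] is the only valid pattern that it satisfies, and
    it identifies no pair. *)
Lemma qcount (phi : {ffun 'I_k -> 'I_n}) :
  #|[set q | [&& qvalid q, ~~ qodd q & qsat q phi]]| =
  #|[set q | [&& qvalid q, qodd q & qsat q phi]]| + qgood phi.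
Proof.
case: (boolP [forall u, forall v, H u v ==> G (phi u) (phi v)]) => hom; last first.
  rewrite /qgood (negbTE hom) addn0.
  suff no q : qvalid q -> qsat q phi = false.
    have z F : [set q | [&& qvalid q, F q & qsat q phi]] = set0.
      by apply/setP => q; rewrite !inE; case E: (qvalid q); rewrite //= no ?andbF.
    by rewrite (z (fun q => ~~ qodd q)) (z qodd) cards0.
  move=> hq; apply/negP => hs; case/negP: hom.
  apply/forallP => u; apply/forallP => v; apply/implyP => huv.
  have [-> _] := oA (phi u) (phi v).
  have := qvalidP hq u v; rewrite huv (qedge hq hs huv).
  by rewrite (qedge hq hs); [case: A; case: A | rewrite adj_sym].
have homP u v : H u v -> G (phi u) (phi v).
  by move=> huv; move/forallP: hom => /(_ u)/forallP/(_ v)/implyP; apply.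
case: (boolP (inj && [exists p : 'I_k * 'I_k,
    [&& p.1 < p.2, ~~ H p.1 p.2 & phi p.1 == phi p.2]])) => [|hne].
  case/andP=> hinj /existsP[[u v] /= /and3P[huv hH /eqP eqp]].
  have -> : qgood phi = false.
    rewrite /qgood hinj /=; apply/negbTE; rewrite negb_and; apply/orP; right.
    by apply/negP => /injectiveP h; have e := h _ _ eqp; rewrite e ltnn in huv.
  have nuv : u != v by apply: contraTneq huv => ->; rewrite ltnn.
  rewrite addn0.
  pose tog (q : {ffun 'I_k * 'I_k -> bool}) :=
    [ffun p => q p (+) ((p == (u, v)) || (p == (v, u)))].
  have togK : involutive tog.
    by move=> q; apply/ffunP => p; rewrite !ffunE -addbA addbb addbF.
  have togV q : qvalid q -> qvalid (tog q).
    move=> hq; apply/forallP => a; apply/forallP => b; rewrite !ffunE !xpair_eqE.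
    have := qvalidP hq a b; case: ifP => hab.
      have -> : (a == u) && (b == v) = false.
        by apply/negP => /andP[/eqP ea /eqP eb]; rewrite -ea -eb hab in hH.
      have -> : (a == v) && (b == u) = false.
        by apply/negP => /andP[/eqP ea /eqP eb]; rewrite adj_sym -ea -eb hab in hH.
      have -> : (b == u) && (a == v) = false.
        by apply/negP => /andP[/eqP ea /eqP eb]; rewrite -ea -eb adj_sym hab in hH.
      have -> : (b == v) && (a == u) = false.
        by apply/negP => /andP[/eqP ea /eqP eb]; rewrite -ea -eb hab in hH.
      by rewrite !addbF.
    rewrite (andbC (b == u)) (andbC (b == v)) (orbC _ ((a == u) && _)).
    case/andP=> /eqP -> h; rewrite eqxx /= hinj /=.
    case: (boolP ((a == u) && (b == v) || (a == v) && (b == u))) => [h2|_].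
      rewrite addbT; apply/implyP => _.
      by case/orP: h2 => /andP[/eqP -> /eqP ->] //; rewrite eq_sym.
    by rewrite addbF; move: h; rewrite hinj => /implyP h; apply/implyP => /h.
  have togO q : qodd (tog q) = ~~ qodd q.
    rewrite /qodd (cardsD1 (u, v)) [in RHS](cardsD1 (u, v)).
    have -> : qeq (tog q) :\ (u, v) = qeq q :\ (u, v).
      apply/setP => -[a b]; rewrite !inE !ffunE /=.
      case: (boolP ((a, b) == (u, v))) => //= hab.
      case: (boolP ((a, b) == (v, u))) => [|_]; last by rewrite addbF.
      by rewrite xpair_eqE => /andP[/eqP -> /eqP ->]; rewrite ltnNge (ltnW huv).
    rewrite !inE /= !ffunE eqxx huv hH /= addbT !oddD.
    by case: (q (u, v)) => /=; case: odd.
  have togS q : qvalid q -> qsat q phi -> qsat (tog q) phi.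
    move=> hq hs; apply/qsatP => a b; rewrite !ffunE !xpair_eqE.
    have := qsatP _ _ hs a b; case: (q (a, b)) => //=; first by move=> ->.
    move=> _; case/orP => /andP[/eqP -> /eqP ->]; rewrite /qrel /=.
      by rewrite (negbTE hH) eqp.
    by rewrite adj_sym (negbTE hH) eqp.
  rewrite -[LHS](card_imset _ (inv_inj togK)); apply: eq_card => q.
  apply/imsetP/idP => [[q' hq' ->]|].
    move: hq'; rewrite !inE => /and3P[h1 h2 h3].
    by rewrite togV // togO h2 togS.
  rewrite inE => /and3P[h1 h2 h3]; exists (tog q); last by rewrite togK.
  by rewrite inE togV // togO h2 togS.
have uniq q : qvalid q -> qsat q phi -> q = qcan phi.
  move=> hq hs; apply/ffunP => -[u v]; rewrite ffunE /=.
  case: (boolP (H u v)) => huv /=; first exact: qedge.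
  apply/negbTE/negP => hquv; case/negP: hne.
  have := qvalidP hq u v; rewrite (negbTE huv) hquv => /andP[_] /= /andP[-> nuv] /=.
  have := qsatP _ _ hs u v hquv; rewrite /qrel /= (negbTE huv) => hphi.
  case: (ltngtP u v) => [lt|lt|/val_inj e].
  - by apply/existsP; exists (u, v); rewrite /= lt huv.
  - by apply/existsP; exists (v, u); rewrite /= lt adj_sym huv eq_sym.
  - by rewrite e eqxx in nuv.
have canV : qvalid (qcan phi).
  apply/forallP => u; apply/forallP => v; rewrite !ffunE /= (adj_sym H v u).
  case: ifP => // huv; rewrite huv //=.
  by have [h1 h2] := oA (phi u) (phi v); move: h2; have := homP _ _ huv; rewrite h1; do 2 case: A.
have canS : qsat (qcan phi) phi.
  by apply/qsatP => u v; rewrite ffunE /qrel /= => /andP[->].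
have canE : qeq (qcan phi) = set0.
  by apply/setP => -[u v]; rewrite !inE ffunE /=; case: (H u v); rewrite ?andbF.
have canO : qodd (qcan phi) = false by rewrite /qodd canE cards0.
have -> : [set q | [&& qvalid q, ~~ qodd q & qsat q phi]] = [set qcan phi].
  apply/setP => q; rewrite !inE; apply/and3P/eqP => [[h1 _ h2]|->].
    exact: uniq.
  by rewrite canO.
have -> : [set q | [&& qvalid q, qodd q & qsat q phi]] = set0.
  apply/setP => q; rewrite !inE; apply/and3P => -[h1 h2 h3].
  by move: h2; rewrite (uniq q h1 h3) canO.
rewrite cards1 cards0 /qgood hom /=.
suff -> : inj ==> injectiveb phi by [].
apply/implyP => hinj; apply/injectiveP => u v e; apply/eqP; apply: contraT => nuv.
move: hne; rewrite hinj /= negb_exists => /forallP hne.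
have nH : H u v = false.
  by apply/negP => /homP; rewrite e adj_irr.
case: (ltngtP u v) => [lt|lt|/val_inj e'].
- by have := hne (u, v); rewrite /= lt nH e eqxx.
- by have := hne (v, u); rewrite /= lt adj_sym nH e eqxx.
- by rewrite e' eqxx in nuv.
Qed.

Lemma inclusion_exclusion :
  \sum_(q | qvalid q && ~~ qodd q) #|[set phi | qsat q phi]| =
  \sum_(q | qvalid q && qodd q) #|[set phi | qsat q phi]| +
  #|[set phi | qgood phi]|.
Proof.
have sw (P : pred {ffun 'I_k * 'I_k -> bool}) :
    \sum_(q | P q) #|[set phi | qsat q phi]| =
    \sum_phi #|[set q | P q && qsat q phi]|.
  under eq_bigr => q _ do rewrite -sum1dep_card.
  rewrite (exchange_big_dep xpredT) //=; apply: eq_bigr => phi _.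
  by rewrite -sum1dep_card.
rewrite !sw -sum1dep_card [X in _ = _ + X]big_mkcond -big_split /=.
apply: eq_bigr => phi _; have := qcount phi.
have -> : [set q | qvalid q && ~~ qodd q && qsat q phi] =
  [set q | [&& qvalid q, ~~ qodd q & qsat q phi]].
  by apply/setP => q; rewrite !inE andbA.
have -> : [set q | qvalid q && qodd q && qsat q phi] =
  [set q | [&& qvalid q, qodd q & qsat q phi]].
  by apply/setP => q; rewrite !inE andbA.
by move=> ->; case: qgood.
Qed.

End InclusionExclusion.

(** * Subgraphs and automorphisms *)

Section Copies.
Variables (k n : nat) (H : sgraph k) (G : sgraph n).

Definition automorphisms : {set {ffun 'I_k -> 'I_k}} :=
  [set f : {ffun 'I_k -> 'I_k} |
    [forall u, forall v, ((u != v) ==> (f u != f v)) && (H u v == H (f u) (f v))]].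

Lemma autoP (f : {ffun 'I_k -> 'I_k}) : reflect
  (injective f /\ forall u v, H (f u) (f v) = H u v) (f \in automorphisms).
Proof.
rewrite inE; apply: (iffP forallP) => [h|[h1 h2] u].
  split=> [u v e|u v]; last by move/forallP: (h u) => /(_ v)/andP[_ /eqP].
  apply/eqP; apply: contraT => nuv; move/forallP: (h u) => /(_ v)/andP[].
  by rewrite nuv e eqxx.
apply/forallP => v; rewrite h2 eqxx andbT; apply/implyP; apply: contraNN.
by move=> /eqP/h1 ->.
Qed.

Definition copy (phi : {ffun 'I_k -> 'I_n}) : {set 'I_n} * {set {set 'I_n}} :=
  ([set phi u | u : 'I_k],
   [set [set phi p.1; phi p.2] | p in [pred p : 'I_k * 'I_k | H p.1 p.2]]).

Lemma set2_inj (T : finType) (a b c d : T) : [set a; b] = [set c; d] ->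
  a = c /\ b = d \/ a = d /\ b = c.
Proof.
move=> e; have : a \in [set c; d] by rewrite -e set21.
have : b \in [set c; d] by rewrite -e set22.
have : c \in [set a; b] by rewrite e set21.
have : d \in [set a; b] by rewrite e set22.
rewrite !inE; do 4 (case/orP => /eqP ?; subst; auto).
Qed.

Lemma copy_edge (phi : {ffun 'I_k -> 'I_n}) u v : injective phi ->
  ([set phi u; phi v] \in (copy phi).2) = H u v.
Proof.
move=> hi; apply/imsetP/idP => [[[a b] /= hab /set2_inj]|h]; last by exists (u, v).
by case=> -[/hi -> /hi ->] //; rewrite adj_sym.
Qed.

Lemma goodP (phi : {ffun 'I_k -> 'I_n}) : reflect
  (injective phi /\ forall u v, H u v -> G (phi u) (phi v)) (qgood H G true phi).
Proof.
apply: (iffP andP) => [[/forallP h /injectiveP hi]|[hi h]]; split=> //.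
- by move=> u v; move/forallP: (h u) => /(_ v)/implyP.
- by apply/forallP => u; apply/forallP => v; apply/implyP/h.
- by apply/injectiveP.
Qed.

Lemma copies_eq : [set copy phi | phi in [pred phi | qgood H G true phi]] =
  [set S : {set 'I_n} * {set {set 'I_n}} | is_subgraph G S && isomorphic_to H S].
Proof.
apply/setP => S; rewrite inE; apply/imsetP/andP.
  case=> phi /goodP[hi hh] ->; split.
    apply/andP; split.
      apply/subsetP => e /imsetP[[u v] /= huv ->].
      by apply/imset2P; exists (phi u) (phi v) => //; rewrite inE; apply: hh.
    apply/forall_inP => e /imsetP[[u v] /= huv ->].
    by apply/subsetP => x /set2P[] ->; apply: imset_f.
  apply/existsP; exists phi; apply/and3P; split; [exact/injectiveP|exact: eqxx|].
  by apply/forallP => u; apply/forallP => v; rewrite copy_edge.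
case=> /andP[/subsetP hE /forall_inP hV] /existsP[phi /and3P[/injectiveP hi /eqP h1 /forallP h2]].
have hH u v : H u v = ([set phi u; phi v] \in S.2).
  by move/forallP: (h2 u) => /(_ v)/eqP.
exists phi.
  apply/goodP; split=> // u v; rewrite hH => /hE /imset2P[a b _].
  by rewrite inE /= => hab /set2_inj[] [-> ->] //; rewrite adj_sym.
case: S hE hV h1 h2 hH => S1 S2 /= hE hV h1 h2 hH.
congr pair => //; apply/setP => e; apply/idP/imsetP => [he|[[u v] /= huv ->]];
  last by rewrite -hH.
have := hE e he => /imset2P[a b _ hab eab].
have /subsetP hs := hV e he.
have : a \in S1 by apply: hs; rewrite eab set21.
have : b \in S1 by apply: hs; rewrite eab set22.
rewrite -h1 => /imsetP[v _ ev] /imsetP[u _ eu]; exists (u, v).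
  by rewrite inE /= hH -eu -ev -eab.
by rewrite eab eu ev.
Qed.

(** Two embeddings with the same image differ by a unique automorphism of [H], applied first; so
    every fibre of [copy] is in bijection with the automorphisms. *)
Lemma sub_aut : #|[set phi | qgood H G true phi]| = sub H G * #|automorphisms|.
Proof.
rewrite -sum1dep_card (partition_big copy (fun S => S \in
  [set S : {set 'I_n} * {set {set 'I_n}} | is_subgraph G S && isomorphic_to H S])) /=; last first.
  by move=> phi h; rewrite -copies_eq; apply: imset_f.
rewrite /sub -sum_nat_const; apply: eq_bigr => S; rewrite -copies_eq.
case/imsetP => phi /goodP[hi hh] ->; rewrite sum1dep_card.
pose comp (f : {ffun 'I_k -> 'I_k}) := [ffun u => phi (f u)].
have compI : injective comp.
  by move=> f g /ffunP e; apply/ffunP => u; move: (e u); rewrite !ffunE => /hi.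
rewrite -(card_imset _ compI); apply: eq_card => psi; rewrite inE.
apply/andP/imsetP; last first.
  case=> f /autoP[fi fh] ->; split.
    apply/goodP; split=> [u v|u v huv]; rewrite !ffunE; first by move/hi/fi.
    by apply: hh; rewrite fh.
  have [g fK gK] := injF_bij fi.
  rewrite /copy; apply/eqP; congr pair; apply/setP => e.
    apply/imsetP/imsetP => -[u _ ->]; first by exists (f u); rewrite // ffunE.
    by exists (g u); rewrite // ffunE gK.
  apply/imsetP/imsetP => -[[u v] /= huv ->].
    by exists (f u, f v); rewrite /= ?inE /= ?fh // !ffunE.
  exists (g u, g v); last by rewrite /= !ffunE !gK.
  by rewrite inE /= -fh !gK.
case=> /goodP[pi ph] /eqP eS.
have ex u : {w | psi u = phi w}.
  apply: sig_eqW; have : psi u \in (copy psi).1 by apply: imset_f.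
  by rewrite eS => /imsetP[w _ ->]; exists w.
pose f := [ffun u => sval (ex u)].
have fE u : phi (f u) = psi u by rewrite ffunE -(svalP (ex u)).
exists f; last by apply/ffunP => u; rewrite ffunE fE.
apply/autoP; split=> [u v e|u v]; first by apply: pi; rewrite -!fE e.
by rewrite -(@copy_edge phi (f u) (f v) hi) !fE -(@copy_edge psi u v pi) eS.
Qed.

Lemma aut_gt0 : 0 < #|automorphisms|.
Proof.
apply/card_gt0P; exists [ffun u => u]; apply/autoP; split=> [u v|u v]; by rewrite !ffunE.
Qed.

Lemma hom_qgood : hom H G = #|[set phi | qgood H G false phi]|.
Proof. by apply: eq_card => phi; rewrite !inE /qgood andbT. Qed.

End Copies.

(** * Star decompositions *)

Section StarDecomposition.
Variables (I D : finType) (bot : D) (q : rel I) (R : I -> I -> rel D).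
Variables (m : nat) (lab : I -> nat).
Hypothesis lab_le : forall v, lab v <= m.
Hypothesis lab_closed : forall u v, q u v -> lab v = lab u \/ lab v = 0.

Definition bdy (g : nat) (v : I) : bool :=
  [&& lab v == 0, g != 0 & [exists u, q u v && (lab u == g)]].

Definition dom (g : nat) (v : I) : bool := (lab v == g) || bdy g v.

(** Partial maps are total maps with value [bot] off their domain, so that maps on different pieces
    live in one finite type. *)
Definition restr (P : pred I) (f : {ffun I -> D}) : {ffun I -> D} :=
  [ffun v => if P v then f v else bot].

Definition local (g : nat) : {set {ffun I -> D}} :=
  [set f : {ffun I -> D} | [forall v, (f v != bot) == dom g v] &&
    [forall u, forall v, [&& dom g u, dom g v & q u v] ==> R u v (f u) (f v)]].

Definition full : {set {ffun I -> D}} :=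
  [set f : {ffun I -> D} | [forall v, f v != bot] &&
    [forall u, forall v, q u v ==> R u v (f u) (f v)]].

Lemma localP g (f : {ffun I -> D}) : reflect
  ((forall v, (f v != bot) = dom g v) /\
   forall u v, dom g u -> dom g v -> q u v -> R u v (f u) (f v)) (f \in local g).
Proof.
rewrite inE; apply: (iffP andP) => [[/forallP h1 /forallP h2]|[h1 h2]]; split.
- by move=> v; rewrite (eqP (h1 v)).
- by move=> u v a b c; move/forallP: (h2 u) => /(_ v)/implyP; apply; apply/and3P.
- by apply/forallP => v; rewrite h1.
- by apply/forallP => u; apply/forallP => v; apply/implyP => /and3P[]; apply: h2.
Qed.

Lemma fullP (f : {ffun I -> D}) : reflect
  ((forall v, f v != bot) /\ forall u v, q u v -> R u v (f u) (f v)) (f \in full).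
Proof.
rewrite inE; apply: (iffP andP) => [[/forallP h1 /forallP h2]|[h1 h2]]; split=> //.
- by move=> u v a; move/forallP: (h2 u) => /(_ v)/implyP; apply.
- by apply/forallP.
- by apply/forallP => u; apply/forallP => v; apply/implyP; apply: h2.
Qed.

Lemma dom0 v : dom 0 v = (lab v == 0).
Proof. by rewrite /dom /bdy eqxx andbF orbF. Qed.

Lemma restr_full g f : f \in full -> restr (dom g) f \in local g.
Proof.
case/fullP=> h1 h2; apply/localP; split=> [v|u v hu hv huv]; rewrite !ffunE.
  by case: ifP; rewrite ?eqxx // h1.
by rewrite hu hv; apply: h2.
Qed.

(** No arc joins two branches, and none leaves the centre. Once the map is fixed on the centre, the
    extensions to the branches are therefore independent, each being tied to the centre only through
    its boundary. *)
Lemma star_fiber psi : psi \in local 0 ->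
  #|[set f in full | restr (dom 0) f == psi]| =
  \prod_(g < m) #|[set chi in local g.+1 |
                    restr (bdy g.+1) chi == restr (bdy g.+1) psi]|.
Proof.
move=> hpsi; case/localP: (hpsi) => p1 p2.
pose F (g : 'I_m) : pred {ffun I -> D} :=
  mem [set chi in local g.+1 | restr (bdy g.+1) chi == restr (bdy g.+1) psi].
have -> : \prod_(g < m) #|[set chi in local g.+1 |
    restr (bdy g.+1) chi == restr (bdy g.+1) psi]| = #|family F|.
  by rewrite card_family foldrE big_map big_enum.
pose split (f : {ffun I -> D}) := [ffun g : 'I_m => restr (dom g.+1) f].
have labx v : lab v != 0 -> exists g : 'I_m, lab v = g.+1.
  move=> h; have hg : (lab v).-1 < m by have := lab_le v; lia.
  by exists (Ordinal hg) => /=; lia.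
have spI : {in [set f in full | restr (dom 0) f == psi] &, injective split}.
  move=> f f'; rewrite !inE => /andP[_ /eqP e1] /andP[_ /eqP e2] e.
  apply/ffunP => v; case: (boolP (lab v == 0)) => hv.
    by have := congr1 (fun h : {ffun I -> D} => h v) (etrans e1 (esym e2));
      rewrite !ffunE dom0 hv.
  have [g hg] := labx v hv.
  have := congr1 (fun h : {ffun 'I_m -> {ffun I -> D}} => h g v) e.
  by rewrite !ffunE /dom hg eqxx.
rewrite -(card_in_imset spI); apply: eq_card => chi.
apply/imsetP/familyP => [[f]|hF].
  rewrite inE => /andP[hf /eqP hr] -> g; rewrite ffunE inE restr_full //=.
  apply/eqP/ffunP => v; rewrite !ffunE -hr !ffunE; case: ifP => // hb.
  by rewrite dom0 /dom hb orbT; case/and3P: hb => ->.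
have hF' g : chi g \in local g.+1 /\ restr (bdy g.+1) (chi g) = restr (bdy g.+1) psi.
  by have := hF g; rewrite inE => /andP[-> /eqP].
pose f := [ffun v => if lab v == 0 then psi v else
   if [pick g : 'I_m | lab v == g.+1] is Some g then chi g v else bot].
have f0 v : lab v = 0 -> f v = psi v by move=> h; rewrite ffunE h.
have fS v (g : 'I_m) : lab v = g.+1 -> f v = chi g v.
  move=> h; rewrite ffunE h /=; case: pickP => [g'|/(_ g)]; last by rewrite eqxx.
  by move=> /eqP[e]; congr (chi _ v); apply: val_inj.
have fb v (g : 'I_m) : dom g.+1 v -> f v = chi g v.
  case/orP => [/eqP|hb]; first exact: fS.
  have hl : lab v = 0 by case/and3P: hb => /eqP.
  rewrite f0 //; have [_ e] := hF' g.
  by have := congr1 (fun h : {ffun I -> D} => h v) e; rewrite !ffunE hb => ->.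
have hf : f \in full.
  apply/fullP; split=> [v|u v huv].
    case: (boolP (lab v == 0)) => hv; first by rewrite f0 ?(eqP hv) // p1 dom0.
    have [g hg] := labx v hv; rewrite (fS _ _ hg); have [/localP[c1 _] _] := hF' g.
    by rewrite c1 /dom hg eqxx.
  case: (boolP (lab u == 0)) => hu.
    have hv : lab v = 0 by case: (lab_closed huv) => // ->; apply/eqP.
    by rewrite !f0 ?(eqP hu) //; apply: p2; rewrite ?dom0 ?hv.
  have [g hg] := labx u hu; have [/localP[_ c2] _] := hF' g.
  have hdu : dom g.+1 u by rewrite /dom hg eqxx.
  have hdv : dom g.+1 v.
    case: (lab_closed huv) => [e|hv]; first by rewrite /dom e hg eqxx.
    apply/orP; right; rewrite /bdy hv; apply/existsP; exists u.
    by rewrite huv hg eqxx.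
  by rewrite (fb _ _ hdu) (fb _ _ hdv); apply: c2.
exists f.
  rewrite inE hf; apply/eqP/ffunP => v; rewrite ffunE dom0.
  case: ifP => [/eqP /f0 //|hv]; apply/esym/eqP.
  by have := p1 v; rewrite dom0 hv => /negbT; rewrite negbK.
apply/ffunP => g; rewrite ffunE; apply/ffunP => v; rewrite ffunE.
case: ifP => [/fb -> //|hv]; have [/localP[c1 _] _] := hF' g.
by have := c1 v; rewrite hv => /negbT; rewrite negbK => /eqP.
Qed.

Lemma star_decomposition :
  #|full| = \sum_(psi in local 0) \prod_(g < m)
    #|[set chi in local g.+1 | restr (bdy g.+1) chi == restr (bdy g.+1) psi]|.
Proof.
rewrite -sum1_card (partition_big (restr (dom 0)) (mem (local 0))) /=; last first.
  by move=> f; apply: restr_full.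
apply: eq_bigr => psi hpsi; rewrite -star_fiber //.
by rewrite -sum1dep_card.
Qed.

End StarDecomposition.

(** * Source components of sparse digraphs *)

Section LightDigraph.
Variables (T : finType) (r : rel T).
Local Notation cr := (connect r).

(** Strong components are represented by their [scc_rep]; a root represents a
    strong component that no arc enters. *)
Definition scc u v := cr u v && cr v u.
Definition scc_rep v := odflt v [pick u | scc v u].
Definition rootv s := (scc_rep s == s) && [forall u, cr u s ==> cr s u].
Definition rts z := [set s | rootv s && cr s z].
Definition joint z := 1 < #|rts z|.

Definition oneway := [set p : T * T | r p.1 p.2 && ~~ r p.2 p.1].
Definition below v := [set p in oneway | cr v p.2].
Definition ent z := [set p in oneway | scc z p.2 && ~~ scc z p.1].
(** A joint that is as far upstream as possible: each arc into its strong component comes from a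
    vertex that a single root reaches. *)
Definition topj z := joint z && [forall p in ent z, ~~ joint p.1].
Definition und u v := r u v || r v u.

Lemma sccC u v : scc u v = scc v u. Proof. by rewrite /scc andbC. Qed.

Lemma scc_refl u : scc u u. Proof. by rewrite /scc connect0. Qed.

Lemma scc_trans v u w : scc u v -> scc v w -> scc u w.
Proof.
case/andP=> a b /andP[c d].
by rewrite /scc (connect_trans a c) (connect_trans d b).
Qed.

Lemma scc_repP v : scc v (scc_rep v).
Proof.
by rewrite /scc_rep; case: pickP => //= /(_ v); rewrite scc_refl.
Qed.

Lemma scc_rep_eq u v : scc u v -> scc_rep u = scc_rep v.
Proof.
move=> h; rewrite /scc_rep.
have e : scc u =1 scc v.
  move=> w; apply/idP/idP; first by apply: scc_trans; rewrite sccC.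
  exact: scc_trans.
by rewrite (eq_pick e); case: pickP => // /(_ v); rewrite scc_refl.
Qed.

(** Among the vertices that reach [v], one that itself reaches the most vertices lies in a source
    component. *)
Lemma root_above v : exists2 s, rootv s & cr s v.
Proof.
have h0 : cr v v by apply: connect0.
pose u := [arg max_(u > v | cr u v) #|[set x | cr u x]|].
have [hu hmax] : cr u v /\ forall w, cr w v -> #|[set x | cr w x]| <= #|[set x | cr u x]|.
  by rewrite /u; case: arg_maxnP.
have [su us] := andP (scc_repP u).
exists (scc_rep u); last exact: connect_trans us hu.
rewrite /rootv -(scc_rep_eq (scc_repP u)) eqxx; apply/forallP => w; apply/implyP => hw.
have wu : cr w u by apply: connect_trans hw us.
apply: (connect_trans us).
have sb : [set x | cr u x] \subset [set x | cr w x].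
  by apply/subsetP => x; rewrite !inE; apply: connect_trans.
have := hmax w (connect_trans wu hu) => hle.
have /eqP e : [set x | cr u x] == [set x | cr w x] by rewrite eqEcard sb.
have : w \in [set x | cr w x] by rewrite inE connect0.
by rewrite -e inE.
Qed.

Lemma root_min s t : rootv s -> rootv t -> cr t s -> t = s.
Proof.
case/andP=> /eqP cs /forallP hs /andP[/eqP ct _] h.
have sst : scc s t by rewrite /scc h (implyP (hs t)).
by rewrite -cs -ct (scc_rep_eq sst).
Qed.

Lemma root_back s u : rootv s -> cr u s -> cr s u.
Proof. by case/andP => _ /forallP/(_ u)/implyP. Qed.

Lemma cross_arc (P : pred T) a b : cr a b -> ~~ P a -> P b ->
  exists u v, [/\ cr a u, r u v, cr v b, ~~ P u & P v].
Proof.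
case/connectP => p; elim: p a => [|c p IH] a /=; first by move=> _ -> /negP.
case/andP=> rac hp hb na pb; case: (boolP (P c)) => pc.
  exists a, c; split=> //; apply/connectP; by exists p.
have [u [v [h1 h2 h3 h4 h5]]] := IH c hp hb pc pb.
by exists u, v; split=> //; apply: connect_trans (connect1 rac) h1.
Qed.

Lemma crossP (P : pred T) u v : r u v -> ~~ P u -> P v ->
  (r v u -> P u) -> (u, v) \in oneway.
Proof.
move=> h1 h2 h3 h4; rewrite inE /= h1; apply/negP => /h4; exact/negP.
Qed.

Lemma jointP z : reflect (exists s t, [/\ s \in rts z, t \in rts z & s != t]) (joint z).
Proof.
apply: (iffP card_gt1P) => -[s [t [h1 h2 h3]]]; exists s, t; split=> //.
Qed.

(** Again by extremality: among the joints that reach [y], one that reaches the most vertices. A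
    joint entering its component would reach strictly more. *)
Lemma top_above y : joint y -> exists2 z, topj z & cr z y.
Proof.
move=> hy; pose P z := joint z && cr z y.
have h0 : P y by rewrite /P hy connect0.
pose z := [arg max_(u > y | P u) #|[set x | cr u x]|].
have [/andP[hz zy] hmax] : P z /\ forall w, P w -> #|[set x | cr w x]| <= #|[set x | cr z x]|.
  by rewrite /z; case: arg_maxnP.
exists z => //; rewrite /topj hz; apply/forall_inP => -[a b].
rewrite !inE /= => /and3P[/andP[rab _] /andP[zb bz] nza]; apply/negP => ja.
have az : cr a z by apply: connect_trans (connect1 rab) bz.
have sb : [set x | cr z x] \subset [set x | cr a x].
  by apply/subsetP => x; rewrite !inE; apply: connect_trans.
have pa : P a by rewrite /P ja (connect_trans az zy).
have /eqP e : [set x | cr z x] == [set x | cr a x] by rewrite eqEcard sb hmax.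
case/negP: nza; rewrite /scc az andbT.
have : a \in [set x | cr a x] by rewrite inE connect0.
by rewrite -e inE.
Qed.

(** Roots that reach the source component of [s] all coincide with [s], so that this component
    contains no joint. *)
Lemma joint_no_root s z : joint z -> s \in rts z -> ~~ scc z s.
Proof.
move=> /card_gt1P[a [b [ha hb nab]]] hs; apply: contraNN nab => /andP[zs sz].
move: ha hb hs; rewrite !inE => /andP[ra az] /andP[rb bz] /andP[rs _].
rewrite (root_min rs ra (connect_trans az zs)).
by rewrite (root_min rs rb (connect_trans bz zs)).
Qed.

Lemma ent_from s z : cr s z -> ~~ scc z s ->
  exists2 p, p \in ent z & cr s p.1.
Proof.
move=> sz nzs.
have [u [v [h1 h2 h3 h4 h5]]] := cross_arc sz nzs (scc_refl z).
exists (u, v) => //; rewrite !inE /= h2 h4 h5 !andbT.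
apply: contraNN h4 => rvu; apply: scc_trans h5 _.
by rewrite /scc (connect1 h2) (connect1 rvu).
Qed.

(** Every root of a joint lies outside its component and so comes in through an arc of [ent z]. The
    tail of this arc is not a joint, hence the arc determines the root. *)
Lemma top_rts z : topj z -> #|rts z| <= #|ent z|.
Proof.
case/andP=> jz /forall_inP hz.
pose g (p : T * T) := odflt z [pick s in rts p.1].
apply: leq_trans (leq_imset_card g _); apply: subset_leq_card.
apply/subsetP => s hs; have := hs; rewrite inE => /andP[rs sz].
have [p hp sp] := ent_from sz (joint_no_root jz hs).
apply/imsetP; exists p => //; rewrite /g.
have sp' : s \in rts p.1 by rewrite inE rs.
case: pickP => [t ht|/(_ s)]; last by rewrite sp'.
apply/eqP; apply: contraNT (hz p hp) => nst.
by apply/jointP; exists s, t.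
Qed.

Lemma ent_below z v : cr v z -> ent z \subset below v.
Proof.
move=> vz; apply/subsetP => p; rewrite !inE => /and3P[/andP[-> ->] /andP[h _] _] /=.
exact: connect_trans h.
Qed.

Lemma top_gt1 z : topj z -> 1 < #|ent z|.
Proof. by move=> h; apply: leq_trans (top_rts h); case/andP: h. Qed.

(** A topmost joint above [y] would be entered by two one-way arcs. *)
Lemma one_arc_no_joint y : #|oneway| <= 1 -> ~~ joint y.
Proof.
move=> h; apply/negP => /top_above[z /top_gt1 hz _].
have : #|ent z| <= #|oneway|.
  by apply: subset_leq_card; apply/subsetP => p; rewrite inE => /andP[].
lia.
Qed.

Lemma und_sym : connect_sym und.
Proof. by apply: sym_connect_sym => u v; rewrite /und orbC. Qed.

Lemma comp_closed (C : {set T}) c v :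
  (forall u w, u \in C -> und u w -> w \in C) -> c \in C -> connect und c v -> v \in C.
Proof.
move=> hC hc /connectP[p]; elim: p c hc => [|x p IH] c hc /=; first by move=> _ ->.
by case/andP=> h1 h2; apply: IH => //; apply: hC h1.
Qed.

(* What a root reaches is closed under adjacency: a vertex entered from outside
   would also be reached by another root. *)
Lemma few_roots_nojoint s c : rootv s -> connect und c s ->
  (forall y, cr s y -> ~~ joint y) ->
  [set t | rootv t && connect und c t] \subset [set s].
Proof.
move=> rs cs hj; apply/subsetP => t; rewrite inE => /andP[rt ct].
have hst : connect und s t by rewrite (connect_trans _ ct) // und_sym.
have : t \in [set x | cr s x].
  apply: comp_closed hst; last by rewrite inE.
  move=> u w; rewrite !inE => su /orP[ruw|rwu].
    exact: connect_trans su (connect1 ruw).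
  have [x rx xw] := root_above w.
  have xu : cr x u by apply: connect_trans xw (connect1 rwu).
  suff -> : s = x by [].
  apply/eqP; apply: contraT => nsx.
  by case/negP: (hj u su); apply/jointP; exists s, x; rewrite !inE rs rx su xu.
rewrite !inE => st; apply/eqP/esym.
exact: root_min st.
Qed.

Hypothesis light : forall v, #|below v| <= 3.

(** Otherwise the path from [t] to [x] enters the reach of [z] by a one-way arc [(a, b)] that avoids
    the component of [z], and the path from [z] to [b] enters the component of [b] by another one,
    [(c, e)]. Together with two arcs into the component of [z], this gives four one-way arcs below
    [z]. *)
Lemma root_meets_top t x z : topj z -> rootv t -> cr t x -> cr z x -> cr t z.
Proof.
move=> hz rt tx zx; apply: contraT => ntz.
have nzt : ~~ cr z t by apply: contraNN ntz; apply: root_back.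
have [a [b [ta rab bx nza zb]]] := @cross_arc (cr z) t x tx nzt zx.
have hab : (a, b) \in oneway.
  by apply: (@crossP (cr z)) => // rba; apply: connect_trans zb (connect1 rba).
have nbz : ~~ scc b z.
  apply: contraNN ntz => /andP[bz _]; apply: connect_trans ta _.
  exact: connect_trans (connect1 rab) bz.
have [[c e] he zc] := ent_from zb nbz.
have hsub : (a, b) |: ((c, e) |: ent z) \subset below z.
  apply/subsetP => p; rewrite 2!inE => /orP[/eqP ->|].
    by rewrite inE hab.
  rewrite in_setU1 => /orP[/eqP ->|]; last by apply: (subsetP (ent_below (connect0 _ _))).
  move: he; rewrite !inE /= => /and3P[-> /andP[be _] _] /=.
  exact: connect_trans zb be.
have := subset_leq_card hsub; have := light z; have := top_gt1 hz.
have n1 : (c, e) \notin ent z.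
  move: he; rewrite !inE /= => /and3P[_ be _]; rewrite negb_and; apply/orP; right.
  rewrite negb_and; apply/orP; left; apply: contraNN nbz => ze.
  by rewrite sccC; apply: scc_trans ze _; rewrite sccC.
have n2 : (a, b) \notin (c, e) |: ent z.
  rewrite in_setU1 negb_or; apply/andP; split.
    by apply: contraNneq nza => -[-> _].
  rewrite !inE /= negb_and; apply/orP; right.
  by rewrite negb_and sccC nbz.
have -> : #|(a, b) |: ((c, e) |: ent z)| = (1 + (1 + #|ent z|))%N.
  by rewrite cardsU1 n2 cardsU1 n1.
by clear; lia.
Qed.

(** Two topmost joints in different components are entered by disjoint sets of at least two arcs,
    and all four lie below [s]. *)
Lemma top_unique s z z' : rootv s -> topj z -> topj z' -> cr s z -> cr s z' -> scc z z'.
Proof.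
move=> rs hz hz' sz sz'; apply: contraT => nzz.
have dis : [disjoint ent z & ent z'].
  apply/pred0P => p /=; apply/negbTE/negP; rewrite !inE => /andP[].
  move=> /and3P[_ h1 _] /and3P[_ h2 _]; case/negP: nzz.
  by apply: scc_trans h1 _; rewrite sccC.
have hsub : ent z :|: ent z' \subset below s by rewrite subUset !ent_below.
have := subset_leq_card hsub; have := light s.
have := top_gt1 hz; have := top_gt1 hz'.
move: dis; rewrite -setI_eq0 => /eqP dis; rewrite cardsU dis cards0; lia.
Qed.

(* If there is a joint, all roots of a weak component reach the same topmost
   one, since two such joints would give more than three one-way arcs below a
   common root; and each of these roots uses its own arc into that joint. *)
Lemma few_roots c : #|[set t | rootv t && connect und c t]| <= 3.
Proof.
case: (boolP [exists y, joint y && connect und c y]) => [|nj]; last first.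
  have [s rs sc] := root_above c.
  have cs : connect und c s.
    by rewrite und_sym; apply: connect_sub sc => u v h; apply: connect1; rewrite /und h.
  apply: leq_trans (subset_leq_card (few_roots_nojoint rs cs _)) _; last by rewrite cards1.
  move=> y sy; apply: contraNN nj => jy; apply/existsP; exists y; rewrite jy.
  apply: connect_trans cs _.
  by apply: connect_sub sy => u v h; apply: connect1; rewrite /und h.
case/existsP=> y0 /andP[jy0 cy0].
have [z hz zy0] := top_above jy0.
pose C := [set v | [exists s in rts z, cr s v]].
have y0C : y0 \in C.
  have := hz; rewrite /topj => /andP[/jointP[s [_ [hs _ _]]] _].
  rewrite inE; apply/existsP; exists s; rewrite hs /=.
  by move: hs; rewrite inE => /andP[_ h]; apply: connect_trans h zy0.
have closedC u w : u \in C -> und u w -> w \in C.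
  rewrite !inE => /existsP[s /andP[hs su]] /orP[ruw|rwu].
    by apply/existsP; exists s; rewrite hs (connect_trans su (connect1 ruw)).
  have [t rt tw] := root_above w.
  apply/existsP; exists t; rewrite tw andbT inE rt /=.
  have tu : cr t u by apply: connect_trans tw (connect1 rwu).
  move: hs; rewrite inE => /andP[rs sz].
  case: (eqVneq s t) => [<- //|nst].
  have ju : joint u by apply/jointP; exists s, t; rewrite !inE rs rt su tu.
  have [z1 hz1 z1u] := top_above ju.
  have sz1 := root_meets_top hz1 rs su z1u.
  have tz1 := root_meets_top hz1 rt tu z1u.
  have /andP[_ h] := top_unique rs hz hz1 sz sz1.
  exact: connect_trans tz1 h.
apply: (@leq_trans #|rts z|); last first.
  apply: leq_trans (top_rts hz) _; apply: leq_trans (light z).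
  exact: subset_leq_card (ent_below (connect0 _ _)).
apply: subset_leq_card; apply/subsetP => t; rewrite inE => /andP[rt ct].
have : t \in C.
  by apply: (comp_closed closedC y0C); apply: connect_trans ct; rewrite und_sym.
rewrite inE => /existsP[s /andP[hs st]]; move: (hs); rewrite inE => /andP[rs _].
by rewrite -(root_min rt rs st).
Qed.

End LightDigraph.

(** * Decompositions of patterns *)

Section Certificates.
Variable k : nat.
Implicit Types (q : rel 'I_k).

(** Label 0 is the centre of the star, the other labels are its branches; the
    depth is a distance to the roots and witnesses that they reach all. *)
Record cert_ok q (lab : 'I_k -> nat) (rt : pred 'I_k) (dep : 'I_k -> nat) : Prop := {
  cert_lab : forall v, lab v <= k;
  cert_dep : forall v, dep v <= k;
  cert_closed : forall u v, q u v -> lab v = lab u \/ lab v = 0;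
  cert_reach : forall v, rt v \/ exists u, [/\ q u v, lab u = lab v & dep u < dep v]
}.

Definition width (lab : 'I_k -> nat) (rt : pred 'I_k) (w : nat) : Prop :=
  forall g, #|[set v | rt v && (lab v == g)]| <= w.

Definition outside q (W : {set 'I_k}) : rel 'I_k :=
  fun u v => [&& q u v, u \notin W & v \notin W].

(** Outside [W] the label names the weak component; the depth is the distance from [T] along arcs
    that do not cross the border of [W]. *)
Lemma cert_builder q (W T : {set 'I_k}) w :
  (forall u v, q u v -> u \in W -> v \in W) ->
  (forall v, exists2 t, t \in T &
     connect (fun x y => q x y && ((x \in W) == (y \in W))) t v) ->
  #|T :&: W| <= w ->
  (forall c, #|[set t in T | (t \notin W) && connect (und (outside q W)) c t]| <= w) ->
  exists lab rt dep, cert_ok q lab rt dep /\ width lab rt w.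
Proof.
move=> hW hT hwW hwC.
set g := (fun x y => q x y && ((x \in W) == (y \in W))) in hT.
set ur := und (outside q W) in hwC.
have ursym : connect_sym ur by apply: und_sym.
pose lab v := if v \in W then 0 else (fingraph.root ur v).+1.
pose P v i := [exists t in T, [exists p : i.-tuple 'I_k, path g t p && (last t p == v)]].
have PP v i : reflect (exists t p, [/\ t \in T, path g t p, last t p = v & size p = i]) (P v i).
  apply: (iffP exists_inP) => [[t tT /existsP[p /andP[h1 /eqP h2]]]|[t [p [h1 h2 h3 h4]]]].
    by exists t, p; split=> //; rewrite size_tuple.
  exists t => //; apply/existsP; move: h4 => /eqP h4.
  by exists (Tuple h4); rewrite /= h2 h3 eqxx.
have exP v : exists i, P v i.
  have [t tT /connectP[p h1 h2]] := hT v.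
  by exists (size p); apply/PP; exists t, p.
pose dep v := ex_minn (exP v).
have depP v : P v (dep v) /\ forall i, P v i -> dep v <= i.
  by rewrite /dep; case: ex_minnP.
exists lab, (mem T), dep; split; last first.
  case=> [|c].
    apply: leq_trans hwW; apply: subset_leq_card; apply/subsetP => v.
    by rewrite !inE /lab => /andP[-> ]; case: ifP.
  case: (boolP [exists v0, (v0 \in T) && (lab v0 == c.+1)]) => [|none]; last first.
    rewrite (_ : [set _ | _] = set0) ?cards0 //; apply/setP => v; rewrite !inE.
    by apply/negP => h; case/existsP: none; exists v.
  case/existsP=> v0 /andP[_ /eqP hv0].
  apply: leq_trans (hwC v0); apply: subset_leq_card; apply/subsetP => v.
  rewrite !inE => /andP[-> /eqP]; move: hv0; rewrite /lab /=.
  case: ifP => // _ [e0]; case: ifP => // _ [e1]; rewrite /=.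
  by apply/(rootP ursym); apply: ord_inj; rewrite e0 e1.
split=> [v|v|u v huv|v].
- by rewrite /lab; case: ifP.
- have [/PP[t [p [tT hp lp sp]]] hmin] := depP v.
  (* A path without repetitions has at most [k] vertices, which bounds the depth. *)
  case/shortenP: hp lp sp => p' h1 h2 h3 h4 _.
  have : dep v <= size p' by apply: hmin; apply/PP; exists t, p'.
  by move/card_uniqP: h2 (max_card (mem (t :: p'))) => -> /=; rewrite card_ord; lia.
- rewrite /lab; case: (boolP (v \in W)) => hv; first by right.
  have hu : u \notin W by apply: contraNN hv; apply: hW huv.
  left; rewrite (negbTE hu); congr (nat_of_ord _).+1; apply/(rootP ursym).
  by rewrite ursym; apply: connect1; rewrite /ur /und /outside huv hu hv.
have [/PP[t [p [tT hp lp sp]]] _] := depP v.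
case: (lastP p) hp lp sp => [|p' x]; first by move=> _ /= <-; left.
rewrite rcons_path last_rcons size_rcons => /andP[h1 h2] ex hs; right.
exists (last t p'); move: h2; rewrite ex /g => /andP[h2 h3]; split=> //.
  rewrite /lab (eqP h3); case: ifP => // hv.
  have hu : last t p' \notin W by rewrite (eqP h3) hv.
  congr (nat_of_ord _).+1; apply/(rootP ursym); apply: connect1.
  by rewrite /ur /und /outside h2 hu hv.
rewrite -hs ltnS; have [_] := depP (last t p'); apply.
by apply/PP; exists t, p'.
Qed.

Section Multipartite.
Variables (q : rel 'I_k) (S : eqType) (c : 'I_k -> S).
Hypothesis qc : forall u v, c u != c v -> q u v || q v u.

(** Different classes are completely joined, so arcs inside a class are the ones that depend on the
    pattern. For the patterns of [H] the one-way ones are added edges, by [xarcs_edges]. *)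
Definition xarcs := [set p in oneway q | c p.1 == c p.2].
Definition reach (B : {set 'I_k}) := [set v | [exists b in B, connect q b v]].
Definition met (W : {set 'I_k}) := [set p in xarcs | p.2 \in W].

Lemma reach_closed B u v : q u v -> u \in reach B -> v \in reach B.
Proof.
rewrite !inE => huv /exists_inP[b bB hb]; apply/exists_inP; exists b => //.
exact: connect_trans hb (connect1 huv).
Qed.

Lemma sub_reach (B : {set 'I_k}) : B \subset reach B.
Proof. by apply/subsetP => b hb; rewrite inE; apply/exists_inP; exists b. Qed.

Lemma reach_sub (B B' : {set 'I_k}) : B \subset B' -> reach B \subset reach B'.
Proof.
move=> /subsetP h; apply/subsetP => v; rewrite !inE => /exists_inP[b /h bB hb].
by apply/exists_inP; exists b.
Qed.

Lemma reach_cert (B : {set 'I_k}) w : #|B| <= w ->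
  (forall x, #|[set t | rootv (outside q (reach B)) t &&
                 connect (und (outside q (reach B))) x t]| <= w) ->
  exists lab rt dep, cert_ok q lab rt dep /\ width lab rt w.
Proof.
move=> hB hC; set W := reach B in hC; set r := outside q W in hC.
pose T := B :|: [set s | (s \notin W) && rootv r s].
apply: (@cert_builder q W T w).
- by move=> u v; apply: reach_closed.
- move=> v; case: (boolP (v \in W)) => hv.
    move: (hv); rewrite inE => /exists_inP[b bB hb]; exists b; first by rewrite inE bB.
    case/connectP: hb => p hp ->; apply/connectP; exists p => //.
    have : b \in W by apply: (subsetP (sub_reach B)).
    elim: p b {bB} hp => [|x p IH] b //= /andP[h1 h2] hb.
    have hx : x \in W by apply: reach_closed h1 hb.
    by rewrite h1 hb hx eqxx /=; apply: IH.
  have [s rs sv] := root_above r v.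
  exists s; last first.
    apply: connect_sub sv => x y /and3P[h1 h2 h3]; apply: connect1.
    by rewrite h1 (negbTE h2) (negbTE h3).
  apply/setUP; right; rewrite in_set rs andbT.
  case/connectP: sv => [[|x p]] /=; first by move=> _ <-.
  by case/andP=> /and3P[_ h _].
- apply: leq_trans hB; apply: subset_leq_card; apply/subsetP => v.
  by rewrite !inE => /andP[/orP[->|/andP[/negP h _]] h'].
- move=> x; apply: leq_trans (hC x); apply: subset_leq_card; apply/subsetP => v.
  rewrite !inE => /andP[/orP[vB|/andP[_ ->]] /andP[h ->]] //.
  by case/negP: h; have := subsetP (sub_reach B) v vB; rewrite inE.
Qed.

Lemma few_roots1 (r : rel 'I_k) x : #|oneway r| <= 1 ->
  #|[set t | rootv r t && connect (und r) x t]| <= 1.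
Proof.
move=> h; have [s rs sx] := root_above r x.
have cs : connect (und r) x s.
  by rewrite und_sym; apply: connect_sub sx => u v huv; apply: connect1; rewrite /und huv.
rewrite -(cards1 s); apply: subset_leq_card; apply: few_roots_nojoint => // y _.
exact: one_arc_no_joint.
Qed.

(** The exponent balances two demands. Each vertex of [B] beyond [s0] pays with four arcs of
    [xarcs], so the centre has at most [#|xarcs| %/ 4 + 1] roots. A branch may have three, which is
    at most [#|xarcs| %/ 4 + 2] as soon as there are four such arcs; fewer arcs need a separate
    argument. *)
Lemma cert_exists (v0 : 'I_k) : exists lab rt dep, cert_ok q lab rt dep /\
  width lab rt (if #|xarcs| == 0 then 1 else #|xarcs| %/ 4 + 2).
Proof.
pose s0 := [arg max_(u > v0) #|[set x | connect q u x]|].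
have s0max w : #|[set x | connect q w x]| <= #|[set x | connect q s0 x]|.
  by rewrite /s0; case: arg_maxnP => // i _; apply.
(* A vertex [v] of another class is joined to [s0]. If the arc goes from [v] to [s0], then [v]
   reaches all that [s0] reaches, and by the choice of [s0] the two sets are equal; so [s0] reaches
   [v] in any case. *)
have out_c (B : {set 'I_k}) v : s0 \in B -> v \notin reach B -> c v = c s0.
  move=> sB nv; apply/eqP; apply: contraNT nv => ncv.
  have rs0 x : connect q s0 x -> x \in reach B.
    by move=> h; rewrite inE; apply/exists_inP; exists s0.
  case/orP: (qc ncv) => h; last by apply: rs0; apply: connect1.
  apply: rs0; have sb : [set x | connect q s0 x] \subset [set x | connect q v x].
    by apply/subsetP => x; rewrite !inE; apply: connect_trans; apply: connect1.
  have /eqP e : [set x | connect q s0 x] == [set x | connect q v x].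
    by rewrite eqEcard sb s0max.
  have : v \in [set x | connect q v x] by rewrite inE.
  by rewrite -e inE.
have ow_out (B : {set 'I_k}) p : s0 \in B -> p \in oneway (outside q (reach B)) ->
    p \in xarcs :\: met (reach B).
  move=> sB; rewrite inE => /andP[/and3P[h1 h2 h3]].
  rewrite /outside h2 h3 !andbT => h4; apply/setDP; split.
    by rewrite inE inE h1 h4 (out_c B p.1) // (out_c B p.2) // eqxx.
  by rewrite inE negb_and h3 orbT.
have met_sub W : met W \subset xarcs by apply/subsetP => p; rewrite inE => /andP[].
have ow_card (B : {set 'I_k}) : s0 \in B -> #|oneway (outside q (reach B))| + #|met (reach
  B)| <= #|xarcs|.
  move=> sB; rewrite -(cardsID (met (reach B)) xarcs) addnC.
  rewrite (setIidPr (met_sub _)) leq_add2l; apply: subset_leq_card.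
  by apply/subsetP => p; apply: ow_out.
have s01 : s0 \in [set s0] by rewrite inE.
case: ifP => [/eqP h0|hn0].
  apply: (@reach_cert [set s0]); first by rewrite cards1.
  by move=> x; apply: few_roots1; have := ow_card _ s01; lia.
case: (leqP 4 #|xarcs|) => h4; last first.
  have -> : #|xarcs| %/ 4 = 0 by rewrite divn_small.
  set r := outside q (reach [set s0]).
  case: (boolP [exists y, joint r y]) => [/existsP[y jy]|nj]; last first.
    apply: (@reach_cert [set s0]); first by rewrite cards1.
    move=> x; have [s rs sx] := root_above r x.
    have cs : connect (und r) x s.
      by rewrite und_sym; apply: connect_sub sx => u v huv; apply: connect1; rewrite /und huv.
    apply: (@leq_trans 1) => //; rewrite -(cards1 s); apply: subset_leq_card.
    by apply: few_roots_nojoint => // y _; apply: contraNN nj => jy; apply/existsP; exists y.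
  have [z hz _] := top_above jy.
  have sB : s0 \in [set s0; z] by rewrite !inE eqxx.
  (* At least two of the at most three arcs of [xarcs] enter the component of [z]. With [z] in the
     centre at most one remains outside, which is too few for a joint. *)
  apply: (@reach_cert [set s0; z]); first by rewrite cards2; case: eqP.
  move=> x; apply: (@leq_trans 1) => //; apply: few_roots1.
  have := ow_card _ sB; have := top_gt1 hz.
  suff : #|ent r z| <= #|met (reach [set s0; z])| by lia.
  apply: subset_leq_card; apply/subsetP => p; rewrite inE => /andP[hp].
  have := ow_out _ _ s01 hp; rewrite inE => /andP[_ hx] /andP[/andP[zp _] _].
  rewrite inE hx inE; apply/exists_inP; exists z; first by rewrite !inE eqxx orbT.
  by apply: connect_sub zp => u v /and3P[h _ _]; apply: connect1.
(* Every vertex of [B] other than [s0] is paid for by four arcs that end in the reach of [B]. *)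
pose ok (B : {set 'I_k}) := (s0 \in B) && (4 * (#|B| - 1) <= #|met (reach B)|).
have ok0 : ok [set s0] by rewrite /ok s01 cards1 subnn muln0.
pose B := [arg max_(B > [set s0] | ok B) #|reach B|].
have [/andP[sB hB] hmax] : ok B /\ forall B', ok B' -> #|reach B'| <= #|reach B|.
  by rewrite /B; case: arg_maxnP.
apply: (@reach_cert B).
  have := subset_leq_card (met_sub (reach B)).
  have := leq_divM (#|xarcs|) 4; have := ltn_ceil #|xarcs| (isT : 0 < 4); lia.
move=> x; apply: (@leq_trans 3); last first.
  by have := leq_div2r 4 h4; rewrite divnn /=; lia.
(* A vertex with four one-way arcs below it, outside the centre, could be added to [B]: these arcs
   were not met before, and the reach would grow, against the choice of [B]. *)
apply: few_roots => v; rewrite leqNgt; apply/negP => h.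
set r := outside q (reach B) in h *.
have hbel p : p \in below r v -> [/\ p \in xarcs, p.2 \notin reach B & connect q v p.2].
  rewrite inE => /andP[hp vp]; have := ow_out _ _ sB hp.
  rewrite in_setD => /andP[h1 h2]; split=> //.
    by move: h1; rewrite inE h2.
  by apply: connect_sub vp => u w /and3P[h' _ _]; apply: connect1.
have nv : v \notin reach B.
  have /card_gt0P[p hp] : 0 < #|below r v| by lia.
  have [_ n2 h2] := hbel _ hp; apply: contraNN n2 => hv.
  move: hv; rewrite !inE => /exists_inP[b bB hb]; apply/exists_inP; exists b => //.
  exact: connect_trans hb h2.
have sub1 : reach B \subset reach (v |: B) by apply: reach_sub; apply: subsetUr.
have okv : ok (v |: B).
  rewrite /ok inE sB orbT cardsU1 /=.
  have nvB : v \notin B by apply: contraNN nv; apply: (subsetP (sub_reach B)).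
  rewrite nvB.
  have hs : met (reach B) :|: below r v \subset met (reach (v |: B)).
    apply/subsetP => p; rewrite inE => /orP[|/hbel[h1 h2 h3]].
      by rewrite !inE => /andP[-> h1]; move: (subsetP sub1 p.2); rewrite !inE; apply.
    by rewrite inE h1 inE; apply/exists_inP; exists v => //; rewrite !inE eqxx.
  have hd : met (reach B) :&: below r v = set0.
    apply/setP => p; rewrite in_setI in_set0; apply/negP => /andP[h1 /hbel[_ h2 _]].
    by case/negP: h2; move: h1; rewrite inE => /andP[].
  have := subset_leq_card hs; rewrite cardsU hd cards0.
  have B0 : 0 < #|B| by apply/card_gt0P; exists s0.
  have key m b y M : 4 * (y - 1) <= m -> 3 < b -> 0 < y -> m + b - 0 <= M ->
    4 * (true + y - 1) <= M by lia.
  exact: key hB h B0.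
have := hmax _ okv; apply/negP; rewrite -ltnNge; apply: proper_card.
rewrite properE sub1 /=; apply/subsetPn; exists v => //.
by apply: (subsetP (sub_reach _)); rewrite !inE eqxx.
Qed.

End Multipartite.
End Certificates.

Section PatternCertificates.
Variables (k : nat) (H : sgraph k) (inj : bool) (q : {ffun 'I_k * 'I_k -> bool}).
Hypothesis hq : qvalid H inj q.

(** Identifications go both ways, so a one-way arc of a valid pattern is an edge of [H]; if its ends
    have the same class, it is not an edge of [M]. *)
Lemma xarcs_edges (M : sgraph k) (S : eqType) (c : 'I_k -> S) :
  (forall u v, M u v = (c u != c v)) ->
  #|xarcs (fun u v => q (u, v)) c| <= #|edges H :\: edges M|.
Proof.
move=> hM; pose f (p : 'I_k * 'I_k) := [set p.1; p.2].
have fI : {in xarcs (fun u v => q (u, v)) c &, injective f}.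
  move=> [a b] [a' b'] h h' /set2_inj[[/= -> ->] //|[/= ea eb]].
  move: h h'; rewrite !inE /= ea eb => /andP[/andP[-> _] _].
  by rewrite andbF.
rewrite -(card_in_imset fI); apply: subset_leq_card; apply/subsetP => e.
case/imsetP => -[a b]; rewrite !inE /= => /andP[/andP[h1 h2] h3] ->.
have := qvalidP hq a b; case: ifP => hab; last by rewrite h1 (negbTE h2).
move=> _; apply/andP; split.
  apply/negP => /imset2P[u v _]; rewrite inE /= hM => huv /set2_inj[[ea eb]|[ea eb]].
    by move: huv; rewrite -ea -eb h3.
  by move: huv; rewrite -ea -eb eq_sym h3.
by apply/imset2P; exists a b.
Qed.

Lemma multipartite_class (M : sgraph k) : complete_multipartite M ->
  exists c : 'I_k -> {set 'I_k}, forall u v, M u v = (c u != c v).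
Proof. by case=> P _ h; exists (pblock P). Qed.

Lemma sub_edges (M : sgraph k) : edges M \subset edges H ->
  forall u v, M u v -> H u v.
Proof.
move=> /subsetP h u v huv.
have /h/imset2P[a b _] : [set u; v] \in edges M by apply/imset2P; exists u v.
by rewrite inE /= => hab /set2_inj[[-> ->]|[-> ->]] //; rewrite adj_sym.
Qed.

Lemma pattern_cert (M : sgraph k) w (v0 : 'I_k) :
  complete_multipartite M -> edges M \subset edges H ->
  w = (if #|edges H :\: edges M| == 0 then 1 else #|edges H :\: edges M| %/ 4 + 2) ->
  exists lab rt dep, cert_ok (fun u v => q (u, v)) lab rt dep /\ width lab rt w.
Proof.
move=> /multipartite_class[c hc] /sub_edges hM ->.
have qc u v : c u != c v -> q (u, v) || q (v, u).
  rewrite -hc => /hM huv; have := qvalidP hq u v; rewrite huv.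
  by case: (q (u, v)); case: (q (v, u)).
have [lab [rt [dep [h1 h2]]]] := cert_exists (q := fun u v => q (u, v)) qc v0.
exists lab, rt, dep; split=> // g; apply: leq_trans (h2 g) _.
have := xarcs_edges hc; set x := #|xarcs _ _|; set y := #|_ :\: _| => hxy.
case: (eqVneq x 0) => x0; first by case: ifP => _ //; rewrite addn2.
case: (eqVneq y 0) => [y0|_]; first by lia.
by rewrite leq_add2r leq_div2r.
Qed.

End PatternCertificates.

(** * Mixed radix numerals *)

Definition dg (b : nat -> nat) (c v : nat) : nat := (c %/ \prod_(u < v) b u) %% b v.

Lemma dg_surj (b g : nat -> nat) m : (forall v, v < m -> g v < b v) ->
  exists2 c, c < \prod_(u < m) b u & forall v, v < m -> dg b c v = g v.
Proof.
elim: m => [|m IH] hg; first by exists 0; rewrite ?big_ord0.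
have [|c hc hd] := IH; first by move=> v hv; apply: hg; apply: leqW.
set P := \prod_(u < m) b u in hc.
have hm := hg m (leqnn _); exists (g m * P + c).
  by rewrite big_ord_recr /= -/P; nia.
have P0 : 0 < P by lia.
move=> v; rewrite ltnS leq_eqVlt => /orP[/eqP ->|hv].
  by rewrite /dg -/P divnMDl // (divn_small hc) addn0 modn_small.
rewrite -(hd v hv) /dg.
have -> : P = \prod_(u < v) b u * (b v * \prod_(i < m - v.+1) b (v.+1 + i)).
  have gen r : v.+1 + r = m ->
      P = \prod_(u < v) b u * (b v * \prod_(i < r) b (v.+1 + i)).
    by move=> e; rewrite /P -e big_split_ord /= big_ord_recr /= mulnA.
  by apply: gen; rewrite subnKC.
set Q := \prod_(u < v) b u; set X := \prod_(_ < _) _.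
have Q0 : 0 < Q.
  rewrite /Q; apply: prodn_gt0 => u; have := hg u; have := ltn_ord u; lia.
rewrite (_ : g m * (Q * (b v * X)) = (g m * X * b v) * Q); last by lia.
by rewrite divnMDl // modnMDl.
Qed.

Lemma dg_lt b c v : 0 < b v -> dg b c v < b v.
Proof. by move=> h; rewrite ltn_mod. Qed.

Lemma numeral_lt b (g : nat -> nat) m : (forall v, v < m -> g v < b) ->
  \sum_(v < m) g v * b ^ v < b ^ m.
Proof.
elim: m => [|m IH] hg; first by rewrite big_ord0.
rewrite big_ord_recr /= expnS.
have h1 := hg m (leqnn _); have := IH (fun v hv => hg v (leqW hv)).
have := leq_mul h1 (leqnn (b ^ m)); rewrite mulSn.
set S := \sum_(_ < _) _; lia.
Qed.

Lemma numeral_inj b (g g' : nat -> nat) m :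
  (forall v, v < m -> g v < b) -> (forall v, v < m -> g' v < b) ->
  \sum_(v < m) g v * b ^ v = \sum_(v < m) g' v * b ^ v ->
  forall v, v < m -> g v = g' v.
Proof.
elim: m => [|m IH] hg hg' //; rewrite !big_ord_recr /= => e.
have l1 := numeral_lt (fun v hv => hg v (leqW hv)).
have l2 := numeral_lt (fun v hv => hg' v (leqW hv)).
set S1 := \sum_(_ < _) _ in e l1; set S2 := \sum_(_ < _) _ in e l2.
have p : b ^ m = (b ^ m).-1.+1 by lia.
have := @idx_eq (g m) (g' m) S1 S2 (b ^ m).-1; rewrite -p.
have -> : S1 <= (b ^ m).-1 by lia.
have -> : S2 <= (b ^ m).-1 by lia.
rewrite addnC e addnC eqxx => /(_ isT isT)/esym/andP[/eqP em /eqP es].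
move=> v; rewrite ltnS leq_eqVlt => /orP[/eqP -> //|hv].
by apply: IH hv => // u hu; [apply: hg | apply: hg']; apply: leqW.
Qed.

(** An injection into a range of the same size is a bijection; a loop over all codes thus sums over
    all objects. *)
Lemma sum_codes (T : finType) (N : nat) (code : T -> nat) (F : nat -> nat) (E : T -> nat) :
  #|T| = N -> injective code -> (forall x, code x < N) ->
  (forall x, F (code x) = E x) -> \sum_(c < N) F c = \sum_x E x.
Proof.
move=> hN hi hl hF; pose f x := Ordinal (hl x).
have fi : injective f by move=> x y [/hi].
have fb : bijective f by apply: inj_card_bij => //; rewrite card_ord hN.
rewrite (reindex f) /=; last exact: onW_bij.
by apply: eq_bigr => x _; rewrite hF.
Qed.

Section Patterns.
Variables (k n d : nat) (H : sgraph k) (G : sgraph n) (A : rel 'I_n).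

Record ctx (s : store) : Prop := {
  c_k : s 4 0 = k;
  c_n : s 0 1 = n;
  c_H : forall u v : 'I_k, s 1 (u * k + v) = H u v;
  c_or : oriented d G A s;
  c_KQ : s 12 0 = 2 ^ (k * k);
  c_KC : s 13 0 = (k.+1 * k.+1 * 2) ^ k;
  c_M : s 31 0 = n.+1 ^ k;
  c_MM : s 30 0 = 2 ^ (k * k) * n.+1 ^ k
}.

Definition ctx_arrays := [:: 0; 1; 4; 9; 10; 11; 12; 13; 30; 31].

Lemma ctx_agree s s' : agree (fun a => a \in ctx_arrays) s s' -> ctx s -> ctx s'.
Proof.
move=> h [h1 h2 h3 [o1 o2 o3 o4 o5 o6 o7] h5 h6 h7 h8].
have e a i : a \in ctx_arrays -> s' a i = s a i by move=> /h ->.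
split; rewrite ?e //; first by move=> u v; rewrite e.
split=> //; rewrite ?e //.
- by move=> v w; rewrite e.
- by move=> x hx; rewrite e ?o3.
- by move=> i; rewrite e.
- by move=> v; rewrite e.
- by move=> v w /o6[j h9 h10]; exists j; rewrite ?e.
Qed.

Lemma ctx_sub (P : pred nat) s t : all P ctx_arrays -> agree P t s -> ctx s -> ctx t.
Proof. by move=> /allP h hP; apply: ctx_agree => a i /h ha; rewrite hP. Qed.

Lemma ctx_run p env s : all (fun a => a \notin wr p) ctx_arrays -> ctx s -> ctx (run p env s).
Proof.
move=> /allP h; apply: ctx_agree => a i /h ha.
by rewrite run_frame.
Qed.

Lemma ctx_forst p env s i : all (fun a => a \notin wr p) ctx_arrays -> ctx s ->
  ctx (forst p env s i).
Proof.
by move=> /allP h; apply: ctx_agree => a j /h ha; rewrite forst_frame.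
Qed.

Lemma cell_lt (u v : nat) : u < k -> v < k -> u * k + v < k * k.
Proof. nia. Qed.

Definition has_bits (q : {ffun 'I_k * 'I_k -> bool}) (s : store) :=
  forall u v : 'I_k, s 15 (u * k + v) = q (u, v).

Definition qof (c : nat) : {ffun 'I_k * 'I_k -> bool} :=
  [ffun p : 'I_k * 'I_k => dg (fun=> 2) c (p.1 * k + p.2) == 1].

Lemma run_bits s c : ctx s -> has_bits (qof c) (run p_bits [:: c] s).
Proof.
move=> hs; rewrite /p_bits run_For /= (c_k hs).
set body := Put 15 _ _; pose st i := forst body [:: c] s i.
suff h i : i <= k * k -> forall j, j < i -> st i 15 j = dg (fun=> 2) c j.
  move=> u v; rewrite -/(st _) (h _ (leqnn _)) ?cell_lt // ffunE /=.
  have := @dg_lt (fun=> 2) c (u * k + v) isT.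
  by case: (dg _ _ _) => [|[|x]].
elim: i => [|i IH] hi j //.
have -> : st i.+1 = update (st i) 15 i (dg (fun=> 2) c i) by [].
rewrite ltnS leq_eqVlt; case: (eqVneq j i) => [->|ne] /= hj; first by rewrite upd_same.
by rewrite upd_idx // IH // ltnW.
Qed.

Lemma not_ev s e env : ev s (not_ e) env = (ev s e env == 0).
Proof. by []. Qed.

(** ** Certificates *)

Definition cb := k.+1 * k.+1 * 2.
Definition rtc (x : nat) := x %% 2 != 0.
Definition labc (x : nat) := (x %/ 2) %% k.+1.
Definition depc (x : nat) := (x %/ 2) %/ k.+1.

Section Certificate.
Variables (q : {ffun 'I_k * 'I_k -> bool}) (cd : nat -> nat).

Definition certv :=
  [forall u : 'I_k, forall v : 'I_k, q (u, v) ==>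
     (labc (cd v) == labc (cd u)) || (labc (cd v) == 0)] &&
  [forall v : 'I_k, rtc (cd v) ||
     [exists u : 'I_k, [&& q (u, v), labc (cd u) == labc (cd v) & depc (cd u) < depc (cd v)]]].

Definition isrt g v := rtc (cd v) && (labc (cd v) == g).
End Certificate.

Lemma ev_cb s env : ctx s -> ev s cb_ env = cb.
Proof. by move=> hs; rewrite /= (c_k hs) addn1. Qed.

Lemma ev_isrt s g v env : ctx s -> ev s (isrt_ g v) env = isrt (s 17) (ev s g env) (ev s v env).
Proof.
move=> hs; rewrite /= (c_k hs) addn1 /isrt /rtc /labc.
have := ltn_pmod (s 17 (ev s v env)) (isT : 0 < 2).
by case: (_ %% 2) => [|[|x]] // _; rewrite ?mul0n ?mul1n.
Qed.

Lemma run_decode l x env s : ctx s -> size env = l -> 17 \notin rd x ->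
  (forall v, ev s x (rcons env v) = ev s x env) ->
  forall v, v < k -> run (p_decode l x) env s 17 v = dg (fun=> cb) (ev s x env) v.
Proof.
move=> hs hl hx hxe; rewrite /p_decode run_For /= (c_k hs).
set body := Put 17 _ _; pose st i := forst body env s i.
suff h i : i <= k -> forall j, j < i -> st i 17 j = dg (fun=> cb) (ev s x env) j.
  by move=> v hv; rewrite -/(st _) (h _ (leqnn _)).
have nl r : nth 0 (rcons env r) l = r by rewrite nth_rcons hl ltnn eqxx.
elim: i => [|i IH] hi j //.
have hst : ctx (st i) by apply: ctx_forst.
have vx : ev (st i) x (rcons env i) = ev s x env.
  rewrite -(hxe i); apply: ev_frame => a c ha; apply: forst_frame.
  by rewrite inE; apply: contraNneq hx => <-.
have -> : st i.+1 = update (st i) 17 (nth 0 (rcons env i) l)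
    ((ev (st i) x (rcons env i) %/ \prod_(u < nth 0 (rcons env i) l) ev (st i) cb_ (rcons
      (rcons env i) u))
       %% ev (st i) cb_ (rcons env i)) by [].
rewrite vx nl ev_cb //; under eq_bigr => u _ do rewrite ev_cb //.
rewrite ltnS leq_eqVlt; case: (eqVneq j i) => [->|ne] /= hj; first by rewrite upd_same.
by rewrite upd_idx // IH // ltnW.
Qed.

Lemma ev_inv q s a b : ctx s -> has_bits q s ->
  (ev s inv_ [:: a; b] == 0) = certv q (s 17).
Proof.
move=> hs hq; rewrite /= (c_k hs) addn1 addn_eq0; congr (_ && _).
  rewrite sum_nat_eq0; apply: eq_forallb => u; rewrite implyTb sum_nat_eq0.
  apply: eq_forallb => v; rewrite implyTb hq /labc.
  case: (q _) => //=; move: (_ == _ %[mod _]) (_ %% k.+1 == 0).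
  by do 2 case.
rewrite sum_nat_eq0; apply: eq_forallb => v; rewrite implyTb /rtc.
case: (_ %% 2 == 0) => //=; rewrite mul1n eqb0 sum_nat_eq0 negb_forall.
apply: eq_existsb => u; rewrite implyTb hq /labc /depc.
by case: (q _); move: (_ == _ %[mod _]) (_ < _) => [] [].
Qed.

(** The number of candidate maps over all pieces, that is, the cost that the search minimises. *)
Definition tot (cd : nat -> nat) D := \sum_(g < k.+1) \prod_(v < k)
  (if isrt cd g v then n else k * D.+1).

Lemma ev_base s g v env : ctx s -> ev s (base_ g v) env =
  if isrt (s 17) (ev s g env) (ev s v env) then n else k * (s 11 0).+1.
Proof.
move=> hs.
have -> : ev s (base_ g v) env = ev s (isrt_ g v) env * s 0 1 +
   (ev s (isrt_ g v) env == 0) * (s 4 0 * (s 11 0 + 1)) by [].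
rewrite ev_isrt // (c_k hs) (c_n hs) addn1.
by case: isrt; rewrite ?mul1n ?mul0n ?addn0.
Qed.

Lemma ev_lim s g l env : ctx s -> size env = l ->
  (forall v, ev s g (rcons env v) = ev s g env) ->
  ev s (lim_ l g) env = \prod_(v < k)
    (if isrt (s 17) (ev s g env) v then n else k * (s 11 0).+1).
Proof.
move=> hs hl hg.
have -> : ev s (lim_ l g) env = \prod_(v < s 4 0) ev s (base_ g (Var l)) (rcons env v) by [].
rewrite (c_k hs); apply: eq_bigr => v _; rewrite ev_base // hg /=.
by rewrite nth_rcons hl ltnn eqxx.
Qed.

Lemma eq_certv q cd cd' : (forall v, v < k -> cd v = cd' v) -> certv q cd = certv q cd'.
Proof.
move=> h; rewrite /certv; congr (_ && _).
  by apply: eq_forallb => u; apply: eq_forallb => v; rewrite !h.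
apply: eq_forallb => v; rewrite h //; congr (_ || _); apply: eq_existsb => u.
by rewrite !h.
Qed.

Lemma eq_isrt cd cd' g v : cd v = cd' v -> isrt cd g v = isrt cd' g v.
Proof. by rewrite /isrt => ->. Qed.

Lemma eq_tot cd cd' D : (forall v, v < k -> cd v = cd' v) -> tot cd D = tot cd' D.
Proof.
move=> h; apply: eq_bigr => g _; apply: eq_bigr => v _.
by rewrite (@eq_isrt cd cd') // h.
Qed.

Lemma run_search q s a c0 : ctx s -> has_bits q s ->
  let cd c := dg (fun=> cb) c in
  c0 < cb ^ k -> certv q (cd c0) ->
  let s' := run p_search [:: a] s in
  [/\ certv q (s' 17), tot (s' 17) (s 11 0) <= tot (cd c0) (s 11 0),
     forall v, v < k -> s' 17 v < cb & agree (fun b => b \notin [:: 17; 18; 19]) s' s].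
Proof.
move=> hs hq cd hc0 hv0; set D := s 11 0.
pose bod := Sq (p_decode 2 (Var 1))
    (Ite (Bin OMul (not_ inv_) (Bin OAdd (not_ (Arr 18 (Cst 0)))
        (Bin OLt (Bin OAdd (Sum (Bin OAdd k_ (Cst 1)) (lim_ 3 (Var 2))) (Cst 1)) (Arr 18 (Cst
          0)))))
      (Sq (Put 18 (Cst 0) (Bin OAdd (Sum (Bin OAdd k_ (Cst 1)) (lim_ 3 (Var 2))) (Cst 1)))
        (Put 19 (Cst 0) (Var 1))) Nop).
pose s1 := update s 18 0 0; pose st i := forst bod [:: a] s1 i.
have hst i : ctx (st i).
  by apply: ctx_forst => //; apply: ctx_agree hs => b j hb; rewrite /s1 upd_arr //; apply:
    contraTneq hb => ->.
have stE i b j : b \notin [:: 17; 18; 19] -> st i b j = s b j.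
  move=> hb; rewrite /st forst_frame; last by apply: contraNN hb; rewrite /= !inE;
    case/or3P => ->; rewrite ?orbT.
  by rewrite /s1 upd_arr //; apply: contraNneq hb => ->.
pose P i (t : store) := (t 18 0 = 0 /\ forall c, c < i -> ~~ certv q (cd c)) \/
   [/\ certv q (cd (t 19 0)), t 18 0 = (tot (cd (t 19 0)) D).+1 &
       forall c, c < i -> certv q (cd c) -> tot (cd (t 19 0)) D <= tot (cd c) D].
have inv i : P i (st i).
  elim: i => [|i IH]; first by left; split=> //; rewrite /st /= /s1 upd_same.
  pose t := run (p_decode 2 (Var 1)) [:: a; i] (st i).
  have ht : ctx t by apply: ctx_run.
  have t17 v : v < k -> t 17 v = cd i v by apply: run_decode.
  have tE b j : b != 17 -> t b j = st i b j by move=> hb; apply: run_frame; rewrite inE.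
  have tq : has_bits q t by move=> u v; rewrite tE // stE // hq.
  have itot : ev t (Sum (Bin OAdd k_ (Cst 1)) (lim_ 3 (Var 2))) [:: a; i] = tot (cd i) D.
    have -> : ev t (Sum (Bin OAdd k_ (Cst 1)) (lim_ 3 (Var 2))) [:: a; i] =
       \sum_(g < t 4 0 + 1) ev t (lim_ 3 (Var 2)) [:: a; i; nat_of_ord g] by [].
    rewrite (c_k ht) addn1 -(eq_tot D t17); apply: eq_bigr => g _.
    by rewrite ev_lim // tE // stE.
  have icert : ev t (not_ inv_) [:: a; i] = certv q (cd i).
    by rewrite not_ev (ev_inv (q := q)) // (eq_certv q t17).
  have -> : st i.+1 = if ev t (not_ inv_) [:: a; i] * ((t 18 0 == 0) +
        (ev t (Sum (Bin OAdd k_ (Cst 1)) (lim_ 3 (Var 2))) [:: a; i] + 1 < t 18 0)) != 0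
     then update (update t 18 0 (ev t (Sum (Bin OAdd k_ (Cst 1)) (lim_ 3 (Var 2))) [:: a;
       i] + 1)) 19 0 i
     else t by [].
  rewrite icert itot tE // addn1.
  case: (boolP (certv q (cd i))) => hi; last first.
    rewrite mul0n /=; case: IH => [[e h]|[h1 h2 h3]]; [left|right]; rewrite !tE //.
      by split=> // c; rewrite ltnS leq_eqVlt => /orP[/eqP -> //|]; apply: h.
    split=> // c; rewrite ltnS leq_eqVlt => /orP[/eqP ->|]; last exact: h3.
    by rewrite (negbTE hi).
  rewrite mul1n; case: IH => [[e h]|[h1 h2 h3]].
    rewrite e eqxx /=; right; rewrite upd_same upd_arr // upd_same; split=> // c.
    rewrite ltnS leq_eqVlt => /orP[/eqP -> //|/h h' h'']; by rewrite h'' in h'.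
  rewrite h2 /= ltnS add0n; case: ltnP => hlt /=.
    right; rewrite upd_same upd_arr // upd_same; split=> // c.
    rewrite ltnS leq_eqVlt => /orP[/eqP -> //|hc hcc].
    by apply: leq_trans (ltnW hlt) _; apply: h3.
  right; rewrite !tE // ; split=> // c.
  by rewrite ltnS leq_eqVlt => /orP[/eqP -> //|]; apply: h3.
have KC : ev s1 (Arr 13 (Cst 0)) [:: a] = cb ^ k := c_KC hs.
pose t := st (cb ^ k).
have runE : run p_search [:: a] s = run (p_decode 1 (Arr 19 (Cst 0))) [:: a] t.
  by rewrite /t -KC.
move=> s'; have s'E : s' = run (p_decode 1 (Arr 19 (Cst 0))) [:: a] t := runE.
have s17 v : v < k -> s' 17 v = cd (t 19 0) v.
  by rewrite s'E; apply: run_decode => //; apply: hst.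
have [[_ /(_ c0 hc0)]|[h1 h2 h3]] := inv (cb ^ k); first by rewrite hv0.
split.
- by rewrite (eq_certv q s17).
- by rewrite (eq_tot D s17); apply: h3.
- by move=> v hv; rewrite s17 //; apply: dg_lt.
- by move=> b j hb; rewrite s'E run_frame /t ?stE //; apply: contraNN hb; rewrite /= !inE => ->.
Qed.

(** ** Tables of a certificate *)

Lemma idx_eqk g g' v v' : v < k -> v' < k ->
  (g * k + v == g' * k + v') = (g == g') && (v == v').
Proof.
move=> h h'; have e : k = k.-1.+1 by lia.
by rewrite e; apply: idx_eq; lia.
Qed.

Section Evaluation.
Variable q : {ffun 'I_k * 'I_k -> bool}.

Definition labv (s : store) (v : 'I_k) := labc (s 17 v).
Definition qr : rel 'I_k := fun u v => q (u, v).
Notation bdyv s := (bdy qr (labv s)).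
Notation domv s := (dom qr (labv s)).

Record tables (s : store) : Prop := {
  t_bdy : forall g (v : 'I_k), g <= k -> s 20 (g * k + v) = bdyv s g v;
  t_dom : forall g (v : 'I_k), g <= k -> s 21 (g * k + v) = domv s g v;
  t_lim : forall g, g <= k -> s 22 g = \prod_(v < k)
    (if isrt (s 17) g v then n else k * (s 11 0).+1)
}.

Lemma run_tables s a : ctx s -> has_bits q s -> tables (run p_tables [:: a] s).
Proof.
move=> hs hq.
pose inner := Sq (Put 20 (Bin OAdd (Bin OMul (Var 1) k_) (Var 2))
        (Bin OMul (Bin OMul (Bin OEq (lab_ (Var 2)) (Cst 0)) (not_ (Bin OEq (Var 1) (Cst 0))))
         (Bin OLt (Cst 0) (Sum k_ (Bin OMul (Q_ (Var 3) (Var 2)) (Bin OEq (lab_ (Var 3)) (Var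
           1)))))))
    (Put 21 (Bin OAdd (Bin OMul (Var 1) k_) (Var 2)) (Bin OAdd (Bin OEq (lab_ (Var 2)) (Var
      1)) (Arr 20 (Bin OAdd (Bin OMul (Var 1) k_) (Var 2))))).
pose outer := Sq (Put 22 (Var 1) (lim_ 2 (Var 1))) (For k_ inner).
pose st i := forst outer [:: a] s i.
(* Progress in lexicographic order: the rows before [g0], and row [g0] before [v0]. *)
pose ok g0 v0 g v := (g < g0) || (g == g0) && (v < v0).
pose lim g := \prod_(v < k) (if isrt (s 17) g v then n else k * (s 11 0).+1).
pose P b g0 v0 (t : store) := [/\ agree (fun b => b \notin [:: 20; 21; 22]) t s,
  forall g (v : 'I_k), ok g0 v0 g v -> t 20 (g * k + v) = bdyv s g v,
  forall g (v : 'I_k), ok g0 v0 g v -> t 21 (g * k + v) = domv s g v &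
  forall g, g < b -> t 22 g = lim g].
have tc t : agree (fun b => b \notin [:: 20; 21; 22]) t s -> ctx t.
  by move=> h; apply: ctx_sub h hs.
have step b g v t : v < k -> P b g v t -> P b g v.+1 (run inner [:: a; g; v] t).
  move=> hv [h1 h2 h3 h4].
  have ht := tc _ h1; pose vo := Ordinal hv.
  have b1 : ev t (Bin OMul (Bin OMul (Bin OEq (lab_ (Var 2)) (Cst 0)) (not_ (Bin OEq (Var 1)
    (Cst 0))))
         (Bin OLt (Cst 0) (Sum k_ (Bin OMul (Q_ (Var 3) (Var 2)) (Bin OEq (lab_ (Var 3)) (Var
           1)))))) [:: a; g; v] = bdyv s g vo.
    rewrite [LHS]/= (c_k ht) addn1 /bdy /labv /labc /qr.
    have -> : (0 < \sum_(i < k) t 15 (i * k + v) * ((t 17 i %/ 2) %% k.+1 == g)) =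
       [exists u, q (u, vo) && (labv s u == g)].
      rewrite lt0n sum_nat_eq0 negb_forall; apply: eq_existsb => u.
      rewrite implyTb -[v]/(nat_of_ord vo) !h1 // hq /labv /labc.
      by case: (q _); case: (_ == g).
    rewrite h1 // /labv /labc; case: (_ %% _ == 0); case: (g == 0) => //=.
    by case: [exists _, _].
  set X := ev t _ _ in b1.
  have runE : run inner [:: a; g; v] t = update (update t 20 (g * t 4 0 + v) X) 21
     (g * t 4 0 + v) (((t 17 v %/ 2) %% (t 4 0 + 1) == g) + update t 20 (g * t 4 0 + v) X 20
       (g * t 4 0 + v)) by [].
  rewrite runE (c_k ht) upd_same b1 addn1 h1 // -[v in s 17 v]/(nat_of_ord vo).
  have okS g' (v' : 'I_k) : ok g v.+1 g' v' -> ok g v g' v' \/ g' = g /\ v' = vo.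
    rewrite /ok; case: ltngtP => //=; first by left.
    move=> ->; rewrite ltnS leq_eqVlt => /orP[/eqP e|]; last by left.
    by right; split=> //; apply: val_inj.
  split.
  - move=> c i hc; have := hc; rewrite !inE !negb_or => /and3P[c1 c2 _].
    by rewrite !upd_arr ?h1.
  - move=> g' v' /okS[h|[-> ->]]; last by rewrite upd_arr // upd_same.
    rewrite upd_arr //; case: (eqVneq (g' * k + v') (g * k + v)) => [e|ne].
      rewrite e upd_same; move/eqP: e; rewrite idx_eqk // => /andP[/eqP -> /eqP e].
      by have -> : v' = vo by apply: val_inj.
    by rewrite upd_idx // h2.
  - move=> g' v' h.
    have domE : (labc (s 17 v) == g) + bdyv s g vo = domv s g vo.
      rewrite /dom /bdy /labv /=; case: (eqVneq (labc (s 17 v)) g) => [->|_] //=.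
      by case: (g == 0).
    case: (eqVneq (g' * k + v') (g * k + v)) => [e|ne].
      rewrite e upd_same; move/eqP: e; rewrite idx_eqk // => /andP[/eqP -> /eqP e].
      have -> : v' = vo by apply: val_inj.
      by rewrite -domE.
    rewrite upd_idx // upd_arr // h3 //.
    by case: (okS _ _ h) => // -[e1 e2]; rewrite e1 e2 eqxx in ne.
  - by move=> g' h; rewrite !upd_arr // h4.
have outerS g : g <= k.+1 -> P g g 0 (st g).
  elim: g => [|g IH] hg.
    by split=> //; rewrite /ok => g v; rewrite !ltn0 andbF.
  have [h1 h2 h3 h4] := IH (ltnW hg); set t := st g in h1 h2 h3 h4 *.
  have ht := tc _ h1.
  have lE : ev t (lim_ 2 (Var 1)) [:: a; g] = lim g.
    rewrite ev_lim // h1 //; apply: eq_bigr => v _; rewrite (@eq_isrt (t 17) (s 17)) //.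
    by rewrite h1.
  set t1 := update t 22 g (lim g).
  have p1 : P g.+1 g 0 t1.
    split.
    - move=> c i hc; have := hc; rewrite !inE !negb_or => /and3P[_ _ c3].
      by rewrite /t1 upd_arr ?h1.
    - by move=> g' v' h; rewrite /t1 upd_arr // h2.
    - by move=> g' v' h; rewrite /t1 upd_arr // h3.
    - move=> g'; rewrite /t1 ltnS leq_eqVlt; case: (eqVneq g' g) => [->|ne] /=.
        by rewrite upd_same.
      by move=> h; rewrite upd_idx ?h4.
  have stS : st g.+1 = run (For k_ inner) [:: a; g] (update t 22 g (ev t (lim_ 2 (Var 1)) [::
    a; g])) by [].
  rewrite stS lE -/t1 run_For.
  have -> : ev t1 k_ [:: a; g] = k by case: p1 => /tc /c_k.
  have inn v : v <= k -> P g.+1 g v (forst inner [:: a; g] t1 v).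
    elim: v => [|v IHv] hv //; rewrite forstS; apply: step => //.
    by apply: IHv; apply: ltnW.
  have [j1 j2 j3 j4] := inn k (leqnn k); split=> // g' v h; [apply: j2 | apply: j3];
    by move: h; rewrite /ok ltn0 andbF orbF ltnS leq_eqVlt ltn_ord andbT orbC.
have runE : run p_tables [:: a] s = st k.+1.
  have <- : ev s (Bin OAdd k_ (Cst 1)) [:: a] = k.+1 by rewrite /= (c_k hs) addn1.
  by [].
have [h1 h2 h3 h4] := outerS _ (leqnn _).
rewrite runE; set t := st k.+1 in h1 h2 h3 h4 *.
have e17 g (v : 'I_k) : (bdyv t g v = bdyv s g v) * (domv t g v = domv s g v).
  have e u : labv t u = labv s u by rewrite /labv h1.
  have eb : bdyv t g v = bdyv s g v.
    by rewrite /bdy e; congr [&& _, _ & _]; apply: eq_existsb => u; rewrite e.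
  by rewrite /dom e eb.
split=> [g v hg|g v hg|g hg]; rewrite ?e17.
- by apply: h2; rewrite /ok ltnS hg.
- by apply: h3; rewrite /ok ltnS hg.
- rewrite h4 // h1 //; apply: eq_bigr => v _; rewrite (@eq_isrt (t 17) (s 17)) //.
  by rewrite h1.
Qed.

(** ** Evaluation of a certificate *)

Variables (s0 : store) (a : nat).
Hypotheses (h0 : ctx s0) (hq0 : has_bits q s0) (hc0 : certv q (s0 17)).
Hypotheses (hcb : forall v, v < k -> s0 17 v < cb) (ht0 : tables s0).

Definition work_arrays := [:: 23; 24; 25; 26; 27].
Definition keeps := agree (fun b => b \notin work_arrays).

Lemma keeps_ctx t : keeps t s0 -> ctx t.
Proof. by move=> h; apply: ctx_sub h h0. Qed.

Definition D := s0 11 0.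
Definition bs g (v : nat) := if isrt (s0 17) g v then n else k * D.+1.
Definition lim g := \prod_(v < k) bs g v.
Notation domg g := (domv s0 g).
Notation bdyg g := (bdyv s0 g).
Notation pmap := {ffun 'I_k -> 'I_n.+1}.

(** A root stores its image; any other vertex of the domain stores a predecessor together with the
    index of an out-neighbour. [rho] schedules the passes: it increases from predecessor to
    successor, which excludes circular definitions. *)
Definition coded g c (psi : pmap) (rho : 'I_k -> nat) :=
  [/\ forall v, ~~ domg g v -> psi v = 0 :> nat,
      forall v : 'I_k, domg g v -> isrt (s0 17) g v -> dg (bs g) c v + 1 = psi v,
      forall v : 'I_k, domg g v -> ~~ isrt (s0 17) g v ->
        exists u : 'I_k, [/\ dg (bs g) c v %/ D.+1 = u, domg g u, rho u < rho v &
          s0 9 (dg (bs g) c v %% D.+1 * n.+1 + psi u) = psi v] &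
      forall v, rho v <= k.+1].

Lemma ev_dig t g' c r v : keeps t s0 -> g' <= k ->
  ev t dig_ [:: a; g'; c; r; v] = dg (bs (k - g')) c v.
Proof.
move=> ht hg; have hc := keeps_ctx ht.
have -> : ev t dig_ [:: a; g'; c; r; v] =
   (c %/ \prod_(u < v) ev t (base_ g_ (Var 5)) [:: a; g'; c; r; v; nat_of_ord u])
     %% ev t (base_ g_ (Var 4)) [:: a; g'; c; r; v] by [].
have gE e : ev t g_ [:: a, g', c & e] = k - g' by rewrite /= (c_k hc).
have bE x e : ev t (base_ g_ x) [:: a, g', c & e] = bs (k - g') (ev t x [:: a, g', c & e]).
  by rewrite ev_base // gE /bs /D !(@eq_isrt (t 17) (s0 17)) ht.
by rewrite bE; under eq_bigr => u _ do rewrite bE.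
Qed.

Lemma run_phi t g' c : keeps t s0 -> g' <= k -> let g := k - g' in c < lim g ->
  let t' := run p_phi [:: a; g'; c] t in
  [/\ agree (fun b => b != 23) t' t,
      forall v : 'I_k, t' 23 v <= n,
      forall v : 'I_k, ~~ domg g v -> t' 23 v = 0 &
      forall psi rho, coded g c psi rho -> forall v : 'I_k, t' 23 v = psi v].
Proof.
move=> ht hg g hc.
pose rest := For k_ (Put 23 (Var 4) (Bin OMul (IX_ g_ (Var 4))
    (Bin OAdd (Bin OMul (isrt_ g_ (Var 4)) (Bin OAdd dig_ (Cst 1))) (Bin OMul (not_ (isrt_ g_
      (Var 4)))
      (Arr 9 (Bin OAdd (Bin OMul (Bin OMod dig_ (Bin OAdd (Arr 11 (Cst 0)) (Cst 1))) (Bin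
        OAdd n_ (Cst 1))) (Arr 23 (Bin ODiv dig_ (Bin OAdd (Arr 11 (Cst 0)) (Cst 1)))))))))).
pose inner := Put 23 (Var 4) (Bin OMul (IX_ g_ (Var 4))
    (Bin OAdd (Bin OMul (isrt_ g_ (Var 4)) (Bin OAdd dig_ (Cst 1))) (Bin OMul (not_ (isrt_ g_
      (Var 4)))
      (Arr 9 (Bin OAdd (Bin OMul (Bin OMod dig_ (Bin OAdd (Arr 11 (Cst 0)) (Cst 1))) (Bin
        OAdd n_ (Cst 1))) (Arr 23 (Bin ODiv dig_ (Bin OAdd (Arr 11 (Cst 0)) (Cst 1))))))))).
have hgk : g <= k by rewrite leq_subr.
pose z i := forst (Put 23 (Var 3) (Cst 0)) [:: a; g'; c] t i.
have z23 b i j : b != 23 -> z i b j = t b j.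
  by move=> hb; apply: forst_frame; rewrite inE.
have zv i : i <= k -> forall j, j < i -> z i 23 j = 0.
  elim: i => [|i IH] hi j //.
  have -> : z i.+1 = update (z i) 23 i 0 by [].
  rewrite ltnS leq_eqVlt; case: (eqVneq j i) => [->|ne] /= hj; first by rewrite upd_same.
  by rewrite upd_idx // IH // ltnW.
pose st r := forst rest [:: a; g'; c] (z k) r.
(* In the middle of pass [r], all vertices scheduled before [r] are settled, and so are those
   scheduled for [r] that precede [j]. *)
pose P psi rho r j (x : store) := [/\ agree (fun b => b != 23) x t,
   forall v : 'I_k, x 23 v <= n, forall v : 'I_k, ~~ domg g v -> x 23 v = 0 &
   coded g c psi rho -> forall v : 'I_k, domg g v ->
      rho v < r \/ v < j /\ rho v <= r -> x 23 v = psi v].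
have bpos (v : 'I_k) : isrt (s0 17) g v -> 0 < n.
  move=> hv; case: (posnP n) => // n0; move: hc.
  by rewrite /lim (bigD1 v) //= /bs hv n0 mul0n.
have keepx x : agree (fun b => b != 23) x t -> keeps x s0.
  move=> hx b i hb; rewrite hx ?ht //; apply: contraNneq hb => ->; by rewrite !inE.
have step psi rho r j x : j < k -> P psi rho r j x -> P psi rho r j.+1 (run inner [:: a; g';
  c; r; j] x).
  move=> hj [h1 h2 h3 h4]; have hx := keepx _ h1; pose v := Ordinal hj.
  have hcx := keeps_ctx hx.
  have ixE : ev x (IX_ g_ (Var 4)) [:: a; g'; c; r; j] = domg g v.
    rewrite /= (c_k hcx) -/g -[j in X in x 21 X]/(nat_of_ord v) hx ?inE //.
    exact: (t_dom ht0).
  have rtE : ev x (isrt_ g_ (Var 4)) [:: a; g'; c; r; j] = isrt (s0 17) g v.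
    rewrite ev_isrt // (@eq_isrt (x 17) (s0 17)) ?hx //.
    by rewrite /= (c_k hcx).
  set dv := dg (bs g) c v.
  pose new := domg g v * (isrt (s0 17) g v * (dv + 1) + (isrt (s0 17) g v == false) *
      s0 9 (dv %% D.+1 * n.+1 + x 23 (dv %/ D.+1))).
  have runE : run inner [:: a; g'; c; r; j] x = update x 23 j (ev x (IX_ g_ (Var 4)) [:: a;
    g'; c; r; j] *
     (ev x (isrt_ g_ (Var 4)) [:: a; g'; c; r; j] * (ev x dig_ [:: a; g'; c; r; j] + 1) +
      (ev x (isrt_ g_ (Var 4)) [:: a; g'; c; r; j] == 0) *
        x 9 (ev x dig_ [:: a; g'; c; r; j] %% (x 11 0 + 1) * (x 0 1 + 1) + x 23 (ev x dig_
          [:: a; g'; c; r; j] %/ (x 11 0 + 1))))) by [].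
  rewrite runE ixE rtE ev_dig // -/g (c_n hcx) (hx 11 0) // (hx 9) // !addn1 -/D -[dg (bs g)
    c j]/dv.
  have newn : domg g v * (isrt (s0 17) g v * dv.+1 + ((isrt (s0 17) g v : nat) == 0) *
      s0 9 (dv %% D.+1 * n.+1 + x 23 (dv %/ D.+1))) <= n.
    case: (domg g v); rewrite ?mul0n // mul1n.
    case: (boolP (isrt _ _ _)) => hr /=; rewrite ?mul1n ?mul0n ?add0n ?addn0.
      by have := @dg_lt (bs g) c v; rewrite /bs hr => /(_ (bpos _ hr)).
    exact: or_le (c_or h0) _.
  split.
  - by move=> b i hb; rewrite upd_arr // h1.
  - move=> w; case: (eqVneq (w : nat) j) => [->|ne]; first by rewrite upd_same.
    by rewrite upd_idx.
  - move=> w hw; case: (eqVneq (w : nat) j) => [e|ne]; last by rewrite upd_idx // h3.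
    have ew : w = v by apply: val_inj.
    by rewrite e upd_same -ew (negbTE hw).
  - move=> hcd w hw hrho; case: (eqVneq (w : nat) j) => [e|ne]; last first.
      rewrite upd_idx // h4 //; case: hrho => [|[hwj hr]]; first by left.
      by right; split=> //; move: hwj; rewrite ltnS leq_eqVlt (negbTE ne).
    have ew : w = v by apply: val_inj.
    rewrite e upd_same -ew hw mul1n; rewrite /dv -ew.
    have hrw : rho w <= r by case: hrho => [/ltnW|[_]].
    case: hcd => [k1 k2 k3 k4].
    case: (boolP (isrt (s0 17) g w)) => hr /=; rewrite ?mul1n ?mul0n ?add0n ?addn0.
      by rewrite -addn1; apply: k2.
    have [u [e1 e2 e3 e4]] := k3 w hw hr.
    rewrite e1 h4 //.
    by left; apply: leq_trans e3 hrw.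
have kE x e : keeps x s0 -> ev x k_ e = k by move=> /keeps_ctx/c_k.
have inv psi rho r : P psi rho r 0 (st r).
  elim: r => [|r IH].
    split; first by move=> b i hb; rewrite /st /= z23.
    - by move=> v; rewrite /st /= zv.
    - by move=> v _; rewrite /st /= zv.
    - by move=> _ v _ [|[]].
  have hx : keeps (st r) s0 by apply: keepx; case: IH.
  have -> : st r.+1 = forst inner [:: a; g'; c; r] (st r) k.
    by have e := kE (st r) [:: a; g'; c; r] hx; rewrite -[X in forst _ _ _ X]e.
  have inn j : j <= k -> P psi rho r j (forst inner [:: a; g'; c; r] (st r) j).
    elim: j => [|j IHj] hj //; rewrite forstS; apply: step => //.
    by apply: IHj; apply: ltnW.
  have [k1 k2 k3 k4] := inn k (leqnn k); split=> // hcd v hv [hr|[]] //.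
  by apply: k4 => //; right.
have runE : run p_phi [:: a; g'; c] t = st k.+2.
  have <- : ev (z k) (Bin OAdd k_ (Cst 2)) [:: a; g'; c] = k.+2.
    by rewrite /= z23 // (c_k (keeps_ctx ht)) addn2.
  by rewrite /st /z; have e := kE t [:: a; g'; c] ht; rewrite -[X in forst _ _ t X]e.
move=> t'; have t'E : t' = st k.+2 := runE.
(* Any [psi] and [rho] will do for the facts that hold without a coded map. *)
have [k1 k2 k3 _] := inv [ffun=> ord0] (fun=> 0) k.+2.
split; rewrite t'E // => psi rho hcd v.
have [_ _ _ k4] := inv psi rho k.+2.
case: (boolP (domg g v)) => hv; last first.
  by rewrite k3 //; case: hcd => /(_ v hv) ->.
by apply: k4 => //; left; case: hcd => _ _ _ /(_ v).
Qed.

Definition arcN (x y : nat) : bool :=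
  [exists u : 'I_n, exists v : 'I_n, [&& x == u.+1, y == v.+1 & A u v]].
Definition Rn (u v : 'I_k) : rel 'I_n.+1 :=
  fun x y => if H u v then arcN x y else x == y.
Definition localg g : {set pmap} := local ord0 qr Rn (labv s0) g.

Lemma arcN_S (u v : 'I_n) : arcN u.+1 v.+1 = A u v.
Proof.
apply/existsP/idP => [[u' /existsP[v' /and3P[/eqP [e1] /eqP [e2] h]]]|h].
  by have -> : u = u' by [apply: val_inj]; have -> : v = v' by apply: val_inj.
by exists u; apply/existsP; exists v; rewrite !eqxx.
Qed.

(** Vertices of label [g] are scheduled by their depth in the certificate. Boundary vertices are
    scheduled last, at [k.+1]; each has a predecessor in the branch by definition. *)
Lemma code_ex g psi : g <= k -> psi \in localg g ->
  exists c rho, c < lim g /\ coded g c psi rho.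
Proof.
move=> hg /localP[p1 p2]; have ho := c_or h0.
case/andP: (hc0) => /forallP hcl /forallP hrc.
pose rho (v : 'I_k) := if labv s0 v == g then depc (s0 17 v) else k.+1.
have depk (v : 'I_k) : depc (s0 17 v) <= k.
  have := hcb (ltn_ord v); rewrite /depc /cb => h.
  rewrite -ltnS ltn_divLR // ltn_divLR //; lia.
have arcj (u v : 'I_k) : q (u, v) -> domg g u -> domg g v ->
    exists2 j, j <= D & s0 9 (j * n.+1 + psi u) = psi v.
  move=> huv du dv; have := p2 u v du dv huv; rewrite /Rn.
  case: (H u v) => [/existsP[x /existsP[y /and3P[/eqP ex /eqP ey hA]]]|/eqP e].
    by rewrite ex ey; apply: or_out ho _ _ hA.
  exists 0 => //; rewrite mul0n add0n e.
  have : psi v != ord0 by rewrite p1.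
  case: (psi v) => [[|x] hx] // _; exact: (or_self ho (Ordinal (hx : x < n))).
have P0 (v : 'I_k) : exists d0, [/\ d0 < bs g v,
    domg g v -> isrt (s0 17) g v -> d0 + 1 = psi v &
    domg g v -> ~~ isrt (s0 17) g v ->
        exists u : 'I_k, [/\ d0 %/ D.+1 = u, domg g u, rho u < rho v &
          s0 9 (d0 %% D.+1 * n.+1 + psi u) = psi v]].
  have k0 : 0 < k by apply: leq_ltn_trans (ltn_ord v).
  rewrite /bs; case: (boolP (isrt (s0 17) g v)) => hr; last first.
    case: (boolP (domg g v)) => hd; last by exists 0; split=> //; rewrite muln_gt0 k0.
    suff [u [quv du hrho]] : exists u : 'I_k, [/\ q (u, v), domg g u & rho u < rho v].
      have [j hj ej] := arcj u v quv du hd.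
      have e1 : (u * D.+1 + j) %/ D.+1 = u by rewrite divnMDl // divn_small ?addn0.
      have e2 : (u * D.+1 + j) %% D.+1 = j by rewrite modnMDl modn_small.
      exists (u * D.+1 + j); split=> // [|_ _]; first by have := ltn_ord u; nia.
      by exists u; rewrite e1 e2.
    case/orP: (hd) => [hl|hb].
      have nrt : ~~ rtc (s0 17 v) by apply: contraNN hr => h; rewrite /isrt h.
      have := hrc v; rewrite (negbTE nrt) /= => /existsP[u /and3P[h1 /eqP h2 h3]].
      have hlu : labv s0 u == g by rewrite /labv h2.
      by exists u; rewrite /rho hlu hl /dom hlu.
    case/and3P: (hb) => /eqP hl hgn /existsP[u /andP[huv hu]]; exists u; split=> //.
      by rewrite /dom hu.
    by rewrite /rho hu hl eq_sym (negbTE hgn) ltnS.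
  case: (boolP (domg g v)) => hd; last first.
    by case/andP: hr => _ hr; case/negP: hd; rewrite /dom /labv hr.
  have : psi v != ord0 by rewrite p1.
  case: (psi v) => [[|x] hx] // _; exists x; split=> // _ _.
  by rewrite addn1.
have [f hf] := fin_all_exists P0.
pose f' (v : nat) := if insub v is Some o then f o else 0.
have f'E (v : 'I_k) : f' v = f v by rewrite /f' valK.
have [|c hc hd] := @dg_surj (bs g) f' k.
  move=> v hv; rewrite -[v]/(nat_of_ord (Ordinal hv)) f'E.
  by case: (hf (Ordinal hv)).
have hd' (v : 'I_k) : dg (bs g) c v = f v by rewrite hd.
exists c, rho; split=> //; split=> v; rewrite ?hd'.
- by move=> h; have := p1 v; rewrite (negbTE h) => /negbT; rewrite negbK => /eqP ->.
- by have [_ h _] := hf v.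
- by have [_ _] := hf v.
- by rewrite /rho; case: ifP => // _; apply: leqW.
Qed.

Lemma ev_badl t g' c (psi : pmap) : keeps t s0 -> g' <= k ->
  (forall v : 'I_k, t 23 v = psi v) -> (forall v, ~~ domg (k - g') v -> psi v = ord0) ->
  (ev t badl_ [:: a; g'; c] == 0) = (psi \in localg (k - g')).
Proof.
move=> ht hg hpsi hz; have hct := keeps_ctx ht.
set g := k - g' in hz *; have hgk : g <= k by rewrite leq_subr.
have ix (v : 'I_k) : t 21 (g * k + v) = domg g v by rewrite ht // (t_dom ht0).
rewrite /= (c_k hct) -/g (c_n hct) addn1 addn_eq0 !sum_nat_eq0.
apply/andP/localP => [[/forallP h1 /forallP h2]|[h1 h2]].
  have nz v : domg g v -> psi v != ord0.
    move=> hv; have := h1 v; rewrite implyTb ix hv hpsi mul1n eqb0.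
    by apply: contraNN => /eqP ->.
  split=> [v|u v du dv quv].
    case: (boolP (domg g v)) => hv; first exact: nz.
    by rewrite (hz _ hv) eqxx.
  have := h2 u; rewrite implyTb sum_nat_eq0 => /forallP/(_ v); rewrite implyTb.
  rewrite !ix du dv (ht 15) // hq0 (quv : q (u, v) = true) (c_H hct) !hpsi !mul1n /Rn.
  have := nz u du; have := nz v dv.
  case: (psi u) => [[|x] hx] //; case: (psi v) => [[|y] hy] // _ _ /=.
  case: (H u v) => /=; last by rewrite -val_eqE /= mul0n mul1n add0n !eqb0 negbK.
  rewrite mul0n addn0 mul1n.
  rewrite (or_arc (c_or hct) (Ordinal (hx : x < n)) (Ordinal (hy : y < n))).
  by rewrite -(arcN_S (Ordinal (hx : x < n)) (Ordinal (hy : y < n))); case: arcN.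
have nz v : domg g v -> psi v != ord0 by move=> hv; rewrite h1.
split; apply/forallP => u; rewrite implyTb.
  rewrite ix hpsi; case: (boolP (domg g u)) => //= hu; rewrite mul1n eqb0.
  by apply: contraNN (nz u hu) => /eqP e; apply/eqP; apply: val_inj.
rewrite sum_nat_eq0; apply/forallP => v; rewrite implyTb !ix (ht 15) // hq0.
case: (boolP (domg g u)) => //= du; case: (boolP (domg g v)) => //= dv.
case: (boolP (q (u, v))) => //= quv; have := h2 u v du dv quv.
rewrite (c_H hct) !hpsi !mul1n /Rn; have := nz u du; have := nz v dv.
case: (psi u) => [[|x] hx] //; case: (psi v) => [[|y] hy] // _ _ /=.
case: (H u v) => /=; last by rewrite -val_eqE /= mul0n mul1n add0n !eqb0 negbK.
rewrite mul0n addn0 mul1n.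
rewrite (or_arc (c_or hct) (Ordinal (hx : x < n)) (Ordinal (hy : y < n))).
by rewrite -(arcN_S (Ordinal (hx : x < n)) (Ordinal (hy : y < n))) => ->.
Qed.

Definition idx (psi : pmap) := \sum_(v < k) psi v * n.+1 ^ v.
Definition bidx g (psi : pmap) := \sum_(v < k) bdyg g v * psi v * n.+1 ^ v.

Lemma ord_numeral (f : 'I_k -> nat) : (forall v, f v <= n) ->
  exists2 f' : nat -> nat, (forall v : 'I_k, f' v = f v) & forall v, v < k -> f' v < n.+1.
Proof.
move=> hf; exists (fun v => if insub v is Some o then f o else 0) => [v|v hv].
  by rewrite valK.
by case: insub => [o|] //; rewrite ltnS.
Qed.

Lemma ord_numeral_lt (f : 'I_k -> nat) : (forall v, f v <= n) ->
  \sum_(v < k) f v * n.+1 ^ v < n.+1 ^ k.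
Proof.
move=> /ord_numeral[f' e h].
rewrite (eq_bigr (fun v : 'I_k => f' v * n.+1 ^ v)); first exact: numeral_lt.
by move=> v _; rewrite e.
Qed.

Lemma ord_numeral_inj (f1 f2 : 'I_k -> nat) : (forall v, f1 v <= n) -> (forall v, f2 v <= n) ->
  \sum_(v < k) f1 v * n.+1 ^ v = \sum_(v < k) f2 v * n.+1 ^ v -> f1 =1 f2.
Proof.
move=> /ord_numeral[f1' e1 l1] /ord_numeral[f2' e2 l2].
rewrite (eq_bigr (fun v : 'I_k => f1' v * n.+1 ^ v)); last by move=> v _; rewrite e1.
rewrite [RHS](eq_bigr (fun v : 'I_k => f2' v * n.+1 ^ v)); last by move=> v _; rewrite e2.
by move=> e v; rewrite -e1 -e2; apply: (numeral_inj l1 l2 e).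
Qed.

Lemma idx_lt psi : idx psi < n.+1 ^ k.
Proof. by apply: ord_numeral_lt => v; rewrite -ltnS. Qed.

Lemma idx_inj : injective idx.
Proof.
move=> psi chi e; apply/ffunP => v; apply: val_inj.
by apply: (ord_numeral_inj _ _ e) => w; rewrite -ltnS.
Qed.

Lemma bdy_le g (psi : pmap) v : bdyg g v * psi v <= n.
Proof. by case: bdy; rewrite ?mul0n // mul1n -ltnS. Qed.

Lemma bidx_lt g psi : bidx g psi < n.+1 ^ k.
Proof. by apply: ord_numeral_lt => v; apply: bdy_le. Qed.

Lemma bidx_restr g psi chi : (bidx g psi == bidx g chi) =
  (restr ord0 (bdyg g) psi == restr ord0 (bdyg g) chi).
Proof.
apply/eqP/eqP => [e|/ffunP e].
  apply/ffunP => v; rewrite !ffunE; have := ord_numeral_inj (bdy_le g psi) (bdy_le g chi) e v.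
  by case: bdy => //; rewrite !mul1n => /val_inj.
apply: eq_bigr => v _; have := e v; rewrite !ffunE.
by case: bdy => [->|].
Qed.

Definition M := n.+1 ^ k.
Definition key g x := (a * k.+1 + g) * M + x.
Definition cnt g y := #|[set chi in localg g | bidx g chi == y]|.
(** The amount a local map adds to its table: 1 in a branch and, in the centre, its summand in
    [star_decomposition]. *)
Definition wt g psi := if g == 0 then \prod_(i < k) cnt i.+1 (bidx i.+1 psi) else 1.

Lemma M_gt0 : 0 < M. Proof. by rewrite expn_gt0. Qed.

Lemma key_eq g g' x x' : x < M -> x' < M ->
  (key g x == key g' x') = (g == g') && (x == x').
Proof.
move=> h h'; rewrite /key; have e : M = M.-1.+1 by have := M_gt0; lia.
have := @idx_eq (a * k.+1 + g) (a * k.+1 + g') x x' M.-1.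
by rewrite -e => ->; rewrite ?eqn_add2l; lia.
Qed.

Lemma key_lt g x : g <= k -> x < M -> key g x < a.+1 * k.+1 * M.
Proof.
move=> hg hx; rewrite /key; apply: (@leq_trans ((a * k.+1 + g).+1 * M)).
  by rewrite mulSn; lia.
by rewrite leq_mul2r; apply/orP; right; rewrite mulSn; lia.
Qed.

(** [S] collects the maps of label [g] counted so far. Greater labels are finished; smaller labels
    and later patterns are untouched. *)
Record St g (S : {set pmap}) (t : store) : Prop := {
  st_keeps : keeps t s0;
  st_sub : S \subset localg g;
  st_done : forall g' y, g < g' -> g' <= k -> y < M -> t 26 (key g' y) = cnt g' y;
  st_T : forall y, y < M -> t 26 (key g y) = \sum_(psi in S | bidx g psi == y) wt g psi;
  st_seen : forall x, x < M -> t 25 (key g x) = [exists psi in S, idx psi == x];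
  st_todo : forall g' x, g' < g -> x < M -> t 26 (key g' x) = 0 /\ t 25 (key g' x) = 0;
  st_later : forall i, a.+1 * k.+1 * M <= i -> t 26 i = 0 /\ t 25 i = 0
}.

Lemma St_agree g S t t' : agree (fun b => b \notin [:: 23; 24; 27]) t' t -> St g S t -> St g S t'.
Proof.
move=> h [h1 h2 h3 h4 h5 h6 h7]; split=> //.
- by move=> b i hb; rewrite h ?h1 //; apply: contraNN hb; rewrite !inE; case/or3P => ->;
  rewrite ?orbT.
- by move=> g' y *; rewrite h // h3.
- by move=> y hy; rewrite h // h4.
- by move=> x hx; rewrite h // h5.
- by move=> g' x *; rewrite !h //; apply: h6.
- by move=> i hi; rewrite !h //; apply: h7.
Qed.

Lemma lab_le_k v : labv s0 v <= k.
Proof. by rewrite -ltnS ltn_mod. Qed.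

Lemma lab_closed u v : qr u v -> labv s0 v = labv s0 u \/ labv s0 v = 0.
Proof.
move=> huv; case/andP: hc0 => /forallP/(_ u)/forallP/(_ v)/implyP/(_ huv).
by case/orP => /eqP; [left | right].
Qed.

Definition fullg : {set pmap} := full ord0 qr Rn.

Lemma wt_total : \sum_(psi in localg 0) wt 0 psi = #|fullg|.
Proof.
rewrite /fullg (star_decomposition (m := k) ord0 Rn lab_le_k lab_closed).
apply: eq_bigr => psi _; rewrite /wt eqxx; apply: eq_bigr => i _.
by apply: eq_card => chi; rewrite !inE bidx_restr.
Qed.

Lemma card_pmap (X : {set pmap}) : #|X| <= M.
Proof. by apply: leq_trans (max_card _) _; rewrite card_ffun !card_ord. Qed.

(** In a branch the sum counts local maps, in the centre it counts full maps, by [wt_total]. This is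
    why the minimum taken in [p_task] is never reached. *)
Lemma wt_le g (S : {set pmap}) : S \subset localg g -> \sum_(psi in S) wt g psi <= M.
Proof.
move=> hS; apply: (@leq_trans (\sum_(psi in localg g) wt g psi)).
  rewrite [X in _ <= X](big_setID S) /= (setIidPr hS); exact: leq_addr.
case: (eqVneq g 0) => [->|g0]; first by rewrite wt_total; apply: card_pmap.
under eq_bigr => psi _ do rewrite /wt (negbTE g0).
by rewrite sum1_card card_pmap.
Qed.

Lemma ev_bidx t l gx env g (psi : pmap) : keeps t s0 -> size env = l ->
  g <= k -> (forall v, ev t gx (rcons env v) = g) ->
  (forall v : 'I_k, t 23 v = psi v) -> ev t (bidx_ l gx) env = bidx g psi.
Proof.
move=> ht hl hg hgx hpsi; have hct := keeps_ctx ht.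
have -> : ev t (bidx_ l gx) env = \sum_(v < t 4 0)
   (t 20 (ev t gx (rcons env v) * t 4 0 + nth 0 (rcons env v) l) * t 23 (nth 0 (rcons env v) l) *
    \prod_(i < nth 0 (rcons env v) l) (t 0 1 + 1)) by [].
rewrite (c_k hct); apply: eq_bigr => v _.
have -> : nth 0 (rcons env v) l = v by rewrite nth_rcons hl ltnn eqxx.
by rewrite hgx ht // (t_bdy ht0) // hpsi (c_n hct) addn1 prod_nat_const card_ord.
Qed.

(** The part of [p_task] for a local map met for the first time. A map may have several codes, and
    array 25 keeps it from being counted twice. *)
Definition store_psi : il :=
  Sq (Put 25 (Arr 24 (Cst 0)) (Cst 1))
       (Sq (Put 27 (Cst 0) (Bin OAdd (not_ (not_ g_)) (Bin OMul (not_ g_)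
          (Prd k_ (Arr 26 (key_ (Bin OAdd (Var 3) (Cst 1)) (bidx_ 4 (Bin OAdd (Var 3) (Cst
            1)))))))))
        (Put 26 (key_ g_ (bidx_ 3 g_))
          (Bin OMin (Bin OAdd (Arr 26 (key_ g_ (bidx_ 3 g_))) (Arr 27 (Cst 0))) (Arr 30 (Cst
            0))))).

Lemma run_store g S t g' c (psi : pmap) : g = k - g' -> g' <= k -> St g S t ->
  (forall v : 'I_k, t 23 v = psi v) -> psi \in localg g -> psi \notin S ->
  t 24 0 = key g (idx psi) -> St g (psi |: S) (run store_psi [:: a; g'; c] t).
Proof.
move=> eg hg' hSt hpsi hl hnS h24; have hgk : g <= k by rewrite eg leq_subr.
have ht := st_keeps hSt; have hct := keeps_ctx ht.
set t1 := update t 25 (t 24 0) 1.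
have k1 : keeps t1 s0.
  by move=> b i hb; rewrite /t1 upd_arr ?ht //; apply: contraNneq hb => ->.
set W := ev t1 (Bin OAdd (not_ (not_ g_)) (Bin OMul (not_ g_)
          (Prd k_ (Arr 26 (key_ (Bin OAdd (Var 3) (Cst 1)) (bidx_ 4 (Bin OAdd (Var 3) (Cst
            1)))))))) [:: a; g'; c].
have WE : W = wt g psi.
  have -> : W = ((k - g' == 0 : nat) == 0) + (k - g' == 0) * \prod_(i < k)
      t1 26 ((a * (k + 1) + (i + 1)) * M + ev t1 (bidx_ 4 (Bin OAdd (Var 3) (Cst 1))) [:: a;
        g'; c; nat_of_ord i]).
    rewrite /W; have := c_k (keeps_ctx k1) => e.
    by rewrite /= !e (c_M (keeps_ctx k1)).
  rewrite -eg /wt; case: (eqVneq g 0) => [g0|_] //.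
  rewrite -[LHS]/(0 + 1 * _) add0n mul1n; apply: eq_bigr => i _.
  rewrite (@ev_bidx _ _ _ _ i.+1 psi) //; last by move=> v; rewrite /= addn1.
  rewrite !addn1 -[LHS]/(t 26 (key i.+1 (bidx i.+1 psi))).
  by rewrite (st_done hSt) ?g0 ?ltn_ord //; apply: bidx_lt.
set t2 := update t1 27 0 W.
have k2 : keeps t2 s0.
  by move=> b i hb; rewrite /t2 upd_arr ?k1 //; apply: contraNneq hb => ->.
have kE : ev t2 (key_ g_ (bidx_ 3 g_)) [:: a; g'; c] = key g (bidx g psi).
  have -> : ev t2 (key_ g_ (bidx_ 3 g_)) [:: a; g'; c] =
    (a * (t2 4 0 + 1) + (t2 4 0 - g')) * t2 31 0 + ev t2 (bidx_ 3 g_) [:: a; g'; c] by [].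
  rewrite (@ev_bidx _ _ _ _ g psi) //; last by move=> v; rewrite /= (c_k (keeps_ctx k2)).
  by rewrite (c_k (keeps_ctx k2)) (c_M (keeps_ctx k2)) addn1 -eg.
have -> : run store_psi [:: a; g'; c] t = update t2 26 (ev t2 (key_ g_ (bidx_ 3 g_)) [:: a;
  g'; c])
   (minn (t2 26 (ev t2 (key_ g_ (bidx_ 3 g_)) [:: a; g'; c]) + t2 27 0) (t2 30 0)) by [].
have t27 : t2 27 0 = wt g psi by rewrite /t2 upd_same.
have e30 : t2 30 0 = 2 ^ (k * k) * M by apply: c_MM (keeps_ctx k2).
rewrite kE t27 e30; set y := bidx g psi; have hy : y < M by apply: bidx_lt.
have -> : t2 26 (key g y) = t 26 (key g y) by [].
have Sl : psi |: S \subset localg g by rewrite subUset sub1set hl (st_sub hSt).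
have sumS z : \sum_(chi in psi |: S | bidx g chi == z) wt g chi =
    (y == z) * wt g psi + \sum_(chi in S | bidx g chi == z) wt g chi.
  rewrite !big_mkcondr /= big_setU1 //=; congr (_ + _).
  by rewrite -/y; case: (y == z); rewrite ?mul1n.
have minE : minn (t 26 (key g y) + wt g psi) (2 ^ (k * k) * M) = t 26 (key g y) + wt g psi.
  apply/minn_idPl; apply: (@leq_trans M); last by rewrite leq_pmull // expn_gt0.
  rewrite (st_T hSt) // addnC; have := sumS y; rewrite eqxx mul1n => <-.
  apply: leq_trans (wt_le Sl); rewrite [X in _ <= X](bigID (fun chi => bidx g chi == y)) /=.
  exact: leq_addr.
rewrite minE {minE}; set t3 := update _ 26 _ _.
have T3 i : t3 26 i = if i == key g y then t 26 (key g y) + wt g psi else t 26 i by [].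
have S3 i : t3 25 i = if i == key g (idx psi) then 1 else t 25 i.
  by rewrite /t3 /t2 /t1 h24.
split=> //.
- move=> b i hb; have := hb; rewrite !inE !negb_or => /and5P[b3 b4 b5 b6 b7].
  by rewrite /t3 /t2 /t1 !upd_arr // ht.
- move=> g1 z h1 h2 h3; by rewrite T3 key_eq // gtn_eqF //= (st_done hSt).
- move=> z hz; rewrite T3 key_eq // eqxx /= sumS (eq_sym y).
  by case: (eqVneq z y) => [->|_]; rewrite (st_T hSt) // mul1n addnC.
- move=> x hx; rewrite S3 key_eq ?idx_lt // eqxx /= (st_seen hSt) //.
  case: (eqVneq x (idx psi)) => [e|ne].
    have -> // : [exists chi in psi |: S, idx chi == x].
    by apply/exists_inP; exists psi; rewrite ?in_setU1 ?eqxx ?e.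
  congr nat_of_bool; apply/exists_inP/exists_inP => -[chi h1 h2]; exists chi => //.
    by rewrite in_setU1 h1 orbT.
  move: h1; rewrite in_setU1 => /orP[/eqP e|//].
  by rewrite -e (eqP h2) eqxx in ne.
- move=> g1 x h1 h2; rewrite T3 S3 !key_eq ?idx_lt // ltn_eqF //=; exact: (st_todo hSt).
- move=> i hi; rewrite T3 S3; have l1 := key_lt hgk hy; have l2 := key_lt hgk (idx_lt psi).
  by rewrite !gtn_eqF; [exact: (st_later hSt) | lia | lia].
Qed.

(** A code may yield a map that is not local, or one that was met before; then [S] stays as it
    is. *)
Lemma run_task g S t g' c : g = k - g' -> g' <= k -> St g S t -> c < lim g ->
  exists2 S', St g S' (run p_task [:: a; g'; c] t) &
    S \subset S' /\ forall psi rho, coded g c psi rho -> psi \in localg g -> psi \in S'.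
Proof.
move=> eg hg' hSt hc; have ht := st_keeps hSt.
have hc' : c < lim (k - g') by rewrite -eg.
have [f1 f2 f3 f4] := run_phi ht hg' hc'; set t1 := run p_phi _ t in f1 f2 f3 f4.
rewrite -eg in f3 f4.
have hSt1 : St g S t1.
  apply: St_agree hSt => b i hb; apply: f1; apply: contraNneq hb => ->.
  by rewrite inE.
have k1 := st_keeps hSt1; have hc1 := keeps_ctx k1.
pose psi : pmap := [ffun v : 'I_k => inord (t1 23 v)].
have psiE (v : 'I_k) : t1 23 v = psi v by rewrite ffunE inordK // ltnS.
have psi0 v : ~~ domg (k - g') v -> psi v = ord0.
  by rewrite -eg => hv; apply: val_inj; rewrite /= -psiE f3.
have badE := ev_badl c k1 hg' psiE psi0; rewrite -eg in badE.
have codedE chi rho : coded g c chi rho -> chi = psi.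
  by move=> h; apply/ffunP => v; apply: val_inj; rewrite /= -psiE (f4 _ _ h).
have runE : run p_task [:: a; g'; c] t = if ev t1 (not_ badl_) [:: a; g'; c] != 0 then
    let t2 := update t1 24 0 (ev t1 (key_ g_ (Sum k_ (Bin OMul (Arr 23 (Var 3)) (Prd (Var 3)
      (Bin OAdd n_ (Cst 1)))))) [:: a; g'; c]) in
    if (t2 25 (t2 24 0) == 0 : nat) != 0 then run store_psi [:: a; g'; c] t2 else t2
   else t1 by [].
have bE : (ev t1 (not_ badl_) [:: a; g'; c] != 0) = (psi \in localg g).
  by rewrite not_ev badE; case: (_ \in _).
rewrite runE bE {runE bE}; case: ifP => hl; last first.
  exists S => //; split=> // chi rho /codedE -> h; by rewrite h in hl.
cbv zeta.
have -> : ev t1 (key_ g_ (Sum k_ (Bin OMul (Arr 23 (Var 3)) (Prd (Var 3) (Bin OAdd n_ (Cst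
  1)))))) [:: a; g'; c] = key g (idx psi).
  rewrite /= (c_k hc1) (c_n hc1) (c_M hc1) !addn1 -eg /key; congr (_ + _).
  by apply: eq_bigr => v _; rewrite psiE prod_nat_const card_ord.
set t2 := update t1 24 0 _.
have hSt2 : St g S t2.
  apply: St_agree hSt1 => b i hb; rewrite /t2 upd_arr //; apply: contraNneq hb => ->.
  by rewrite !inE.
have e24 : t2 24 0 = key g (idx psi) by rewrite /t2 upd_same.
have e25 : ((t2 25 (t2 24 0) == 0 : nat) != 0) = (psi \notin S).
  rewrite e24 (st_seen hSt2) ?idx_lt //.
  have -> : [exists psi0 in S, idx psi0 == idx psi] = (psi \in S).
    by apply/exists_inP/idP => [[chi h1 /eqP/idx_inj <-] //|h]; exists psi.
  by case: (_ \in _).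
rewrite e25; case: ifP => hS; last first.
  exists S => //; split=> // chi rho /codedE -> _.
  by move/negbFE: hS.
exists (psi |: S).
  by apply: run_store.
split; first exact: subsetUr.
by move=> chi rho /codedE -> _; rewrite setU11.
Qed.

Lemma St_next g t : g < k -> St g.+1 (localg g.+1) t -> St g set0 t.
Proof.
move=> hg [h1 h2 h3 h4 h5 h6 h7]; split=> //.
- exact: sub0set.
- move=> g' y; rewrite leq_eqVlt => /orP[/eqP <- _|]; last exact: h3.
  move=> hy; rewrite h4 // /cnt -sum1dep_card; apply: eq_bigr => psi _.
  by [].
- by move=> y hy; rewrite big_pred0 => [|psi]; rewrite ?inE //; case: (h6 g y).
- move=> x hx; have [_ ->] := h6 g x (ltnSn _) hx; apply/esym/eqP; rewrite eqb0.
  by apply/negP => /exists_inP[psi]; rewrite inE.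
- by move=> g' x hg'; apply: h6; apply: ltnW.
Qed.

Definition fresh t b := forall i, b * k.+1 * M <= i -> t 26 i = 0 /\ t 25 i = 0.

Lemma St_init t : keeps t s0 -> fresh t a -> St k set0 t.
Proof.
move=> ht hf.
have z g x : t 26 (key g x) = 0 /\ t 25 (key g x) = 0.
  by apply: hf; rewrite /key mulnDl -addnA leq_addr.
split=> //.
- exact: sub0set.
- by move=> g' y h1 h2; have := leq_trans h1 h2; rewrite ltnn.
- by move=> y hy; rewrite big_pred0 => [|psi]; rewrite ?inE //; case: (z k y).
- move=> x hx; have [_ ->] := z k x; apply/esym/eqP; rewrite eqb0.
  by apply/negP => /exists_inP[psi]; rewrite inE.
- by move=> i hi; apply: hf; apply: leq_trans hi; rewrite !leq_mul2r leqnSn !orbT.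
Qed.

Lemma run_branch g g' t : g = k - g' -> g' <= k -> St g set0 t ->
  St g (localg g) (run (For (Arr 22 g_) p_task) [:: a; g'] t).
Proof.
move=> eg hg' hSt; have ht := st_keeps hSt; have hgk : g <= k by rewrite eg leq_subr.
have lE : ev t (Arr 22 g_) [:: a; g'] = lim g.
  by rewrite /= (c_k (keeps_ctx ht)) ht // -eg (t_lim ht0).
rewrite run_For lE.
have inv c : c <= lim g -> exists2 S, St g S (forst p_task [:: a; g'] t c) &
   forall c' psi rho, c' < c -> coded g c' psi rho -> psi \in localg g -> psi \in S.
  elim: c => [|c IH] hc; first by exists set0.
  have [S hS hcov] := IH (ltnW hc).
  have [S' hS' [sub hnew]] := run_task eg hg' hS hc.
  exists S' => // c' psi rho; rewrite ltnS leq_eqVlt => /orP[/eqP ->|hc'] hcd hl.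
    exact: hnew hcd hl.
  by apply: (subsetP sub); apply: hcov hcd hl.
have [S hS hcov] := inv _ (leqnn _).
(* Every local map has a code below [lim g], so that none is missed. *)
suff <- : S = localg g by [].
apply/eqP; rewrite eqEsubset (st_sub hS); apply/subsetP => psi hl.
have [c [rho [hc hcd]]] := code_ex hgk hl.
exact: hcov hc hcd hl.
Qed.

Lemma bidx0 psi : bidx 0 psi = 0.
Proof. by rewrite /bidx big1 // => v _; rewrite /bdy eqxx andbF. Qed.

Lemma fullg_qsat : #|fullg| = #|[set phi : {ffun 'I_k -> 'I_n} | qsat H A q phi]|.
Proof.
pose up (phi : {ffun 'I_k -> 'I_n}) : pmap := [ffun v => lift ord0 (phi v)].
have upI : injective up.
  by move=> f f' /ffunP e; apply/ffunP => v; move: (e v); rewrite !ffunE => /lift_inj.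
have Rup u v (x y : 'I_n) : Rn u v (lift ord0 x) (lift ord0 y) = qrel H A (u, v) x y.
  rewrite /Rn /qrel /=; case: (H u v); last by rewrite (inj_eq (@lift_inj _ _)).
  by rewrite /bump /= !add1n arcN_S.
rewrite -[RHS](card_imset _ upI); apply: eq_card => psi.
apply/fullP/imsetP => [[h1 h2]|[phi]].
  have hphi v : exists x, psi v = lift ord0 x.
    by have := h1 v; rewrite eq_sym => /unlift_some[x -> _]; exists x.
  have [phi hp] := fin_all_exists hphi.
  have e : psi = up [ffun v => phi v] by apply/ffunP => v; rewrite !ffunE hp.
  exists [ffun v => phi v] => //; rewrite inE; apply/qsatP => u v huv.
  by rewrite !ffunE -Rup -!hp; apply: h2.
rewrite inE => /qsatP h ->; split=> [v|u v huv]; rewrite !ffunE.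
  by rewrite eq_sym neq_lift.
by rewrite Rup; apply: h.
Qed.

Lemma run_eval t : keeps t s0 -> fresh t a ->
  let t' := run p_eval [:: a] t in
  [/\ keeps t' s0, t' 26 (key 0 0) = #|[set phi : {ffun 'I_k -> 'I_n} | qsat H A q phi]| &
      fresh t' a.+1].
Proof.
move=> ht hf; pose st i := forst (For (Arr 22 g_) p_task) [:: a] t i.
have inv i : i <= k -> St (k - i) set0 (st i).
  elim: i => [|i IH] hi; first by rewrite subn0; apply: St_init.
  have e : k - i = (k - i.+1).+1 by lia.
  apply: St_next; first by lia.
  by rewrite -e; apply: run_branch (IH (ltnW hi)) => //; apply: ltnW.
have fin : St 0 (localg 0) (st k.+1).
  by apply: run_branch; rewrite ?subnn //; have := inv k (leqnn k); rewrite subnn.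
have runE : run p_eval [:: a] t = st k.+1.
  have <- : ev t (Bin OAdd k_ (Cst 1)) [:: a] = k.+1.
    by rewrite /= (c_k (keeps_ctx ht)) addn1.
  by [].
rewrite runE; split; [exact: st_keeps fin| |exact: st_later fin].
rewrite (st_T fin) ?M_gt0 // -fullg_qsat -wt_total; apply: eq_bigl => psi.
by rewrite bidx0 eqxx andbT.
Qed.

End Evaluation.

(** ** The sum over all patterns *)

Lemma ev_sgn q s b : ctx s -> has_bits q s -> ev s sgn_ [:: b] = #|qeq H q|.
Proof.
move=> hs hq; rewrite /= (c_k hs) pair_big /= -sum1dep_card [RHS]big_mkcond.
apply: eq_bigr => -[u v] _ /=; rewrite (c_H hs) hq.
by case: (_ < _); case: (H u v); case: (q _).
Qed.

Lemma ev_badq inj q s b : ctx s -> has_bits q s ->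
  (ev s (badq_ inj) [:: b] == 0) = qvalid H inj q.
Proof.
move=> hs hq; rewrite /= (c_k hs) sum_nat_eq0; apply: eq_forallb => u.
rewrite implyTb sum_nat_eq0; apply: eq_forallb => v; rewrite implyTb (c_H hs) !hq.
rewrite -val_eqE /=.
by move: (H u v) (q (u, v)) (q (v, u)) (nat_of_ord u == v) inj => [] [] [] [] [].
Qed.

Definition npat q := #|[set phi : {ffun 'I_k -> 'I_n} | qsat H A q phi]|.

Variable inj : bool.
Hypothesis cert_code : forall q, qvalid H inj q -> exists2 c, c < cb ^ k &
  certv q (dg (fun=> cb) c).

Definition pos_part q := if qvalid H inj q && ~~ qodd H q then npat q else 0.
Definition neg_part q := if qvalid H inj q && qodd H q then npat q else 0.

Definition fresh_from t b := forall i, b * k.+1 * n.+1 ^ k <= i -> t 26 i = 0 /\ t 25 i = 0.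

Definition main_arrays := [:: 15; 17; 18; 19; 20; 21; 22; 23; 24; 25; 26; 27; 28; 29].

Record main_inv b (s t : store) : Prop := {
  mi_keep : agree (fun x => x \notin main_arrays) t s;
  mi_pos : t 28 0 = \sum_(c < b) pos_part (qof c);
  mi_neg : t 29 0 = \sum_(c < b) neg_part (qof c);
  mi_fresh : fresh_from t b
}.

Lemma npat_le q : npat q <= n.+1 ^ k.
Proof.
apply: leq_trans (max_card _) _; rewrite card_ffun !card_ord.
by case: (k) => // k'; rewrite leq_exp2r.
Qed.

Lemma main_step s t b : ctx s -> b < 2 ^ (k * k) -> main_inv b s t ->
  main_inv b.+1 s (run (p_pattern inj) [:: b] t).
Proof.
move=> hs hb [h1 h2 h3 h4].
have ht : ctx t by apply: ctx_sub h1 hs.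
pose t1 := run p_bits [:: b] t; set q := qof b.
have e1 x i : x != 15 -> t1 x i = t x i by move=> hx; apply: run_frame; rewrite inE.
have ht1 : ctx t1 by apply: ctx_run.
have hq : has_bits q t1 by apply: run_bits.
have bE : (ev t1 (not_ (badq_ inj)) [:: b] != 0) = qvalid H inj q.
  by rewrite not_ev (ev_badq _ _ ht1 hq); case: qvalid.
have runE : run (p_pattern inj) [:: b] t = if ev t1 (not_ (badq_ inj)) [:: b] != 0
  then run p_sign [:: b] (run p_eval [:: b] (run p_tables [:: b] (run p_search [:: b] t1)))
  else t1 by [].
rewrite runE bE; case: ifP => hv; last first.
  split.
  - by move=> x i hx; rewrite e1 ?h1 //; apply: contraNneq hx => ->.
  - by rewrite e1 // h2 big_ord_recr /= /pos_part -/q hv addn0.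
  - by rewrite e1 // h3 big_ord_recr /= /neg_part -/q hv addn0.
  - move=> i hi; rewrite !e1 //; apply: h4; apply: leq_trans hi.
    by rewrite !leq_mul2r leqnSn !orbT.
have [c0 hc0 hcv] := cert_code hv.
have [k1 k2 k3 k4] := run_search b ht1 hq hc0 hcv; set t2 := run p_search _ t1 in k1 k2 k3 k4 *.
have ht2 : ctx t2 by apply: ctx_run.
have hq2 : has_bits q t2 by move=> u v; rewrite k4.
have tb := run_tables b ht2 hq2; set t3 := run p_tables _ t2 in tb *.
have ht3 : ctx t3 by apply: ctx_run.
have e3 x i : x \notin [:: 20; 21; 22] -> t3 x i = t2 x i.
  by move=> hx; apply: run_frame; apply: contraNN hx; rewrite /= !inE; case/or3P => ->;
    rewrite ?orbT.
have hq3 : has_bits q t3 by move=> u v; rewrite e3.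
have e17 v : t3 17 v = t2 17 v by rewrite e3.
have hc3 : certv q (t3 17) by rewrite (@eq_certv q (t3 17) (t2 17)).
have hcb3 v : v < k -> t3 17 v < cb by rewrite e17; apply: k3.
have fr3 : fresh t3 b by move=> i hi; rewrite !e3 // !k4 // !e1 //; apply: h4.
have [m1 m2 m3] := run_eval ht3 hq3 hc3 hcb3 tb (fun _ _ _ => erefl) fr3.
set t4 := run p_eval _ t3 in m1 m2 m3 *.
have ht4 : ctx t4 by apply: ctx_sub m1 ht3.
have hq4 : has_bits q t4 by move=> u v; rewrite m1.
have e4 x i : x \notin main_arrays -> t4 x i = s x i.
  move=> hx; have [n15 nw ns nt] : [/\ x != 15, x \notin work_arrays, x \notin [:: 17; 18;
    19] & x \notin [:: 20; 21; 22]].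
    by move: hx; rewrite !inE !negb_or; do ! case/andP => ?; move=> *; split;
      do ? [apply/andP; split] => //.
  by rewrite m1 // e3 // k4 // e1 // h1.
have e28 : t4 28 0 = t 28 0 by rewrite m1 // e3 // k4 // e1.
have e29 : t4 29 0 = t 29 0 by rewrite m1 // e3 // k4 // e1.
have keyE : ev t4 (key_ (Cst 0) (Cst 0)) [:: b] = key b 0 0.
  by rewrite /= (c_k ht4) (c_M ht4) addn1 /key /M.
have runS : run p_sign [:: b] t4 = if ev t4 sgn_ [:: b] %% 2 != 0
  then update t4 29 0 (minn (t4 29 0 + t4 26 (ev t4 (key_ (Cst 0) (Cst 0)) [:: b])) (t4 30 0))
  else update t4 28 0 (minn (t4 28 0 + t4 26 (ev t4 (key_ (Cst 0) (Cst 0)) [::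
    b])) (t4 30 0)) by [].
rewrite runS keyE m2 -/(npat q) (ev_sgn b ht4 hq4) (c_MM ht4) e28 e29 h2 h3.
(* The sums are at most the number of patterns times the number of maps, so the minimum is
   inactive. *)
have bnd (F : {ffun 'I_k * 'I_k -> bool} -> nat) : (forall q', F q' <= npat q') ->
    F q = npat q ->
    minn (\sum_(c < b) F (qof c) + npat q) (2 ^ (k * k) * n.+1 ^ k) = \sum_(c < b.+1) F (qof c).
  move=> hF hFq; rewrite big_ord_recr /= -/q hFq; apply/minn_idPl.
  rewrite -hFq; have -> : \sum_(c < b) F (qof c) + F q = \sum_(c < b.+1) F (qof c) by rewrite
    big_ord_recr.
  apply: leq_trans (_ : b.+1 * n.+1 ^ k <= _); last by rewrite leq_mul2r hb orbT.
  apply: (@sum_le_const _ (fun c => F (qof c))) => c _.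
  exact: leq_trans (hF _) (npat_le _).
have posle q' : pos_part q' <= npat q' by rewrite /pos_part; case: ifP.
have negle q' : neg_part q' <= npat q' by rewrite /neg_part; case: ifP.
have oE : (#|qeq H q| %% 2 != 0) = odd #|qeq H q| by rewrite modn2; case: odd.
rewrite oE; case: ifP => ho.
  have pq : pos_part q = 0 by rewrite /pos_part /qodd ho andbF.
  have nq : neg_part q = npat q by rewrite /neg_part /qodd ho hv.
  split.
  - by move=> x i hx; rewrite upd_arr ?e4 //; apply: contraNneq hx => ->.
  - by rewrite upd_arr // e28 h2 big_ord_recr /= -/q pq addn0.
  - by rewrite upd_same bnd.
  - by move=> i hi; rewrite !upd_arr //; apply: m3.
have pq : pos_part q = npat q by rewrite /pos_part /qodd ho hv.
have nq : neg_part q = 0 by rewrite /neg_part /qodd ho andbF.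
split.
- by move=> x i hx; rewrite upd_arr ?e4 //; apply: contraNneq hx => ->.
- by rewrite upd_same bnd.
- by rewrite upd_arr // e29 h3 big_ord_recr /= -/q nq addn0.
- by move=> i hi; rewrite !upd_arr //; apply: m3.
Qed.

Lemma qof_surj (q : {ffun 'I_k * 'I_k -> bool}) : exists2 c, c < 2 ^ (k * k) & qof c = q.
Proof.
case: (posnP k) => k0.
  exists 0; first by rewrite expn_gt0.
  by apply/ffunP => -[u v]; have := ltn_ord u; rewrite {2}k0.
pose o i : 'I_k := Ordinal (ltn_pmod i k0).
pose g i := q (o (i %/ k), o i) : nat.
have [|c hc hd] := @dg_surj (fun=> 2) g (k * k); first by move=> v _; rewrite /g; case: (q _).
exists c; first by move: hc; rewrite prod_nat_const card_ord.
apply/ffunP => -[u v]; rewrite ffunE /= hd ?cell_lt // /g.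
have -> : o ((u * k + v) %/ k) = u.
  by apply: val_inj; rewrite /= divnMDl // (divn_small (ltn_ord v)) addn0 modn_small.
have -> : o (u * k + v) = v by apply: val_inj; rewrite /= modnMDl modn_small.
by case: (q _).
Qed.

Lemma sum_qof (F : {ffun 'I_k * 'I_k -> bool} -> nat) :
  \sum_(c < 2 ^ (k * k)) F (qof c) = \sum_q F q.
Proof.
have ex q : exists c, c < 2 ^ (k * k) /\ qof c = q.
  by have [c h1 h2] := qof_surj q; exists c.
have [code hcode] := fin_all_exists ex.
apply: (sum_codes (code := code) (F := fun c => F (qof c))).
- by rewrite card_ffun card_bool card_prod card_ord.
- by move=> q q' e; have [_ <-] := hcode q; have [_ <-] := hcode q'; rewrite e.
- by move=> q; case: (hcode q).
- by move=> q; case: (hcode q) => _ ->.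
Qed.

Lemma run_main s : ctx s -> (forall x i, x \in main_arrays -> s x i = 0) ->
  let t := run (p_main inj) [::] s in
  agree (fun x => x \notin main_arrays) t s /\
  t 28 0 = t 29 0 + #|[set phi | qgood H G inj phi]|.
Proof.
move=> hs hz; pose st i := forst (p_pattern inj) [::] s i.
have inv i : i <= 2 ^ (k * k) -> main_inv i s (st i).
  elim: i => [|i IH] hi; last by apply: main_step => //; apply: IH; apply: ltnW.
  by rewrite -[st 0]/s; split=> //; rewrite ?big_ord0 ?hz // => i _; rewrite !hz.
have runE : run (p_main inj) [::] s = st (2 ^ (k * k)).
  by rewrite /p_main run_For /= (c_KQ hs).
move=> t; rewrite (runE : t = _) {t}; have [h1 -> -> _] := inv _ (leqnn _); split=> //.
rewrite !sum_qof /pos_part /neg_part -!big_mkcond /=.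
exact: inclusion_exclusion (or_orient (c_or hs)) inj.
Qed.

Lemma ev_aut s : ctx s -> s 14 0 = k ^ k -> ev s aut_ [::] = #|automorphisms H|.
Proof.
move=> hs h14; rewrite -sum1_card [RHS]big_mkcond.
pose F c : nat := [forall u : 'I_k, forall v : 'I_k,
   ((u != v) ==> (dg (fun=> k) c u != dg (fun=> k) c v)) &&
   (s 1 (u * k + v) == s 1 (dg (fun=> k) c u * k + dg (fun=> k) c v))].
have -> : ev s aut_ [::] = \sum_(c < k ^ k) F c.
  rewrite /= h14 (c_k hs); apply: eq_bigr => c _; rewrite /F; congr nat_of_bool.
  rewrite sum_nat_eq0; apply: eq_forallb => u; rewrite implyTb sum_nat_eq0.
  apply: eq_forallb => v; rewrite implyTb -!/(dg (fun=> k) c _) -val_eqE /=.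
  rewrite addn_eq0; congr (_ && _); last by case: (s 1 _ == s 1 _).
  by move: (nat_of_ord u == v) (dg _ _ u == dg _ _ v) => [] [].
have ex (f : {ffun 'I_k -> 'I_k}) : exists c, c < k ^ k /\ forall v : 'I_k,
  dg (fun=> k) c v = f v.
  have [|c h1 h2] := @dg_surj (fun=> k) (fun v => if insub v is Some o then f o : nat else 0) k.
    by move=> v hv; case: insubP => [o _ _|]; [exact: ltn_ord | rewrite hv].
  exists c; split; first by move: h1; rewrite prod_nat_const card_ord.
  by move=> v; rewrite h2 // valK.
have [code hcode] := fin_all_exists ex.
apply: (sum_codes (code := code)).
- by rewrite card_ffun card_ord.
- move=> f f' e; apply/ffunP => v; apply: val_inj.
  by have [_ h] := hcode f; have [_ h'] := hcode f'; rewrite /= -h -h' e.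
- by move=> f; case: (hcode f).
move=> f; have [_ h] := hcode f; rewrite /F inE.
set b1 := [forall _, _]; set b2 := [forall _, _]; suff -> : b1 = b2 by case: b2.
apply: eq_forallb => u; apply: eq_forallb => v; rewrite !h !(c_H hs) -val_eqE.
by congr (_ && _); case: (H u v); case: (H _ _).
Qed.

End Patterns.

(** * Running time *)

Section CertificateCodes.
Variables (k n : nat).

Lemma cert_to_code (q : {ffun 'I_k * 'I_k -> bool}) lab rt dep w D0 :
  cert_ok (fun u v => q (u, v)) lab rt dep -> width lab rt w ->
  exists c, [/\ c < cb k ^ k, certv q (dg (fun=> cb k) c) &
    tot k n (dg (fun=> cb k) c) D0 <= k.+1 * (maxn 1 n ^ w * (k * D0.+1).+1 ^ k)].
Proof.
move=> [h1 h2 h3 h4] hw.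
pose x (v : 'I_k) := (dep v * k.+1 + lab v) * 2 + rt v.
have xlt v : x v < cb k.
  rewrite /x /cb; have := h1 v; have := h2 v; case: (rt v) => /= *; nia.
have [|c hc hd] := @dg_surj (fun=> cb k) (fun v => if insub v is Some o then x o else 0) k.
  by move=> v hv; case: insubP => [o _ _|]; [exact: xlt | rewrite hv].
have dE (v : 'I_k) : dg (fun=> cb k) c v = x v by rewrite hd // valK.
have x2 v : x v %/ 2 = dep v * k.+1 + lab v.
  by rewrite /x divnMDl // divn_small ?addn0 //; case: (rt v).
have lE (v : 'I_k) : labc k (dg (fun=> cb k) c v) = lab v.
  by rewrite /labc dE x2 modnMDl modn_small // ltnS.
have pE (v : 'I_k) : depc k (dg (fun=> cb k) c v) = dep v.
  by rewrite /depc dE x2 divnMDl // divn_small ?addn0 // ltnS.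
have rE (v : 'I_k) : rtc (dg (fun=> cb k) c v) = rt v.
  by rewrite /rtc dE /x modnMDl; case: (rt v).
exists c; split; first by move: hc; rewrite prod_nat_const card_ord.
  apply/andP; split; apply/forallP => u.
    apply/forallP => v; apply/implyP => huv; rewrite !lE.
    by case: (h3 u v huv) => ->; rewrite eqxx ?orbT.
  rewrite rE; case: (h4 u) => [->//|[v [a1 a2 a3]]]; apply/orP; right.
  by apply/existsP; exists v; rewrite a1 !lE a2 eqxx !pE.
apply: (@sum_le_const _ (fun g => \prod_(v < k) if isrt k (dg (fun=> cb k) c) g v then n else
  k * D0.+1)) => g _.
set cd := dg _ c; set N := maxn 1 n; set E := (k * D0.+1).+1.
(* Every vertex is charged [E] and a root [N] in addition; the exponent of [N] is then the number of
   roots of label [g]. The maximum in [N] keeps the bound monotone in this exponent when [n = 0]. *)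
apply: (@leq_trans (\prod_(v < k) (N ^ isrt k cd g v * E))).
  apply: leq_prod => v _; case: isrt; rewrite ?expn1 ?expn0 ?mul1n /E; last by lia.
  have : n <= N by rewrite leq_maxr.
  nia.
rewrite big_split /= prod_nat_const card_ord leq_mul2r; apply/orP; right.
rewrite -expn_sum; apply: leq_pexp2l; first by rewrite leq_maxl.
apply: leq_trans (hw g); rewrite -sum1dep_card [X in _ <= X]big_mkcond.
by apply: leq_sum => v _; rewrite /isrt rE lE; case: ifP.
Qed.

Lemma cert_code_width (H : sgraph k) inj (q : {ffun 'I_k * 'I_k -> bool}) (M : sgraph k) D0 :
  qvalid H inj q -> complete_multipartite M -> edges M \subset edges H ->
  let e := #|edges H :\: edges M| in
  exists c, [/\ c < cb k ^ k, certv q (dg (fun=> cb k) c) &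
    tot k n (dg (fun=> cb k) c) D0 <=
      k.+1 * (maxn 1 n ^ (if e == 0 then 1 else e %/ 4 + 2) * (k * D0.+1).+1 ^ k)].
Proof.
(* The decomposition starts from a vertex, hence the empty pattern is treated apart. *)
move=> hq hM hs e; case: (posnP k) => k0.
  have no (v : 'I_k) : False by have := ltn_ord v; rewrite {2}k0.
  exists 0; split; first by rewrite expn_gt0 /cb.
    by apply/andP; split; apply/forallP => v; case: (no v).
  apply: (@sum_le_const _ (fun g => \prod_(v < k) if isrt k (dg (fun=> cb k) 0) g v then n
    else k * D0.+1)) => g _.
  rewrite big1; last by move=> v; case: (no v).
  by rewrite muln_gt0 !expn_gt0 leq_maxl.
have [lab [rt [dep [h1 h2]]]] := pattern_cert hq (Ordinal k0) hM hs erefl.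
exact: cert_to_code h1 h2.
Qed.

End CertificateCodes.

Lemma typed_forst K Z sty p te env ty0 s i L : 2 <= K -> K <= Z -> typed K Z sty s ->
  (forall j, j < i -> tenv K Z (rcons te ty0) (rcons env j)) ->
  typ sty (rcons te ty0) p = Some L -> typed K Z sty (forst p env s i).
Proof.
move=> h1 h2 hs hE hp; apply: (@iteri_inv _ (fun _ => typed K Z sty)) => // j y hj hy.
by have [] := typ_sound h1 h2 hy (hE j hj) hp.
Qed.

Section Cost.
Variables (k n d : nat) (H : sgraph k) (G : sgraph n) (A : rel 'I_n).
Variables (inj : bool) (K Z T0 : nat).
Hypotheses (K2 : 2 <= K) (KZ : K <= Z) (kK : k.+1 <= K) (bK : 2 ^ (k * k) <= K).
Hypothesis cert_cost : forall (q : {ffun 'I_k * 'I_k -> bool}) D0,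
  D0 <= 4 * d -> qvalid H inj q ->
  exists c, [/\ c < cb k ^ k, certv q (dg (fun=> cb k) c) &
    tot k n (dg (fun=> cb k) c) D0 <= T0].

Lemma cert_code (q : {ffun 'I_k * 'I_k -> bool}) : qvalid H inj q -> exists2 c, c < cb k ^ k &
  certv q (dg (fun=> cb k) c).
Proof. by move=> hq; have [c [h1 h2 _]] := cert_cost (leq0n _) hq; exists c. Qed.

Lemma tenv1 b : b <= K -> tenv K Z [:: Sm 1] [:: b].
Proof. by move=> hb; split=> // -[|l] /=; rewrite ?nth_nil ?expn1. Qed.

Lemma tenv2 b g : b <= K -> g <= K -> tenv K Z [:: Sm 1; Sm 1] [:: b; g].
Proof. by move=> hb hg; split=> // -[|[|l]] /=; rewrite ?nth_nil ?expn1. Qed.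

(** The loop over candidates is not small, so [wop] cannot bound it. It bounds one run of [p_task]
    instead, and the numbers of candidates add up to [tot]. *)
Lemma wk_eval s0 t (q : {ffun 'I_k * 'I_k -> bool}) b :
  b < 2 ^ (k * k) -> ctx d H G A s0 -> typed K Z sty1 t ->
  tables n q s0 -> (forall x i, t x i = s0 x i) -> tot k n (s0 17) (s0 11 0) <= T0 ->
  wk p_eval [:: b] t <= 30 * K + T0 * K ^ 48.
Proof.
move=> hb hs0 ht htb hts htot.
have hc : ctx d H G A t by apply: ctx_agree hs0 => x i _; rewrite hts.
have bK' : b <= K by apply: leq_trans bK; apply: ltnW.
rewrite /p_eval wk_For.
have -> : ev t (Bin OAdd k_ (Cst 1)) [:: b] = k.+1 by rewrite /= (c_k hc) addn1.
have -> : wke t (Bin OAdd k_ (Cst 1)) [:: b] = 4 by [].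
set st := fun i => forst (For (Arr 22 g_) p_task) [:: b] t i.
have st_ty i : i <= k.+1 -> typed K Z sty1 (st i).
  move=> hi; apply: (typed_forst (te := [:: Sm 1]) (ty0 := Sm 1) (L := 61) K2 KZ ht);
    last by vm_compute.
  by move=> j hj; apply: tenv2 => //; apply: leq_trans kK; lia.
have st_fr i x j : x \notin work_arrays -> st i x j = s0 x j.
  move=> hx; rewrite /st forst_frame ?hts //; apply: contraNN hx.
  by apply: (allP (_ : all (mem work_arrays) _)).
have step (i : 'I_k.+1) : 2 + wk (For (Arr 22 g_) p_task) [:: b; nat_of_ord i] (st i) <=
    10 + lim k n s0 (k - i) * K ^ 48.
  have ki : nat_of_ord i <= k by rewrite -ltnS.
  have hti := st_ty i (ltnW (ltn_ord i)).
  rewrite wk_For.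
  have k4 : st i 4 0 = k by rewrite st_fr // (c_k hs0).
  have -> : ev (st i) (Arr 22 g_) [:: b; nat_of_ord i] = lim k n s0 (k - i).
    by rewrite /= k4 st_fr // (t_lim htb) // leq_subr.
  have -> : wke (st i) (Arr 22 g_) [:: b; nat_of_ord i] = 5 by [].
  set X := \sum_(_ < _) _; suff : X <= lim k n s0 (k - i) * K ^ 48 by lia.
  have envc c : c <= lim k n s0 (k - i) -> tenv K Z [:: Sm 1; Sm 1; Bg 25] [:: b;
    nat_of_ord i; c].
    move=> hcl; apply: (@tenv_rcons K Z [:: Sm 1; Sm 1] [:: b; nat_of_ord i] (Bg 25) c).
      by apply: tenv2 => //; apply: leq_trans kK; lia.
    apply: leq_trans hcl _; have := hti 22 (k - i).
    by rewrite st_fr // (t_lim htb) // leq_subr.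
  apply: (@sum_le_const _ (fun c => 2 + wk p_task [:: b; nat_of_ord i; c] (forst p_task [::
    b; nat_of_ord i] (st i) c))) => c hcl.
  apply: (@leq_trans (K ^ 1 + K ^ 47)); last by apply: (addK K2) => //; apply: (leK K2).
  apply: leq_add; first by rewrite expn1.
  have tyc : typed K Z sty1 (forst p_task [:: b; nat_of_ord i] (st i) c).
    apply: (typed_forst (te := [:: Sm 1; Sm 1]) (ty0 := Bg 25) (L := 61) K2 KZ hti);
      last by vm_compute.
    by move=> j hj; apply: envc; lia.
  (* 47 and 61 are what [wop] and [typ] compute for [p_task]. *)
  apply: leq_trans (wop_sound K2 KZ (p := p_task) (te := [:: Sm 1; Sm 1; Bg 25]) (w :=
    47) (L := 61) tyc (envc c (ltnW hcl)) _ _) _.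
  - by vm_compute.
  - by vm_compute.
  by [].
have totE : \sum_(i < k.+1) lim k n s0 (k - i) = tot k n (s0 17) (s0 11 0).
  rewrite /tot (reindex_inj rev_ord_inj) /=; apply: eq_bigr => i _.
  by rewrite subSS subKn // -ltnS.
have rhsE : \sum_(i < k.+1) (10 + lim k n s0 (k - i) * K ^ 48) =
    k.+1 * 10 + tot k n (s0 17) (s0 11 0) * K ^ 48.
  by rewrite big_split -big_distrl sum_nat_const card_ord totE.
have hX : \sum_(i < k.+1) (2 + wk (For (Arr 22 g_) p_task) [:: b; nat_of_ord i] (st i)) <=
    \sum_(i < k.+1) (10 + lim k n s0 (k - i) * K ^ 48).
  by apply: leq_sum => i _; apply: step.
have := leq_mul htot (leqnn (K ^ 48)).
move: hX; rewrite rhsE {rhsE step st_ty st_fr totE}; move: (tot _ _ _ _ * _) (T0 * _) => Y Y'.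
rewrite /st; move: (\sum_(_ < _) _) => X; move: kK K2; clear; lia.
Qed.

Lemma wk_pattern t b : b < 2 ^ (k * k) -> ctx d H G A t -> typed K Z sty1 t ->
  wk (p_pattern inj) [:: b] t <= K ^ 50 + T0 * K ^ 48.
Proof.
move=> hb ht hty.
have hE : tenv K Z [:: Sm 1] [:: b] by apply: tenv1; apply: leq_trans (ltnW hb) bK.
have stp p L s : typ sty1 [:: Sm 1] p = Some L -> typed K Z sty1 s ->
    typed K Z sty1 (run p [:: b] s).
  by move=> hp hs; have [] := typ_sound K2 KZ hs hE hp.
(* 38 is the exponent of [p_search], the most expensive among the parts whose loops are all
   small. *)
have cst p L w s : typ sty1 [:: Sm 1] p = Some L -> wop sty1 [:: Sm 1] p = Some w ->
    w <= 38 -> typed K Z sty1 s -> wk p [:: b] s <= K ^ 38.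
  move=> h1 h2 h3 hs; apply: leq_trans _ (leK K2 KZ h3).
  exact: (wop_sound K2 KZ hs hE h1 h2).
have c0 : wk p_bits [:: b] t <= K ^ 38 by apply: (cst _ 4 16).
set t1 := run p_bits [:: b] t.
have ty1 : typed K Z sty1 t1 by apply: (stp _ 4).
have ht1 : ctx d H G A t1 by apply: ctx_run.
have hq : has_bits (qof k b) t1 by apply: run_bits ht.
have c1 : wke t1 (not_ (badq_ inj)) [:: b] <= K ^ 38.
  apply: leq_trans _ (leK K2 KZ (_ : 24 <= 38)) => //.
  by apply: (woe_sound K2 KZ ty1 hE); case: (inj).
have hK := K2; have hK38 : 31 * K ^ 1 <= K ^ 38.
  rewrite (_ : 38 = 37 + 1) // expnD leq_mul2r; apply/orP; right.
  by apply: leq_trans _ (leK K2 KZ (_ : 5 <= 37)) => //; apply: (@leq_trans (2 ^ 5)) => //;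
    rewrite leq_exp2r.
have fin X : X <= 7 * K ^ 38 + T0 * K ^ 48 -> X <= K ^ 50 + T0 * K ^ 48.
  move=> hX; apply: leq_trans hX _; rewrite leq_add2r.
  rewrite (_ : 50 = 12 + 38) // expnD leq_mul2r; apply/orP; right.
  by apply: leq_trans _ (leK K2 KZ (_ : 3 <= 12)) => //; apply: (@leq_trans (2 ^ 3)) => //;
    rewrite leq_exp2r.
apply: fin.
have -> : wk (p_pattern inj) [:: b] t = wk p_bits [:: b] t +
   (1 + wke t1 (not_ (badq_ inj)) [:: b] + if ev t1 (not_ (badq_ inj)) [:: b] != 0 then
     wk p_search [:: b] t1 + (wk p_tables [:: b] (run p_search [:: b] t1) +
     (wk p_eval [:: b] (run p_tables [:: b] (run p_search [:: b] t1)) +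
      wk p_sign [:: b] (run p_eval [:: b] (run p_tables [:: b] (run p_search [:: b] t1)))))
     else 1) by [].
rewrite not_ev (ev_badq _ _ ht1 hq) eqb0 negbK.
case: ifP => hv; last first.
  move: c0 c1 hK38; rewrite expn1; move: (wk _ _ _) (wke _ _ _) (K ^ 38) (T0 * _) hK; clear; lia.
have hD : t1 11 0 <= 4 * d by exact: or_deg (c_or ht1).
have [c [hc hcv htot]] := cert_cost hD hv.
have [k1 k2 k3 k4] := run_search b ht1 hq hc hcv.
have cs : wk p_search [:: b] t1 <= K ^ 38 by apply: (cst _ 25 38).
set t2 := run p_search _ t1 in k1 k2 k3 k4 *.
have ty2 : typed K Z sty1 t2 by apply: (stp _ 25).
have ht2 : ctx d H G A t2 by apply: ctx_run.
have hq2 : has_bits (qof k b) t2 by move=> u v; rewrite k4.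
have tb := run_tables b ht2 hq2.
have ct : wk p_tables [:: b] t2 <= K ^ 38 by apply: (cst _ 5 27).
set t3 := run p_tables _ t2 in tb *.
have ty3 : typed K Z sty1 t3 by apply: (stp _ 5).
have ht3 : ctx d H G A t3 by apply: ctx_run.
have e3 x i : x \notin [:: 20; 21; 22] -> t3 x i = t2 x i.
  by move=> hx; apply: run_frame; apply: contraNN hx; apply: (allP (_ : all (mem [:: 20; 21;
    22]) _)).
have tot3 : tot k n (t3 17) (t3 11 0) <= T0.
  rewrite e3 // k4 //; apply: leq_trans htot; apply: leq_trans k2.
  rewrite /tot; apply/eq_leq/eq_bigr => g _; apply: eq_bigr => v _.
  by rewrite /isrt /rtc /labc !e3.
have ce := wk_eval hb ht3 ty3 tb (fun _ _ => erefl) tot3.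
have ty4 : typed K Z sty1 (run p_eval [:: b] t3) by apply: (stp _ 61) => //; vm_compute.
have cg : wk p_sign [:: b] (run p_eval [:: b] t3) <= K ^ 38 by apply: (cst _ 27 22).
move: c0 c1 cs ct ce cg hK38; rewrite expn1.
move: (wk p_bits _ _) (wke t1 _ _) (wk p_search _ _) (wk p_tables _ _) (wk p_eval _ _) (wk
  p_sign _ _).
move: (K ^ 38) (T0 * _) hK; clear; lia.
Qed.

Lemma wk_main s : ctx d H G A s -> typed K Z sty1 s ->
  (forall x i, x \in main_arrays -> s x i = 0) ->
  wk (p_main inj) [::] s <= K ^ 53 + T0 * K ^ 50.
Proof.
move=> hs hty hz; rewrite /p_main wk_For.
have -> : ev s (Arr 12 (Cst 0)) [::] = 2 ^ (k * k) by rewrite /= (c_KQ hs).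
have -> : wke s (Arr 12 (Cst 0)) [::] = 2 by [].
pose st i := forst (p_pattern inj) [::] s i.
have inv i : i <= 2 ^ (k * k) -> main_inv H A inj i s (st i).
  elim: i => [|i IH] hi; first by rewrite -[st 0]/s; split=> //;
    rewrite ?big_ord0 ?hz // => i _; rewrite !hz.
  by apply: (main_step cert_code hs) => //; apply: IH; apply: ltnW.
have tyst i : i <= 2 ^ (k * k) -> typed K Z sty1 (st i).
  move=> hi; apply: (typed_forst (te := [::]) (ty0 := Sm 1) (L := 61) K2 KZ hty);
    last by case: (inj); vm_compute.
  by move=> j hj; apply: tenv1; apply: leq_trans bK; apply: ltnW; apply: leq_trans hj hi.
have step (i : 'I_(2 ^ (k * k))) : 2 + wk (p_pattern inj) [::
  nat_of_ord i] (st i) <= K ^ 51 + T0 * K ^ 48.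
  have hi := ltn_ord i.
  have hci : ctx d H G A (st i) by apply: ctx_sub (mi_keep (inv i (ltnW hi))) hs.
  have := wk_pattern hi hci (tyst i (ltnW hi)).
  have : 2 + K ^ 50 <= K ^ 51.
    rewrite addnC; apply: (addK K2) => //.
    by apply: leq_trans _ (leK K2 KZ (_ : 1 <= 50)) => //; rewrite expn1.
  by move: (wk _ _ _) (K ^ 50) (K ^ 51) (T0 * _); clear; lia.
have hX : \sum_(i < 2 ^ (k * k)) (2 + wk (p_pattern inj) [:: nat_of_ord i] (st i)) <=
    2 ^ (k * k) * (K ^ 51 + T0 * K ^ 48) by apply:
      (@sum_le_const _ (fun i => 2 + wk (p_pattern inj) [:: i] (st i))) => i hi; exact:
        (step (Ordinal hi)).
have h2 : 2 ^ (k * k) * (K ^ 51 + T0 * K ^ 48) <= K ^ 52 + T0 * K ^ 49.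
  by rewrite (expnS K 51) (expnS K 48) (mulnCA T0) -mulnDr; apply: leq_mul.
have h3 : 4 + K ^ 52 <= K ^ 53.
  rewrite addnC; apply: (addK K2) => //.
  by apply: leq_trans _ (leK K2 KZ (_ : 2 <= 52)) => //; rewrite -[4]/(2 ^ 2) leq_exp2r.
have h4 : T0 * K ^ 49 <= T0 * K ^ 50 by rewrite leq_mul2l (leK K2 KZ (_ : 49 <= 50)) // orbT.
move: hX h2 h3 h4; rewrite /st; move: (\sum_(_ < _) _) => X.
move: (_ * (_ + _)) (K ^ 52) (K ^ 53) (T0 * K ^ 49) (T0 * K ^ 50); clear; lia.
Qed.

End Cost.

(** * The loaded input and the run of the whole program *)

Lemma nth_flatten_at T (x0 : T) (ss : seq (seq T)) r c : c < size (nth [::] ss r) ->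
  nth x0 (flatten ss) (sumn (take r (shape ss)) + c) = nth x0 (nth [::] ss r) c.
Proof.
move=> hc; have e : c < nth 0 (shape ss) r.
  rewrite (nth_map [::]) //; case: (ltnP r (size ss)) => // h.
  by move: hc; rewrite nth_default.
by rewrite nth_flatten -/(flatten_index _ r c) flatten_indexKl // flatten_indexKr.
Qed.

Lemma foldl_sumn s : foldl addn 0 s = sumn s.
Proof.
suff h x : foldl addn x s = x + sumn s by rewrite h.
by elim: s x => [|y s IH] x /=; rewrite ?addn0 // IH addnA.
Qed.

Lemma nth_enum_map m T (x0 : T) (F : 'I_m -> T) (v : 'I_m) :
  nth x0 [seq F w | w <- enum 'I_m] v = F v.
Proof. by rewrite (nth_map v) ?size_enum_ord // nth_ord_enum. Qed.

Section Input.
Variables (k n d : nat) (H : sgraph k) (G : sgraph n) (L : 'I_n -> seq 'I_n).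
Hypotheses (hG : orientable_within G d) (hL : adjacency_lists G L).

Lemma sumn_off v : v <= n -> sumn (take v [seq size (L u) | u <- enum 'I_n]) = off L v.
Proof.
elim: v => [|v IH] hv; first by rewrite take0 /off big_pred0 // => i; rewrite ltn0.
have hs : v < size [seq size (L u) | u <- enum 'I_n] by rewrite size_map size_enum_ord.
rewrite (take_nth 0 hs) sumn_rcons IH 1?ltnW //.
by rewrite (offS _ (Ordinal hv)) -(nth_enum_map 0 (fun u => size (L u)) (Ordinal hv)).
Qed.

Lemma off_le v : off L v <= 2 * d * n.
Proof.
apply: leq_trans (total_deg hG hL).
by rewrite /off [X in _ <= X](bigID (fun i : 'I_n => i < v)) leq_addr.
Qed.

Definition start := run (Put 4 (Cst 0) (Arr 0 (Cst 0))) [::] (load (encode H L)).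

Lemma start_other a i : a != 4 -> start a i = load (encode H L) a i.
Proof. by move=> h; rewrite /start /= upd_arr. Qed.

Lemma start_zero a i : 4 < a -> start a i = 0.
Proof.
move=> h; rewrite start_other; last by rewrite neq_ltn h orbT.
by rewrite /load; move: a h => [|[|[|[|[|a]]]]] //= _; rewrite ?nth_nil //; case: i.
Qed.

Lemma start_input : input H L start.
Proof.
split.
- by rewrite /start /= upd_same.
- by rewrite start_other.
- move=> u v; rewrite start_other // /load /=.
  rewrite (_ : u * k = sumn (take u (shape [seq [seq nat_of_bool (H u v) | v <- enum 'I_k] |
    u <- enum 'I_k]))).
    rewrite nth_flatten_at (nth_enum_map [::]) ?nth_enum_map //.
    by rewrite size_map size_enum_ord.
  rewrite /shape -map_comp.
  have -> : [seq (size \o (fun u : 'I_k => [seq nat_of_bool (H u v) | v <- enum 'I_k])) i | i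
    <- enum 'I_k] = nseq k k.
    rewrite (eq_map (_ : _ =1 fun=> k)) => [|x]; last by rewrite /= size_map size_enum_ord.
    by rewrite -[X in nseq X](size_enum_ord k); elim: (enum _) => //= x l ->.
  by rewrite take_nseq 1?ltnW // sumn_nseq mulnC.
- move=> v hv; rewrite start_other // -sumn_off //.
  by rewrite -[LHS]/(nth 0 (0 :: scanl _ _ _) v) nth_cons_scanl ?foldl_sumn // size_map
    size_enum_ord.
- move=> v j hj; rewrite start_other // /load /=.
  have e : nth [::] [seq [seq val w | w <- L v] | v <- enum 'I_n] v = [seq val w | w <- L v].
    exact: nth_enum_map.
  have -> : off L v = sumn (take v (shape [seq [seq val w | w <- L v] | v <- enum 'I_n])).
    rewrite -sumn_off; last exact: ltnW.
    congr (sumn (take _ _)); rewrite /shape -map_comp; apply: eq_map => u.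
    by rewrite /= size_map.
  by rewrite nth_flatten_at e // size_map.
Qed.

(** The offsets are bounded by the degree sum, which is at most [2 * d * n]. *)
Lemma start_le K a i : 2 <= K -> k <= K -> 2 * d <= K -> start a i <= n.+1 * K.
Proof.
move=> K2 kK dK; rewrite /start /=; case: (eqVneq a 4) => [->|ha].
  case: (eqVneq i 0) => [->|hi]; first by rewrite upd_same /load /=; nia.
  by rewrite upd_idx // /load /= nth_nil.
rewrite upd_arr // /load; set s := nth [::] _ _.
suff : {in s, forall x, x <= n.+1 * K}.
  by move=> h; case: (ltnP i (size s)) => hi; [apply: h; exact: mem_nth | rewrite nth_default].
rewrite /s; move: a ha {s} => [|[|[|[|a]]]] _ x /=.
- by rewrite !inE => /orP[] /eqP ->; nia.
- by case/allpairsP => -[u v] [_ _ ->] /=; case: (H u v) => /=; nia.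
- case/(nthP 0) => j; rewrite /= size_scanl size_map size_enum_ord ltnS => hj <-.
  have hs : j <= size [seq size (L u) | u <- enum 'I_n] by rewrite size_map size_enum_ord.
  rewrite (nth_cons_scanl _ _ hs) foldl_sumn sumn_off //.
  by apply: leq_trans (off_le _) _; nia.
- by case/flattenP => l /mapP[v _ ->] /mapP[w _ ->]; have := ltn_ord w; rewrite /=; nia.
- by rewrite nth_nil.
Qed.

End Input.

(** A typing bounds all cells of an array, whereas the values of arrays 11 to 14 are known in cell 0
    only. This test certifies that no other cell is ever written. *)
Fixpoint scalar (a : nat) (p : il) : bool :=
  match p with
  | Nop => true
  | Put b (Cst 0) _ => true
  | Put b _ _ => b != a
  | Sq p q | Ite _ p q => scalar a p && scalar a q
  | For _ p => scalar a p
  end.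

Lemma run_scalar a p : forall env s i, scalar a p -> i != 0 -> run p env s a i = s a i.
Proof.
move=> env s i hp hi; elim: p env s hp => [|b e1 e2|p IHp q IHq|e p IHp q IHq|e p IHp] env s //=.
- by case: e1 => [[|c]|l|b' e1|o e1 e1'|l e1|l e1] h;
  rewrite /update ?(negbTE hi) ?andbF // [a == b]eq_sym (negbTE h).
- by case/andP=> h1 h2; rewrite IHq ?IHp.
- by case/andP=> h1 h2; case: ifP; rewrite ?IHq ?IHp.
move=> h; apply: (@iteri_inv _ (fun _ (t : store) => t a i = s a i)) => // j t _ <-.
exact: IHp.
Qed.

Section Preparation.
Variables (k n d : nat) (H : sgraph k) (G : sgraph n) (L : 'I_n -> seq 'I_n).
Hypotheses (hG : orientable_within G d) (hL : adjacency_lists G L).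

Lemma setup_values s : input H L s -> let t := run p_setup [::] s in
  [/\ t 12 0 = 2 ^ (k * k), t 13 0 = (k.+1 * k.+1 * 2) ^ k, t 14 0 = k ^ k,
      t 31 0 = n.+1 ^ k & t 30 0 = 2 ^ (k * k) * n.+1 ^ k].
Proof.
move=> hs.
pose s1 := update s 12 0 (ev s (Prd (Bin OMul k_ k_) (Cst 2)) [::]).
pose s2 := update s1 13 0 (ev s1 (Prd k_ (Bin OMul (Bin OMul (Bin OAdd k_ (Cst 1)) (Bin OAdd
  k_ (Cst 1))) (Cst 2))) [::]).
pose s3 := update s2 14 0 (ev s2 (Prd k_ k_) [::]).
pose s4 := update s3 31 0 (ev s3 (Prd k_ (Bin OAdd n_ (Cst 1))) [::]).
move=> t; have -> : t = update s4 30 0 (s4 12 0 * s4 31 0) by [].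
have e1 : s1 12 0 = 2 ^ (k * k).
  by rewrite /s1 upd_same /= prod_nat_const card_ord (in_k hs).
have k1 : s1 4 0 = k by rewrite /s1 upd_arr // (in_k hs).
have e2 : s2 13 0 = (k.+1 * k.+1 * 2) ^ k.
  by rewrite /s2 upd_same /= prod_nat_const card_ord k1 addn1.
have k2 : s2 4 0 = k by rewrite /s2 upd_arr.
have e3 : s3 14 0 = k ^ k by rewrite /s3 upd_same /= prod_nat_const card_ord k2.
have k3 : s3 4 0 = k by rewrite /s3 upd_arr.
have n3 : s3 0 1 = n by rewrite /s3 /s2 /s1 !upd_arr // (in_n hs).
have e4 : s4 31 0 = n.+1 ^ k by rewrite /s4 upd_same /= prod_nat_const card_ord k3 n3 addn1.
have e5 : s4 12 0 = 2 ^ (k * k) by rewrite /s4 /s3 /s2 !upd_arr.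
by split; rewrite ?upd_same ?e5 ?e4 // upd_arr // /s4 ?upd_arr // /s3 ?upd_same // upd_arr.
Qed.

Definition prep : il := p_setup ;; p_peel ;; p_orient.
Let s0 := start H L.
Let s1 := run p_setup [::] s0.
Let s2 := run p_peel [::] s1.
Let s3 := run p_orient [::] s2.

Lemma run_prep : [/\ ctx d H G (arc G s2) s3, s3 14 0 = k ^ k,
  forall x i, x \in main_arrays -> s3 x i = 0 &
  wk p_peel [::] s1 + wk p_orient [::] s2 <=
    20 + 10 * n + (bitlen n * 300 + 200) * (n + 2 * d * n + 1)].
Proof.
have h0 : input H L s0 := start_input H L.
have [v12 v13 v14 v31 v30] := setup_values h0.
have z1 a i : 4 < a -> a \notin [:: 12; 13; 14; 30; 31] -> s1 a i = 0.
  move=> ha hx; have <- : s0 a i = 0 by apply: start_zero.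
  apply: run_frame; apply: contraNN hx.
  by apply: (allP (_ : all (mem [:: 12; 13; 14; 30; 31]) _)).
have h1 : input H L s1.
  by apply: input_agree h0 => a i ha; apply/esym/run_frame; move: a ha => [|[|[|[|[|]]]]].
have z5 (v : 'I_n) : s1 5 v = 0 by apply: z1.
have [p1 p2 p3 p4] := run_peel hG hL h1 z5; rewrite -/s2 in p1 p2 p3.
have h2 : input H L s2.
  by apply: input_agree h1 => a i ha; rewrite p1 //; move: a ha => [|[|[|[|[|]]]]].
have z2 a i : a \in [:: 8; 9; 10; 11] -> s2 a i = 0.
  by rewrite !inE => /or4P[] /eqP ->; rewrite p1 // z1.
have [q1 q2 q3] := run_orient hG hL h2 (fun v => arc_deg (p2 v) (p3 v)) z2; rewrite -/s3 in q1 q2.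
have h3 : input H L s3.
  by apply: input_agree h2 => a i ha; rewrite q1 //; move: a ha => [|[|[|[|[|]]]]].
have e a : a \in [:: 12; 13; 14; 30; 31] -> s3 a 0 = s1 a 0.
  by rewrite !inE => ha; rewrite q1 ?p1 //; move: ha;
    by case/or4P => [|||/orP[]] /eqP ->.
split.
- split; [exact: in_k h3|exact: in_n h3|exact: in_H h3|exact: q2|..]; by rewrite e.
- by rewrite e.
- have zm : all (fun x => [&& 4 < x, x \notin [:: 12; 13; 14; 30; 31],
      x \notin [:: 5; 6; 7] & x \notin [:: 8; 9; 10; 11]]) main_arrays by [].
  by move=> x i /(allP zm)/and4P[? ? ? ?]; rewrite q1 // p1 // z1.
- move: p4 q3; set P := wk _ _ _; set Q := wk _ _ _; set X := n + _ + 1.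
  by rewrite mulnDl mulnA => p4 q3; move: p4 q3; move: (bitlen n * 300 * X) (10 * n); clear;
    rewrite /= ; lia.
Qed.

End Preparation.

Section WholeRun.
Variables (k n d : nat) (H : sgraph k) (G : sgraph n) (L : 'I_n -> seq 'I_n).
Hypotheses (hG : orientable_within G d) (hL : adjacency_lists G L).
Variables (inj : bool) (K T0 : nat).
Hypotheses (K2 : 2 <= K) (kK : k.+1 <= K) (dK : 4 * d <= K) (bK : 2 ^ (k * k) <= K)
  (aK : k ^ k <= K) (cK : cb k ^ k <= K).
Hypothesis cert_cost : forall (q : {ffun 'I_k * 'I_k -> bool}) D0, D0 <= 4 * d ->
  qvalid H inj q -> exists c, [/\ c < cb k ^ k, certv q (dg (fun=> cb k) c) &
    tot k n (dg (fun=> cb k) c) D0 <= T0].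

Let Z := n.+1 * K.
Let KZ : K <= Z. Proof. by rewrite /Z leq_pmull. Qed.
(** 61 is the level that [typ] computes for [p_main], the largest among the phases. *)
Let V := Z ^ (K ^ 61).

Let s0 := start H L.
Let s1 := run p_setup [::] s0.
Let s2 := run p_peel [::] s1.
Let s3 := run p_orient [::] s2.
Let s4 := run (p_main inj) [::] s3.

Lemma start_typed : typed K Z sty0 s0.
Proof.
move=> a i; case: (ltnP 4 a) => ha; first by rewrite /s0 start_zero.
have hZ : s0 a i <= Z ^ (K ^ 1).
  apply: leq_trans (@start_le k n d H G L hG hL K a i K2 (ltnW kK) _) _; first by lia.
  by rewrite -/Z -{1}[Z]expn1; apply: (leZ K2 KZ); rewrite expn1; apply: ltnW.
move: a ha hZ => [|[|[|[|[|a]]]]] // _ _.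
rewrite /= /s0 /start /= expn1; case: (eqVneq i 0) => [->|hi].
  by rewrite upd_same /load /= ltnW.
by rewrite upd_idx // /load /= nth_nil.
Qed.

(** The passage from [sty0] to [sty1] is semantic: the contents of arrays 11 to 14 are known, and
    they are at most [K] by the choice of [K]. *)
Lemma prep_typed : typed K Z sty1 s3 /\ okp V prep [::] s0.
Proof.
have hE : tenv K Z [::] [::] by split=> // l; rewrite !nth_nil.
have [h1 h2] := typ_sound K2 KZ start_typed hE (erefl : typ sty0 [::] prep = Some 12).
split; last exact: h2.
have [hc h14 hz _] := run_prep H hG hL.
have v11 : s3 11 0 <= 4 * d := or_deg (c_or hc).
have v12 : s3 12 0 = _ := c_KQ hc.
have v13 : s3 13 0 = _ := c_KC hc.
have v14 : s3 14 0 = _ := h14.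
move=> a i; case ha: (a \in [:: 11; 12; 13; 14]); last first.
  by have := h1 a i; rewrite /sty1 ha.
rewrite /sty1 ha /= expn1; case: (eqVneq i 0) => [->|hi].
  move: ha; rewrite !inE => /or4P[] /eqP ->; rewrite ?v12 ?v13 ?v14 //.
  exact: leq_trans v11 dK.
rewrite -[s3]/(run prep [::] s0) run_scalar //; first last.
  by move: ha; rewrite !inE => /or4P[] /eqP ->.
by rewrite /s0 start_zero //; move: ha; rewrite !inE => /or4P[] /eqP ->.
Qed.

Lemma main_typed : typed K Z sty1 s4 /\ okp V (p_main inj) [::] s3.
Proof.
have hE : tenv K Z [::] [::] by split=> // l; rewrite !nth_nil.
have ht : typ sty1 [::] (p_main inj) = Some 61 by case: (inj); vm_compute.
by have [h1 h2] := typ_sound K2 KZ prep_typed.1 hE ht; split; [|exact: h2].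
Qed.

Lemma out_typed : typed K Z sty2 s4.
Proof.
move=> a i; have := main_typed.1 a i; rewrite /sty2; case: eqP => // ->.
by move=> h; apply: leq_trans h (bd_sub K2 KZ (_ : subty (Bg 1) (Bg 60))).
Qed.

Lemma okp_all : okp V (p_all inj) [::] (load (encode H L)).
Proof.
have hE : tenv K Z [::] [::] by split=> // l; rewrite !nth_nil.
have ho : okp V (p_out inj) [::] s4.
  case e: (inj); apply: (typ_sound K2 KZ out_typed hE (L := 26) _).2 => //; by vm_compute.
have [[h1 [h2 h3]] h4] := (prep_typed.2, main_typed.2).
split; last first.
  by split; [exact: h1|split; [exact: h2|split; [exact: h3|split; [exact: h4|exact: ho]]]].
split; first exact: leq0n.
split; first exact: leq0n.
rewrite -[X in X <= _]/(s0 0 0).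
apply: leq_trans (start_typed 0 0) (bd_lvl K2 KZ _).
by [].
Qed.

Lemma wk_all : wk (p_all inj) [::] (load (encode H L)) <=
  K ^ 54 + T0 * K ^ 50 + (20 + 10 * n + (bitlen n * 300 + 200) * (n + 2 * d * n + 1)).
Proof.
have hE : tenv K Z [::] [::] by split=> // l; rewrite !nth_nil.
have [hc h14 hz hw] := run_prep H hG hL.
have w1 : wk p_setup [::] s0 <= K ^ 14.
  exact: (wop_sound K2 KZ start_typed hE (L := 11)).
have w2 : wk (p_main inj) [::] s3 <= K ^ 53 + T0 * K ^ 50.
  exact: (wk_main K2 KZ kK bK cert_cost hc prep_typed.1).
have w3 : wk (p_out inj) [::] s4 <= K ^ 35.
  case: (inj); last apply: leq_trans _ (leK K2 KZ (_ : 5 <= 35)) => //.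
    by apply: (wop_sound K2 KZ out_typed hE (L := 26)); vm_compute.
  by apply: (wop_sound K2 KZ out_typed hE (L := 26)); vm_compute.
have -> : wk (p_all inj) [::] (load (encode H L)) =
  4 + (wk p_setup [::] s0 + (wk p_peel [::] s1 + (wk p_orient [::] s2 +
    (wk (p_main inj) [::] s3 + wk (p_out inj) [::] s4)))) by [].
have hK : 4 + K ^ 14 + K ^ 35 + K ^ 53 <= K ^ 54.
  rewrite (expnS K 53); have h : 4 + K ^ 14 + K ^ 35 <= K ^ 53.
    have : 4 + K ^ 14 <= K ^ 35.
      rewrite addnC; apply: leq_trans _ (leK K2 KZ (_ : 15 <= 35)) => //.
      apply: (addK K2 KZ) => //; apply: leq_trans _ (leK K2 KZ (_ : 2 <= 14)) => //.
      by rewrite -[4]/(2 ^ 2) leq_exp2r.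
    by move=> h; apply: leq_trans _ (leK K2 KZ (_ : 36 <= 53)) => //; apply: (addK K2 KZ).
  by apply: leq_trans (leq_mul K2 (leqnn _)); rewrite mul2n -addnn leq_add2r.
move: w1 w2 w3 hw hK; move: (wk p_setup _ _) (wk (p_main _) _ _) (wk (p_out _) _ _) (wk
  p_peel _ _) (wk p_orient _ _).
move: (K ^ 14) (K ^ 53) (K ^ 54) (K ^ 35) (T0 * _) (_ * (_ + 1)); clear; lia.
Qed.

Lemma run_all : run (p_all inj) [::] (load (encode H L)) 0 0 =
  if inj then sub H G else hom H G.
Proof.
have [hc h14 hz _] := run_prep H hG hL.
have [m1 m2] := run_main (cert_code cert_cost) hc hz.
rewrite -[LHS]/(run (p_out inj) [::] s4 0 0).
have hc4 : ctx d H G (arc G s2) s4 by apply: ctx_sub m1 hc.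
have h4 : s4 14 0 = k ^ k by rewrite [LHS]m1.
rewrite -/s4 in m2.
have oE : run (p_out inj) [::] s4 0 0 = if inj then (s4 28 0 - s4 29 0) %/ ev s4 aut_ [::]
  else s4 28 0 - s4 29 0 by case: (inj).
rewrite oE m2 addKn (ev_aut hc4 h4); case: (inj); last by rewrite hom_qgood.
by rewrite sub_aut mulnK // aut_gt0.
Qed.

End WholeRun.

(** * The computable factor and the final time bound *)

(** With [B = d + k + 2] and [K = B ^ (B ^ 4)], the factor to be covered is [K ^ 118]. Its exponent
    [118 * B ^ 4] is at most [B ^ 11], because [118 <= 2 ^ 7 <= B ^ 7]. *)
Definition tower (x y : nat) : nat := (x + y + 2) ^ ((x + y + 2) ^ 11).

Definition tower_prog : il :=
  let B := Bin OAdd (Bin OAdd (Arr 0 (Cst 0)) (Arr 0 (Cst 1))) (Cst 2) in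
  Put 0 (Cst 0) (Prd (Prd (Cst 11) B) B).

Lemma load_sim X : size X <= 4 -> sim [::] 0 (load X) [::] (load X).
Proof.
move=> hX; split=> //.
- move=> a i; rewrite /bump; case: leqP => // ha.
  by rewrite /load !nth_default ?nth_nil ?(leq_trans hX) // leqW.
Qed.

Lemma tower_computable : computable2 tower.
Proof.
exists (cmpi [::] 0 tower_prog) => x y; set s := load [:: [:: x; y]].
have hs : sim [::] 0 s [::] s by apply: load_sim.
have [T [m [hT hm _ _]]] := cmpi_exec tower_prog hs.
exists T; exists T, m; split=> //.
have -> : m 0 0 = run tower_prog [::] s 0 0 by rewrite -(sim_arr hm 0 0).
by rewrite /= upd_same !prod_nat_const !card_ord.
Qed.

(** Each of these quantities is at most a power of [B] with exponent [B ^ 2] or [1 + 4 * B]; both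
    are below [B ^ 4] since [B] is at least 2. *)
Lemma parameter_bounds d k B : 1 < B -> d < B -> k < B -> let K := B ^ (B ^ 4) in
  [/\ k.+1 <= K /\ 4 * d <= K, 2 ^ (k * k) <= K, k ^ k <= K, cb k ^ k <= K &
      k.+1 * (k * (4 * d).+1).+1 ^ k <= K].
Proof.
move=> B2 dB kB K; have B0 : 0 < B by exact: ltnW.
have mono i j : i <= j -> B ^ i <= B ^ j by apply: leq_pexp2l.
have toK i x : i <= B ^ 4 -> x <= B ^ i -> x <= K.
  by move=> h1 h2; apply: leq_trans h2 (mono _ _ h1).
have p2 : 4 <= B ^ 2 by rewrite -[4]/(2 ^ 2) leq_exp2r.
have e4 : B ^ 4 = B ^ 2 * B ^ 2 by rewrite -expnD.
have B4 : 4 * B ^ 2 <= B ^ 4 by rewrite e4 leq_mul2r p2 orbT.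
have BB : B * 2 <= B ^ 2 by rewrite expnS expn1 leq_mul2l B2 orbT.
have d4 : 4 * d.+1 <= B ^ 3.
  by rewrite (expnS B 2) mulnC; apply: leq_mul.
have pw a b i j : a <= B ^ i -> b <= j -> 0 < i -> a ^ b <= B ^ (i * j).
  move=> h1 h2 h3; rewrite expnM; apply: (@leq_trans ((B ^ i) ^ b)).
    by case: (b) => // b'; rewrite leq_exp2r.
  by apply: leq_pexp2l => //; rewrite expn_gt0 B0.
split.
- split; first by apply: (toK 1); rewrite ?expn1 //; lia.
  by apply: (toK 3); [lia | apply: leq_trans d4; rewrite leq_mul2l leqnSn].
- apply: (toK (1 * B ^ 2)); first by lia.
  by apply: pw => //; rewrite expnS expn1; apply: leq_mul; apply: ltnW.
- apply: (toK (1 * B)); first by lia.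
  by apply: pw; rewrite ?expn1 //; apply: ltnW.
- apply: (toK (3 * B)); first by lia.
  have hc : cb k <= B ^ 3 by rewrite /cb 2!expnS expn1 mulnA; do ! apply: leq_mul.
  exact: pw hc (ltnW kB) _.
apply: (toK (1 + 4 * B)); first by lia.
rewrite expnD expn1; apply: leq_mul => //; apply: pw => //; last exact: ltnW.
rewrite (expnS B 3); apply: (@leq_trans (k.+1 * (4 * d).+1)).
  by rewrite [k.+1 * _]mulSn addSn ltnS leq_addl.
apply: leq_mul; first exact: kB.
by apply: leq_trans d4; rewrite mulnS; move: (4 * d); clear; lia.
Qed.

(** 118 is 54 for the work, 62 for the bit length of [V], and 2 for the numerical constants, which
    [2 ^ 16 <= K] absorbs. One logarithm comes from the peeling rounds and one from the bit lengths,
    whence the 2 in [soft_bound]. *)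
Lemma total_time n d k w K V T : 1 <= w -> 2 ^ 16 <= K -> k.+1 <= K -> 4 * d <= K ->
  V = (n.+1 * K) ^ (K ^ 61) ->
  T <= cst * (K ^ 54 + K * maxn 1 n ^ w * K ^ 50 +
    (20 + 10 * n + (bitlen n * 300 + 200) * (n + 2 * d * n + 1))) * bitlen V ->
  T <= K ^ 118 * soft_bound 2 n d k w.
Proof.
have c532 : 532 <= 2 ^ 11 by vm_compute.
move=> w1 K16 kK dK VE hT; apply: leq_trans hT _.
set b := bitlen (n.+1 * d.+1 * k.+1).
have b0 : 0 < b by [].
have nb : bitlen n <= b by apply: leq_bitlen; rewrite -mulnA; apply: leq_trans (leqnSn n) _;
  rewrite leq_pmulr.
have n1b : bitlen n.+1 <= b by apply: leq_bitlen; rewrite -mulnA leq_pmulr.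
set N := maxn 1 n ^ w.
have N0 : 0 < N by rewrite expn_gt0 leq_maxl.
have nN : n <= N.
  apply: leq_trans (leq_maxr 1 n) _; rewrite -{1}[maxn 1 n]expn1.
  by apply: leq_pexp2l => //; rewrite leq_maxl.
have K0 : 0 < K by apply: leq_trans K16; rewrite expn_gt0.
have bV : bitlen V <= 2 * b * K ^ 62.
  have hZ : n.+1 * K < 2 ^ (b + K).
    rewrite expnD; apply: ltn_mul; last exact: ltn_expl.
    by apply: leq_trans (ltn_bitlen _) _; rewrite leq_exp2l.
  apply: (@leq_trans ((b + K) * K ^ 61)).
    apply: bitlen_min; first by rewrite muln_gt0 addn_gt0 b0 expn_gt0 K0.
    by rewrite VE expnM ltn_exp2r // expn_gt0 K0.
  rewrite (expnS K 61) mulnA leq_mul2r; apply/orP; right.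
  by rewrite -mulnA mul2n -addnn; apply: leq_add; rewrite (leq_pmulr, leq_pmull).
have K54 : K <= K ^ 54 by rewrite -{1}[K]expn1 leq_pexp2l.
have wb : K ^ 54 + K * N * K ^ 50 + (20 + 10 * n + (bitlen n * 300 + 200) * (n + 2 * d * n +
  1)) <=
    2 ^ 11 * (K ^ 54 * N * b).
  have i1 : K ^ 54 <= K ^ 54 * N * b by rewrite -mulnA leq_pmulr // muln_gt0 N0.
  have i2 : K * N * K ^ 50 <= K ^ 54 * N * b.
    rewrite mulnAC -expnS; apply: leq_trans (leq_pmulr _ b0); rewrite leq_mul2r.
    by apply/orP; right; apply: leq_pexp2l.
  have i3 : n + 2 * d * n + 1 <= N * K.
    have K4 : 4 <= K by apply: leq_trans K16; rewrite -[4]/(2 ^ 2) leq_exp2l.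
    apply: (@leq_trans (N * (2 * d + 2))); last by rewrite leq_mul2l; apply/orP; right; move:
      K4 dK; clear; lia.
    have := leq_mul nN (leqnn (2 * d)); rewrite mulnDr [n * _]mulnC.
    by move: nN N0; move: (2 * d * n) (N * (2 * d)); clear; lia.
  have i4 : 20 + 10 * n <= 30 * (N * b).
    have : N <= N * b by rewrite leq_pmulr.
    by move: nN; clear; lia.
  have i5 : (bitlen n * 300 + 200) * (n + 2 * d * n + 1) <= 500 * (b * (N * K)).
    by rewrite [in X in _ <= X]mulnA; apply: leq_mul => //; move: nb b0; clear; lia.
  have i6 : N * b <= K ^ 54 * N * b by rewrite -mulnA leq_pmull // expn_gt0 K0.
  have i7 : b * (N * K) <= K ^ 54 * N * b.
    by rewrite mulnC (mulnC N); apply: leq_mul => //; apply: leq_mul.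
  move: i1 i2 i4 i5 i6 i7 c532.
  move: (K ^ 54) (2 ^ 11) (_ * (_ + 1)) (b * _) (N * b) (K * _ * _) (K ^ 54 * _ * _).
  clear => A5 c A4 A3 A2 A1 X *; apply: (@leq_trans (532 * X)); last by rewrite leq_mul2r;
    apply/orP; right.
  lia.
apply: (@leq_trans (2 ^ 6 * (2 ^ 11 * (K ^ 54 * N * b)) * (2 * b * K ^ 62))).
  by apply: leq_mul => //; apply: leq_mul.
rewrite /soft_bound -/N -/b.
have -> : 2 ^ 6 * (2 ^ 11 * (K ^ 54 * N * b)) * (2 * b * K ^ 62) =
   (2 ^ 6 * 2 ^ 11 * 2) * (K ^ 54 * K ^ 62) * (N * (b * b)).
  move: (2 ^ 6) (2 ^ 11) (K ^ 54) (K ^ 62); clear; lia.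
have -> : K ^ 118 * (2 * k.+1 ^ 2 * N * b ^ 2) = K ^ 118 * (2 * k.+1 ^ 2) * (N * (b * b)).
  by rewrite (expnS b) expn1 !mulnA.
rewrite -(expnD K) leq_mul2r; apply/orP; right.
rewrite (_ : K ^ 118 = K ^ 2 * K ^ (54 + 62)); last by rewrite -expnD.
rewrite [X in _ <= X]mulnAC leq_mul2r; apply/orP; right.
apply: leq_trans (leq_pmulr _ _); last by rewrite muln_gt0 expn_gt0.
apply: (@leq_trans ((2 ^ 16) ^ 2)); last by rewrite leq_exp2r.
by rewrite -expnM -expnD mulnC -expnS leq_exp2l.
Qed.

Lemma bound_le_tower d k : ((d + k + 2) ^ ((d + k + 2) ^ 4)) ^ 118 <= tower d k.
Proof.
set B := d + k + 2; have B2 : 2 <= B by rewrite /B leq_addl.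
rewrite /tower -/B -expnM; apply: leq_pexp2l; first exact: ltnW.
rewrite (_ : B ^ 11 = B ^ 4 * B ^ 7); last by rewrite -expnD.
by rewrite leq_mul2l; apply/orP; right; apply: (@leq_trans (2 ^ 7)) => //; rewrite leq_exp2r.
Qed.

Lemma counting_time k n d (H : sgraph k) (G : sgraph n) (L : 'I_n -> seq 'I_n) inj w :
  orientable_within G d -> adjacency_lists G L -> 1 <= w ->
  (forall (q : {ffun 'I_k * 'I_k -> bool}) D0, qvalid H inj q ->
     exists c, [/\ c < cb k ^ k, certv q (dg (fun=> cb k) c) &
       tot k n (dg (fun=> cb k) c) D0 <= k.+1 * (maxn 1 n ^ w * (k * D0.+1).+1 ^ k)]) ->
  outputs_within (cmpi [::] 0 (p_all inj)) (encode H L)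
    (if inj then sub H G else hom H G) (tower d k * soft_bound 2 n d k w).
Proof.
move=> hG hL w1 hc; set B := d + k + 2; set K := B ^ (B ^ 4).
have B2 : 2 <= B by rewrite /B leq_addl.
have [dB kB] : d < B /\ k < B by rewrite /B; lia.
have K16 : 2 ^ 16 <= K.
  apply: (@leq_trans (2 ^ (B ^ 4))); last by rewrite leq_exp2r // expn_gt0 ltnW.
  by rewrite leq_exp2l // -[16]/(2 ^ 4) leq_exp2r.
have [[kK dK] bK aK cK tK] := parameter_bounds B2 dB kB.
have K2 : 2 <= K by apply: leq_trans K16; rewrite -{1}[2]expn1 leq_exp2l.
have cost (q : {ffun 'I_k * 'I_k -> bool}) D0 : D0 <= 4 * d -> qvalid H inj q ->
    exists c, [/\ c < cb k ^ k, certv q (dg (fun=> cb k) c) &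
      tot k n (dg (fun=> cb k) c) D0 <= K * maxn 1 n ^ w].
  move=> hD hq; have [c [h1 h2 h3]] := hc q D0 hq; exists c; split=> //.
  apply: leq_trans h3 _; rewrite mulnCA mulnC leq_mul2r; apply/orP; right.
  apply: leq_trans tK; rewrite leq_mul2l; case: (k) => // k'.
  by rewrite leq_exp2r // ltnS leq_mul2l ltnS hD orbT.
have hs : sim [::] 0 (load (encode H L)) [::] (load (encode H L)) by apply: load_sim.
have [T [m [hT hm _ hcost]]] := cmpi_exec (p_all inj) hs.
exists T, m; split=> //.
  rewrite -(run_all hG hL cost).
  by rewrite -(sim_arr hm 0 0).
apply: leq_trans (leq_mul (bound_le_tower d k) (leqnn _)).
apply: (total_time w1 K16 kK dK erefl).
apply: leq_trans (hcost _ _ (okp_all H hG hL inj K2 kK dK bK aK cK)) _.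
  have -> : 0 + dpi (p_all inj) + 4 = 27 by case: (inj).
  apply: (@leq_trans (2 ^ 5)); first by [].
  apply: (@leq_trans K); first by apply: leq_trans K16; rewrite leq_exp2l.
  apply: (@leq_trans (n.+1 * K)); first by rewrite leq_pmull.
  have K0 : 0 < K := ltnW K2.
  rewrite -{1}[n.+1 * K]expn1; apply: leq_pexp2l; first by rewrite muln_gt0.
  by rewrite expn_gt0 K0.
rewrite leq_mul2r; apply/orP; right; rewrite leq_mul2l; apply/orP; right.
exact: (wk_all hG hL K2 kK dK bK aK cK cost).
Qed.

Theorem theorem1p5 :
  exists f : nat -> nat -> nat, computable2 f /\
  exists (p_hom p_sub p_sub_plus : cmd) (c : nat),
  forall (k n d : nat) (H : sgraph k) (G : sgraph n) (L : 'I_n -> seq 'I_n),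
    degeneracy G d -> adjacency_lists G L ->
    (complete_multipartite H ->
       outputs_within p_hom (encode H L) (hom H G)
         (f d k * soft_bound c n d k 1) /\
       outputs_within p_sub (encode H L) (sub H G)
         (f d k * soft_bound c n d k 1)) /\
    (forall eps : nat, multipartite_plus eps H ->
       outputs_within p_sub_plus (encode H L) (sub H G)
         (f d k * soft_bound c n d k (eps %/ 4 + 2))).
Proof.
exists tower; split; first exact: tower_computable.
exists (cmpi [::] 0 (p_all false)), (cmpi [::] 0 (p_all true)), (cmpi [::] 0 (p_all true)), 2.
move=> k n d H G L [hG _] hL; split=> [hH|eps [M [hM hs he]]].
  split; apply: (counting_time (inj := _) hG hL) => // q D0 hq.
  (* Here [H] is its own multipartite subgraph: no edge is added and the width is 1. *)
  - have := cert_code_width n D0 hq hH (subxx _); by rewrite setDv cards0.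
  - have := cert_code_width n D0 hq hH (subxx _); by rewrite setDv cards0.
apply: (counting_time (inj := true) hG hL); first by rewrite addn2.
move=> q D0 hq; have [c [h1 h2 h3]] := cert_code_width n D0 hq hM hs.
exists c; split=> //; apply: leq_trans h3 _.
(* For [eps = 0] the width 1 is weakened to 2, the value of the stated exponent. *)
rewrite leq_mul2l leq_mul2r he; apply/orP; right; apply/orP; right.
by apply: leq_pexp2l; [rewrite leq_maxl | case: ifP; rewrite ?addn2].
Qed.
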